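(* Let $A$ be an $n\times n$ complex matrix, let $A_{\text{can}}=A_1\oplus A_2\oplus\dots\oplus A_t$ be its canonical matrix for congruence (summands ordered as described in the context), and let $S$ be a nonsingular matrix such that $S^TAS=A_{\text{can}}$. Then all matrices $A+E$ that are sufficiently close to $A$ can be simultaneously reduced by some transformation $$A+E\mapsto \mathcal S(E)^T(A+E)\,\mathcal S(E),\qquad \mathcal S(E)\ \text{nonsingular and holomorphic at zero},\ \mathcal S(0)=S, \qquad (\star)$$ to the form $A_{\text{can}}+\mathcal D$, in which $\mathcal D$ is a $(0,* )$ matrix whose stars represent entries that depend holomorphically on the entries of $E$, the number of stars in $\mathcal D$ is the minimal number that can be achieved by transformations of the form $(\star)$, and the blocks of $\mathcal D=[\mathcal D_{ij}]_{i,j=1}^t$ (partitioned conformably to $A_{\text{can}}$), with $\mathcal D(A_i):=\mathcal D_{ii}$ and $\mathcal D(A_i,A_j):=(\mathcal D_{ji},\mathcal D_{ij})$ for $i<j$, are as follows. (i) Diagonal blocks: $$\mathcal D(H_m(\lambda))=\begin{cases}\begin{bmatrix}0&0\\0^{SW}&0\end{bmatrix}&\text{if }\lambda\ne\pm1,\\[3mm] \begin{bmatrix}0^{NW,\mathrm{even}}&0\\0^{SW}&0^{SE,\mathrm{even}}\end{bmatrix}&\text{if }\lambda=1\ (\text{then } m \text{ is even}),\\[3mm] \begin{bmatrix}0^{NW,\mathrm{odd}}&0\\0^{SW}&0^{SE,\mathrm{odd}}\end{bmatrix}&\text{if }\lambda=-1\ (\text{then } m\text{ is odd}),\end{cases}$$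 where all blocks are $m\times m$; $$\mathcal D(\Gamma_n)=\begin{cases}0^{NW,\mathrm{odd}}&\text{if } n\text{ is even},\\ 0^{NW,\mathrm{even}}&\text{if } n\text{ is odd};\end{cases}\qquad \mathcal D(J_n(0))=0^{SW,\mathrm{odd}}.$$ (ii) Off-diagonal blocks for summands of the same type: $$\mathcal D(H_m(\lambda),H_n(\mu))=\begin{cases}(0,0)&\text{if }\lambda\ne\mu^{\pm1},\\[1mm] \left(\begin{bmatrix}0^{NW}&0\\0&0^{SE}\end{bmatrix},0\right)&\text{if }\lambda=\mu^{-1}\ne\pm1,\\[3mm] \left(\begin{bmatrix}0&0^{NE}\\0^{SW}&0\end{bmatrix},0\right)&\text{if }\lambda=\mu\ne\pm1,\\[3mm] \left(\begin{bmatrix}0^{NW}&0^{NE}\\0^{SW}&0^{SE}\end{bmatrix},0\right)&\text{if }\lambda=\mu=\pm1,\end{cases}$$ where the displayed blocks are $n\times m$; $$\mathcal D(\Gamma_m,\Gamma_n)=\begin{cases}(0,0)&\text{if } m-n\text{ is odd},\\(0^{NW},0)&\text{if } m-n\text{ is even};\end{cases}$$ $$\mathcal D(J_m(0),J_n(0))=\begin{cases}(0^{SW,\mathrm{odd}},\,0^{SW,\mathrm{odd}})&\text{if } m\ge n\text{ and } n\text{ is even},\\(0^{SW,\mathrm{odd}}+\mathcal P_{nm},\,0^{SW,\mathrm{odd}})&\text{if } m\ge n\text{ and } n\text{ is odd}.\end{cases}$$ (iii) Off-diagonal blocks for summands of different types: $$\mathcal D(H_m(\lambda),\Gamma_n)=\begin{cases}(0,0)&\text{if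 }\lambda\ne(-1)^{n+1},\\ ([\,0^{NW}\ \ 0^{NE}\,],\,0)&\text{if }\lambda=(-1)^{n+1},\end{cases}$$ where $0^{NW}$ and $0^{NE}$ are $n\times m$; $$\mathcal D(H_m(\lambda),J_n(0))=\begin{cases}(0,0)&\text{if } n\text{ is even},\\(0^{\updownarrow},0)&\text{if } n\text{ is odd};\end{cases}\qquad \mathcal D(\Gamma_m,J_n(0))=\begin{cases}(0,0)&\text{if } n\text{ is even},\\(0^{\updownarrow},0)&\text{if } n\text{ is odd}.\end{cases}$$
   Context: All matrices are complex. Square matrices $A,B$ are congruent if $B=S^TAS$ with $S$ nonsingular. Canonical form. $J_n(\lambda)$ is the $n\times n$ upper triangular Jordan block with eigenvalue $\lambda$ (ones on the superdiagonal). $\Gamma_n$ is the $n\times n$ matrix with $(i,n+1-i)$ entry $(-1)^{n-i}$ for $1\le i\le n$, with $(i,n+2-i)$ entry $(-1)^{n-i}$ for $2\le i\le n$, and all other entries $0$ (so $\Gamma_1=[1]$, $\Gamma_2=\begin{bmatrix}0&-1\\1&1\end{bmatrix}$). $H_m(\lambda):=\begin{bmatrix}0&I_m\\ J_m(\lambda)&0\end{bmatrix}$, a $2m\times 2m$ matrix. It is a known theorem that each square complex matrix is congruent to a direct sum, determined uniquely up to permutation of summands, of matrices of the form $H_m(\lambda)$ with $\lambda\ne0$, $\lambda\ne(-1)^{m+1}$, $\Gamma_n$, and $J_k(0)$, where $\lambda$ is determined up to replacement by $\lambda^{-1}$. The canonical matrix is written in the order $A_{\text{can}}=\bigoplus_i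 H_{p_i}(\lambda_i)\oplus\bigoplus_j\Gamma_{q_j}\oplus\bigoplus_l J_{r_l}(0)$ with $r_1\ge r_2\ge\dots$ (any of the three groups may be empty); $A_1,\dots,A_t$ denote these summands in this order. $(0,* )$ matrices. A $(0,* )$ matrix is a matrix whose entries are the symbols $0$ and $*$. For a corner $c\in\{NW,NE,SE,SW\}$ (upper left, upper right, lower right, lower left), define the following $p\times q$ $(0,* )$ matrices. Let $L$ be the outer column (first or last) containing the corner $c$ if $p\le q$, and the outer row (first or last) containing the corner $c$ if $p\ge q$; if $p=q$, either choice may be used. In $0^{c}$ the stars are exactly all entries of $L$. In $0^{c,\mathrm{odd}}$ the stars are exactly the entries of $L$ in positions $1,3,5,\dots$ counted along $L$ starting from the corner $c$. In $0^{c,\mathrm{even}}$ the stars are exactly the entries of $L$ in positions $2,4,6,\dots$ counted along $L$ starting from the corner $c$. $0^{\updownarrow}$ is a $p\times q$ $(0,* )$ matrix whose stars are either exactly all entries of the first row or exactly all entries of the last row (either form may be taken). For $p\le q$, $\mathcal P_{pq}$ is the $p\times q$ $(0,* )$ matrix whose stars are exactly the entries $(p,j)$ with $p+2\le j\le q$ (so there are $q-p-1$ stars if $p<q$ and none if $p=q$). A sum of $(0,* )$ matrices has stars at the union of the star positions. The symbol $0$ as a block denotes a zero block of the appropriate size. Holomorphy. $\mathcal S(E)$ is holomorphic at zero if its entries are power series in the $n^2$ entries of $E$ that converge in a neighborhood of $0_n$. The matrix $\mathcal D=\mathcal D(E)$ is determined by $A_{\text{can}}+\mathcal D(E)=\mathcal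 S(E)^T(A+E)\mathcal S(E)$. *)

(* Defs.v *)
From mathcomp Require Import all_boot all_order all_algebra finmap complex.
From mathcomp Require Import all_classical all_reals topology normedtype.
From mathcomp Require summability.

Set Implicit Arguments.
Unset Strict Implicit.
Unset Printing Implicit Defensive.

Import Order.TTheory GRing.Theory Num.Theory.
Import numFieldNormedType.Exports.

Local Open Scope classical_set_scope.
Local Open Scope ring_scope.

Inductive block (C : Type) : Type :=
  | HBlock of nat & C
  | GammaBlock of nat
  | JBlock of nat.
Arguments GammaBlock {C}.
Arguments JBlock {C}.

Definition bsize (C : Type) (b : block C) : nat :=
  match b with
  | HBlock m _ => (m + m)%N
  | GammaBlock n => n
  | JBlock n => n
  end.

Section CanonicalForm.
Variable C : numClosedFieldType.

Definition jordan_mx (n : nat) (l : C) : 'M[C]_n :=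
  \matrix_(i, j) (if i == j then l else if i.+1 == j :> nat then 1 else 0).

(* With 1-based indices I = i.+1 and J = j.+1, the nonzero entries are those
   with I + J = n + 1 or I + J = n + 2, and their value is (-1) ^ (n - I). *)
Definition gamma_mx (n : nat) : 'M[C]_n :=
  \matrix_(i, j) (if (((i + j).+1 == n) || (i + j == n))%N
                  then (-1) ^+ (n - i.+1) else 0).

Definition H_mx (m : nat) (l : C) : 'M[C]_(m + m) :=
  block_mx 0 1%:M (jordan_mx m l) 0.

Definition block_matrix (b : block C) : 'M[C]_(bsize b) :=
  match b return 'M[C]_(bsize b) with
  | HBlock m l => H_mx m l
  | GammaBlock n => gamma_mx n
  | JBlock n => jordan_mx n 0
  end.

Definition valid_block (b : block C) : bool :=
  match b with
  | HBlock m l => [&& (0 < m)%N, l != 0 & l != (-1) ^+ m.+1]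
  | GammaBlock n => (0 < n)%N
  | JBlock n => (0 < n)%N
  end.

(* [may_precede b b'] : b may stand before b' among the ordered summands. *)
Definition may_precede (b b' : block C) : bool :=
  match b, b' with
  | HBlock _ _, _ => true
  | GammaBlock _, HBlock _ _ => false
  | GammaBlock _, _ => true
  | JBlock m, JBlock n => (n <= m)%N
  | JBlock _, _ => false
  end.

Definition canonical_blocks (t : nat) (B : 'I_t -> block C) : Prop :=
  (forall i, valid_block (B i)) /\
  (forall i j : 'I_t, (i < j)%N -> may_precede (B i) (B j)).

Definition canonical_mx (t : nat) (B : 'I_t -> block C) :
    'M[C]_(\sum_i bsize (B i)) :=
  \mxdiag_i block_matrix (B i).

End CanonicalForm.

(* A matrix of zeros and stars is a boolean matrix, with [true] for a star. *)

Definition zero_pattern (p q : nat) : 'M[bool]_(p, q) := const_mx false.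

Definition pattern_sum (p q : nat) (P Q : 'M[bool]_(p, q)) : 'M[bool]_(p, q) :=
  \matrix_(i, j) (P i j || Q i j).

Definition star_count (p q : nat) (P : 'M[bool]_(p, q)) : nat :=
  #|[pred ij : 'I_p * 'I_q | P ij.1 ij.2]|.

Inductive corner : Set := NW | NE | SE | SW.

Definition is_top (c : corner) : bool :=
  match c with NW | NE => true | SE | SW => false end.

Definition is_left (c : corner) : bool :=
  match c with NW | SW => true | NE | SE => false end.

Definition even : pred nat := fun k => ~~ odd k.

(* [s] selects positions along the line, counted from 1 at the corner [c]. *)
Definition corner_col (c : corner) (s : pred nat) (p q : nat) :
    'M[bool]_(p, q) :=
  \matrix_(i, j) ((j == (if is_left c then 0 else q.-1)%N :> nat) &&
                  s (if is_top c then i.+1 else p - i)%N).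

Definition corner_row (c : corner) (s : pred nat) (p q : nat) :
    'M[bool]_(p, q) :=
  \matrix_(i, j) ((i == (if is_top c then 0 else p.-1)%N :> nat) &&
                  s (if is_left c then j.+1 else q - j)%N).

(* A predicate rather than a matrix: both forms are allowed when p = q. *)
Definition corner_pattern (c : corner) (s : pred nat) (p q : nat)
    (P : 'M[bool]_(p, q)) : Prop :=
  ((p <= q)%N /\ P = corner_col c s p q) \/
  ((q <= p)%N /\ P = corner_row c s p q).

Definition updown_pattern (p q : nat) (P : 'M[bool]_(p, q)) : Prop :=
  P = \matrix_(i, j) (i == 0%N :> nat) \/ P = \matrix_(i, j) (i == p.-1 :> nat).

(* The 1-based column condition p + 2 <= J reads p < j for J = j.+1. *)
Definition P_pattern (p q : nat) : 'M[bool]_(p, q) :=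
  \matrix_(i, j) ((i == p.-1 :> nat) && (p < j)%N).

Section Patterns.
Variable C : numClosedFieldType.

Definition diag_pattern (b : block C) : 'M[bool]_(bsize b) -> Prop :=
  match b return 'M[bool]_(bsize b) -> Prop with
  | HBlock m l => fun P : 'M[bool]_(m + m) =>
      if l == 1 then
        [/\ corner_pattern NW even (ulsubmx P), ursubmx P = zero_pattern m m,
            corner_pattern SW predT (dlsubmx P)
          & corner_pattern SE even (drsubmx P)]
      else if l == -1 then
        [/\ corner_pattern NW odd (ulsubmx P), ursubmx P = zero_pattern m m,
            corner_pattern SW predT (dlsubmx P)
          & corner_pattern SE odd (drsubmx P)]
      else
        [/\ ulsubmx P = zero_pattern m m, ursubmx P = zero_pattern m m,
            corner_pattern SW predT (dlsubmx P)
          & drsubmx P = zero_pattern m m]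
  | GammaBlock n => fun P : 'M[bool]_n =>
      if odd n then corner_pattern NW even P else corner_pattern NW odd P
  | JBlock n => fun P : 'M[bool]_n => corner_pattern SW odd P
  end.

(* For b standing before b', [offdiag_pattern b b' X Y] describes the pair
   (X, Y) of blocks at positions (b', b) and (b, b') respectively.  The last
   clause collects the pairs excluded by [may_precede]. *)
Definition offdiag_pattern (b b' : block C) :
    'M[bool]_(bsize b', bsize b) -> 'M[bool]_(bsize b, bsize b') -> Prop :=
  match b, b'
    return 'M[bool]_(bsize b', bsize b) -> 'M[bool]_(bsize b, bsize b') -> Prop
  with
  | HBlock m l, HBlock n u =>
      fun (X : 'M[bool]_(n + n, m + m)) (Y : 'M[bool]_(m + m, n + n)) =>
      Y = zero_pattern _ _ /\
      if (l != u) && (l != u^-1) then X = zero_pattern _ _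
      else if (l == 1) || (l == -1) then
        [/\ corner_pattern NW predT (ulsubmx X),
            corner_pattern NE predT (ursubmx X),
            corner_pattern SW predT (dlsubmx X)
          & corner_pattern SE predT (drsubmx X)]
      else if l == u then
        [/\ ulsubmx X = zero_pattern n m,
            corner_pattern NE predT (ursubmx X),
            corner_pattern SW predT (dlsubmx X)
          & drsubmx X = zero_pattern n m]
      else
        [/\ corner_pattern NW predT (ulsubmx X),
            ursubmx X = zero_pattern n m,
            dlsubmx X = zero_pattern n m
          & corner_pattern SE predT (drsubmx X)]
  | GammaBlock m, GammaBlock n =>
      fun (X : 'M[bool]_(n, m)) (Y : 'M[bool]_(m, n)) =>
      Y = zero_pattern _ _ /\
      if odd m (+) odd n then X = zero_pattern _ _
      else corner_pattern NW predT X
  | JBlock m, JBlock n =>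
      fun (X : 'M[bool]_(n, m)) (Y : 'M[bool]_(m, n)) =>
      corner_pattern SW odd Y /\
      if odd n then
        exists2 Q, corner_pattern SW odd Q & X = pattern_sum Q (P_pattern n m)
      else corner_pattern SW odd X
  | HBlock m l, GammaBlock n =>
      fun (X : 'M[bool]_(n, m + m)) (Y : 'M[bool]_(m + m, n)) =>
      Y = zero_pattern _ _ /\
      if l == (-1) ^+ n.+1 then
        corner_pattern NW predT (lsubmx X) /\ corner_pattern NE predT (rsubmx X)
      else X = zero_pattern _ _
  | HBlock m _, JBlock n =>
      fun (X : 'M[bool]_(n, m + m)) (Y : 'M[bool]_(m + m, n)) =>
      Y = zero_pattern _ _ /\
      if odd n then updown_pattern X else X = zero_pattern _ _
  | GammaBlock m, JBlock n =>
      fun (X : 'M[bool]_(n, m)) (Y : 'M[bool]_(m, n)) =>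
      Y = zero_pattern _ _ /\
      if odd n then updown_pattern X else X = zero_pattern _ _
  | _, _ => fun _ _ => False
  end.

Definition canonical_pattern (t : nat) (B : 'I_t -> block C)
    (P : 'M[bool]_(\sum_i bsize (B i))) : Prop :=
  (forall i, diag_pattern (submxblock P i i)) /\
  (forall i j : 'I_t, (i < j)%N ->
     offdiag_pattern (submxblock P j i) (submxblock P i j)).

End Patterns.

Section Holomorphy.
Variables (C : numClosedFieldType) (n : nat).

Definition mx_monomial (E : 'M[C]_n) (m : 'M[nat]_n) : C :=
  \prod_i \prod_j E i j ^+ m i j.

(* Near 0, f is the sum of a power series in the n^2 entries of E.  The sum is
   the limit over the directed set of finite sets of multi-indices, that is,
   convergence is unconditional (equivalently, absolute). *)
Definition holomorphic_at0 (f : 'M[C]_n -> C) : Prop :=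
  exists a : 'M[nat]_n -> C, \forall E \near (0 : 'M[C]_n),
    summability.partial_sum (fun m => a m * mx_monomial E m)
      @ summability.totally --> f E.

Definition mx_holomorphic_at0 (F : 'M[C]_n -> 'M[C]_n) : Prop :=
  forall i j, holomorphic_at0 (fun E => F E i j).

Definition congruence_transformation (S : 'M[C]_n)
    (F : 'M[C]_n -> 'M[C]_n) : Prop :=
  [/\ mx_holomorphic_at0 F, F 0 = S & \forall E \near (0 : 'M[C]_n),
      F E \in unitmx].

Definition deformation (A Acan : 'M[C]_n) (F : 'M[C]_n -> 'M[C]_n)
    (E : 'M[C]_n) : 'M[C]_n :=
  (F E)^T *m (A + E) *m F E - Acan.

Definition fits_pattern (P : 'M[bool]_n) (D : 'M[C]_n) : Prop :=
  forall i j, ~~ P i j -> D i j = 0.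

Definition reduces_to (A Acan S : 'M[C]_n) (P : 'M[bool]_n)
    (F : 'M[C]_n -> 'M[C]_n) : Prop :=
  [/\ congruence_transformation S F,
      \forall E \near (0 : 'M[C]_n), fits_pattern P (deformation A Acan F E)
    & mx_holomorphic_at0 (deformation A Acan F)].

End Holomorphy.

(* Main.v *)
Require Import Defs.
From mathcomp Require Import all_boot all_order all_algebra complex finmap.
From mathcomp Require Import all_classical all_reals topology normedtype.
From mathcomp Require Import zify ring lra.
From mathcomp Require summability.

(** The tangent space at A of its congruence class consists of the matrices
X^T A + A X.  Everything follows from one linear fact about the canonical
matrix Acan: its tangent space and the space of matrices supported on P are
complementary.  The fact is proved in dual form.  For the bilinear form
tr (X^T Z), the orthogonal complement of the tangent space is the space of
solutions Z of A Z^T + A^T Z = 0 (dual_sys), and complementarity says that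
restricting solutions to the stars of P is a bijection onto all assignments of
values to the stars (unisolvent, canonical_unisolvent).

For a direct sum of summands the dual equation splits into one equation for
each summand and one system for each pair.  Let N denote the nilpotent Jordan
block.
- If one summand of a pair is invertible, one of the two blocks is eliminated
  (unisolvent2_unit).  Between summands of type H and Gamma what remains is,
  up to reversing rows or columns, a relation
  al N Z + be Z N^T + ga N Z N^T + de Z = 0 (corner_sys).  When the eigenvalues
  differ, de is nonzero and nilpotency leaves only Z = 0; when they coincide,
  de = 0 and the relation is a recurrence that propagates freely from the
  shorter outer line of the block: this is the pattern 0^NW, and 0^NE, 0^SE,
  0^SW after reversals.
- On a diagonal block of type Gamma, and on the upper left and lower right parts
  of one of type H with eigenvalue 1 or -1, Z is in addition fixed by an
  involution that acts with alternating signs on the antidiagonals; half of the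
  values on the line survive (diag_unisolvent).
- For two blocks J(0) the equations identify entries along chains, and every
  chain that does not run into the border meets exactly one star
  (J_J_unisolvent).  The diagonal case is the symmetric part of the pair
  (J_n(0), J_n(0)).
- A block J_n(0) against an invertible summand gives a recurrence between rows
  two apart (unit_J_unisolvent).

Existence: let E' = S^T E S and look for the reduction as S (1 + C).
Complementarity provides a linear map g such that Y + g(Y)^T Acan + Acan g(Y)
has pattern P for every Y (tangent_complement), so that with C = g(Y) only the
equation Y = E' + C^T E' + E' C + C^T Acan C + C^T E' C is left.  After adding
E' and E' C to the unknowns it reads y = L(E) + be(y, y) with L linear and be
bilinear.  Its formal solution is obtained by Picard iteration, whose iterates
are polynomials bounded in a weighted norm on coefficients; the bound gives
convergence of the series and of the iterates to the same limit
(quadratic_fixpoint).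

Minimality: expanding any reduction with pattern Q to first order along a line
s X shows that the tangent space and the matrices supported on Q together span
all matrices (tangent_cover).  Hence a dual solution is determined by its
values on Q, while its values on P are arbitrary, so P has at most as many
stars as Q. *)

Set Implicit Arguments.
Unset Strict Implicit.
Unset Printing Implicit Defensive.

Import Order.TTheory GRing.Theory Num.Theory.
Import numFieldNormedType.Exports.

Local Open Scope ring_scope.

(** * Prescribing the values of a solution on a pattern *)

Section Unisolvence.
Variable C : numClosedFieldType.

Definition agree_on p q (P : 'M[bool]_(p, q)) (Z W : 'M[C]_(p, q)) : Prop :=
  forall i j, P i j -> Z i j = W i j.

(** For a linear condition E: restriction to the positions of P maps the space of
solutions bijectively onto the assignments of values to these positions. *)
Definition unisolvent p q (E : 'M[C]_(p, q) -> Prop) (P : 'M[bool]_(p, q)) :=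
  (forall Z, E Z -> agree_on P Z 0 -> Z = 0) /\
  (forall W, exists2 Z, E Z & agree_on P Z W).

(** The orthogonal complement, for the form tr (X^T Z), of the matrices
X^T A + A X; see tangent_adjoint. *)
Definition dual_sys n (A Z : 'M[C]_n) : Prop := A *m Z^T + A^T *m Z = 0.

(** The off-diagonal part of dual_sys for the direct sum of A and B: X is the block
in position (2, 1) and Y the block in position (1, 2). *)
Definition dual_sys2 m n (A : 'M[C]_m) (B : 'M[C]_n) (X : 'M[C]_(n, m))
    (Y : 'M[C]_(m, n)) : Prop :=
  A *m X^T + A^T *m Y = 0 /\ B *m Y^T + B^T *m X = 0.

Definition unisolvent2 m n (E : 'M[C]_(n, m) -> 'M[C]_(m, n) -> Prop)
    (PX : 'M[bool]_(n, m)) (PY : 'M[bool]_(m, n)) : Prop :=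
  (forall X Y, E X Y -> agree_on PX X 0 -> agree_on PY Y 0 -> X = 0 /\ Y = 0) /\
  (forall WX WY, exists X Y, [/\ E X Y, agree_on PX X WX & agree_on PY Y WY]).

Lemma eq_unisolvent p q (E E' : 'M[C]_(p, q) -> Prop) P :
  (forall Z, E Z <-> E' Z) -> unisolvent E P -> unisolvent E' P.
Proof.
move=> EE' [uniqE exE]; split=> [Z /EE' EZ|W]; first exact: uniqE.
by have [Z EZ ZW] := exE W; exists Z => //; apply/EE'.
Qed.

Lemma unisolvent_zero p q (E : 'M[C]_(p, q) -> Prop) :
  E 0 -> (forall Z, E Z -> Z = 0) -> unisolvent E (zero_pattern p q).
Proof.
move=> E0 E_eq0; split=> [Z /E_eq0 //|W].
by exists 0 => // i j; rewrite mxE.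
Qed.

Lemma unisolvent_block m1 m2 n1 n2 (E : 'M[C]_(m1 + m2, n1 + n2) -> Prop)
    E11 E12 E21 E22 (P : 'M[bool]_(m1 + m2, n1 + n2)) :
  (forall Z, E Z <-> [/\ E11 (ulsubmx Z), E12 (ursubmx Z),
                         E21 (dlsubmx Z) & E22 (drsubmx Z)]) ->
  unisolvent E11 (ulsubmx P) -> unisolvent E12 (ursubmx P) ->
  unisolvent E21 (dlsubmx P) -> unisolvent E22 (drsubmx P) -> unisolvent E P.
Proof.
move=> EE [u11 x11] [u12 x12] [u21 x21] [u22 x22]; split=> [Z|W].
  move=> /EE[Z11 Z12 Z21 Z22] PZ.
  have e11 : ulsubmx Z = 0 by apply: u11 => // i j; rewrite 4!mxE => /PZ ->; rewrite !mxE.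
  have e12 : ursubmx Z = 0 by apply: u12 => // i j; rewrite 4!mxE => /PZ ->; rewrite !mxE.
  have e21 : dlsubmx Z = 0 by apply: u21 => // i j; rewrite 4!mxE => /PZ ->; rewrite !mxE.
  have e22 : drsubmx Z = 0 by apply: u22 => // i j; rewrite 4!mxE => /PZ ->; rewrite !mxE.
  by rewrite -[Z]submxK e11 e12 e21 e22 block_mx0.
have [Z11 E11Z a11] := x11 (ulsubmx W); have [Z12 E12Z a12] := x12 (ursubmx W).
have [Z21 E21Z a21] := x21 (dlsubmx W); have [Z22 E22Z a22] := x22 (drsubmx W).
exists (block_mx Z11 Z12 Z21 Z22).
  by apply/EE; rewrite block_mxKul block_mxKur block_mxKdl block_mxKdr.
move=> i j; rewrite -(submxK P) -(submxK W).
case: (split_ordP i) => i1 ->; case: (split_ordP j) => j1 ->;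
  rewrite ?block_mxEul ?block_mxEur ?block_mxEdl ?block_mxEdr;
  by move=> ?; auto.
Qed.

Lemma unisolvent_row m n1 n2 (E : 'M[C]_(m, n1 + n2) -> Prop)
    E1 E2 (P : 'M[bool]_(m, n1 + n2)) :
  (forall Z, E Z <-> E1 (lsubmx Z) /\ E2 (rsubmx Z)) ->
  unisolvent E1 (lsubmx P) -> unisolvent E2 (rsubmx P) -> unisolvent E P.
Proof.
move=> EE [u1 x1] [u2 x2]; split=> [Z|W].
  move=> /EE[Z1 Z2] PZ.
  have e1 : lsubmx Z = 0 by apply: u1 => // i j; rewrite 2!mxE => /PZ ->; rewrite !mxE.
  have e2 : rsubmx Z = 0 by apply: u2 => // i j; rewrite 2!mxE => /PZ ->; rewrite !mxE.
  by rewrite -[Z]hsubmxK e1 e2 row_mx0.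
have [Z1 E1Z a1] := x1 (lsubmx W); have [Z2 E2Z a2] := x2 (rsubmx W).
exists (row_mx Z1 Z2); first by apply/EE; rewrite row_mxKl row_mxKr.
move=> i j; rewrite -(hsubmxK P) -(hsubmxK W).
by case: (split_ordP j) => j1 ->; rewrite ?row_mxEl ?row_mxEr; auto.
Qed.

(** The upper right block is a function of the lower left one and so contributes no
free parameter: no star is placed there. *)
Lemma unisolvent_block_dep m1 m2 n1 n2 (E : 'M[C]_(m1 + m2, n1 + n2) -> Prop)
    E11 E21 E22 f (P : 'M[bool]_(m1 + m2, n1 + n2)) :
  (forall Z, E Z <-> [/\ E11 (ulsubmx Z), ursubmx Z = f (dlsubmx Z),
                         E21 (dlsubmx Z) & E22 (drsubmx Z)]) ->
  f 0 = 0 -> ursubmx P = zero_pattern _ _ ->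
  unisolvent E11 (ulsubmx P) ->
  unisolvent E21 (dlsubmx P) -> unisolvent E22 (drsubmx P) -> unisolvent E P.
Proof.
move=> EE f0 P12 [u11 x11] [u21 x21] [u22 x22]; split=> [Z|W].
  move=> /EE[Z11 Z12 Z21 Z22] PZ.
  have e11 : ulsubmx Z = 0 by apply: u11 => // i j; rewrite 4!mxE => /PZ ->; rewrite !mxE.
  have e21 : dlsubmx Z = 0 by apply: u21 => // i j; rewrite 4!mxE => /PZ ->; rewrite !mxE.
  have e22 : drsubmx Z = 0 by apply: u22 => // i j; rewrite 4!mxE => /PZ ->; rewrite !mxE.
  by rewrite -[Z]submxK Z12 e11 e21 e22 f0 block_mx0.
have [Z11 E11Z a11] := x11 (ulsubmx W).
have [Z21 E21Z a21] := x21 (dlsubmx W); have [Z22 E22Z a22] := x22 (drsubmx W).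
exists (block_mx Z11 (f Z21) Z21 Z22).
  by apply/EE; rewrite block_mxKul block_mxKur block_mxKdl block_mxKdr.
move=> i j; rewrite -(submxK P) -(submxK W) P12.
case: (split_ordP i) => i1 ->; case: (split_ordP j) => j1 ->;
  rewrite ?block_mxEul ?block_mxEur ?block_mxEdl ?block_mxEdr;
  by move=> h; auto; move: h; rewrite mxE.
Qed.

Lemma unisolventT p q (E : 'M[C]_(p, q) -> Prop) P :
  unisolvent E P^T -> unisolvent (fun Z => E Z^T) P.
Proof.
move=> [u x]; split=> [Z hZ PZ|W].
  apply: trmx_inj; rewrite trmx0; apply: u => //.
  by move=> i j; rewrite !mxE => /PZ; rewrite mxE.
have [Z hZ ZW] := x W^T; exists Z^T; first by rewrite trmxK.
by move=> i j Pij; rewrite mxE ZW mxE.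
Qed.

(** * Corner systems *)

(** Reversals of rows and columns move any corner to NW and exchange a Jordan block
with its transpose; they reduce the four kinds of corner patterns to one. *)
Definition flip_mx (T : Type) p q (r c : bool) (Z : 'M[T]_(p, q)) : 'M[T]_(p, q) :=
  \matrix_(i, j) Z (if r then rev_ord i else i) (if c then rev_ord j else j).

Lemma flip_mxK T p q r c : involutive (@flip_mx T p q r c).
Proof. by move=> Z; apply/matrixP=> i j; rewrite !mxE; case: r; case: c; rewrite ?rev_ordK. Qed.

Lemma flip_mulmxl p q m r c (A : 'M[C]_(p, m)) (Z : 'M_(m, q)) s :
  flip_mx r c (A *m Z) = flip_mx r s A *m flip_mx s c Z.
Proof.
apply/matrixP=> i j; rewrite !mxE.
case: s => /=; last by apply: eq_bigr => k _; rewrite !mxE.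
by rewrite (reindex_inj rev_ord_inj); apply: eq_bigr => k _; rewrite !mxE.
Qed.

Lemma flip_mxT T p q r c (Z : 'M[T]_(p, q)) : (flip_mx r c Z)^T = flip_mx c r Z^T.
Proof. by apply/matrixP=> i j; rewrite !mxE. Qed.

Lemma flip_mx0 p q r c : flip_mx r c (0 : 'M[C]_(p, q)) = 0.
Proof. by apply/matrixP=> i j; rewrite !mxE. Qed.

Lemma flip_mxFF T p q (Z : 'M[T]_(p, q)) : flip_mx false false Z = Z.
Proof. by apply/matrixP=> i j; rewrite !mxE. Qed.

Lemma flip_jordan n l : flip_mx true true (jordan_mx n l) = (jordan_mx n l : 'M[C]_n)^T.
Proof.
apply/matrixP=> i j; rewrite !mxE (can_eq (@rev_ordK _)) eq_sym.
case: eqP => // _; congr (if _ then _ else _).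
by rewrite /=; have := ltn_ord i; have := ltn_ord j; lia.
Qed.

Lemma unisolvent_flip p q r c (E : 'M[C]_(p, q) -> Prop) P :
  unisolvent E (flip_mx r c P) -> unisolvent (fun Z => E (flip_mx r c Z)) P.
Proof.
move=> [uniqE exE]; split=> [Z EZ PZ|W].
  apply: (can_inj (@flip_mxK C p q r c)); rewrite flip_mx0; apply: uniqE => //.
  by move=> i j; rewrite !mxE => /PZ; rewrite mxE.
have [Z EZ ZW] := exE (flip_mx r c W).
exists (flip_mx r c Z); first by rewrite flip_mxK.
move=> i j Pij; rewrite -[W](flip_mxK r c).
have {}ZW : agree_on (flip_mx r c P) Z (flip_mx r c W) := ZW.
rewrite mxE ZW; first by rewrite [in RHS]mxE.
by rewrite mxE; case: (r); case: (c); rewrite ?rev_ordK.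
Qed.

Lemma corner_pattern_flip c s p q (P : 'M[bool]_(p, q)) :
  corner_pattern c s P -> corner_pattern NW s (flip_mx (~~ is_top c) (~~ Defs.is_left c) P).
Proof.
move=> [] [le_pq ->]; [left|right]; split=> //; apply/matrixP=> i j; rewrite !mxE;
  have := ltn_ord i; have := ltn_ord j; case: c => /= ltj lti; congr (_ && _);
   rewrite ?subKn // ?subnS; (try by congr s; lia); apply/eqP/eqP => /=; lia.
Qed.

(** Reading zeros outside the matrix turns products with nilpotent Jordan blocks
into pure index shifts, including at the border. *)
Definition ent p q (Z : 'M[C]_(p, q)) (a b : nat) : C :=
  match insub a, insub b with Some i, Some j => Z i j | _, _ => 0 end.

Lemma ent_ord p q (Z : 'M[C]_(p, q)) (i : 'I_p) (j : 'I_q) : ent Z i j = Z i j.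
Proof. by rewrite /ent !insubT //= => ? ?; congr (Z _ _); apply: val_inj. Qed.

Lemma ent_out p q (Z : 'M[C]_(p, q)) a b : (p <= a)%N || (q <= b)%N -> ent Z a b = 0.
Proof.
by move=> /orP[] h; rewrite /ent; [rewrite insubF | case: (insub a) => // i; rewrite insubF];
   rewrite // ltnNge h.
Qed.

Lemma entP p q (Z W : 'M[C]_(p, q)) :
  (forall a b, (a < p)%N -> (b < q)%N -> ent Z a b = ent W a b) -> Z = W.
Proof. by move=> h; apply/matrixP=> i j; rewrite -!ent_ord h. Qed.

Lemma ent0 p q a b : ent (0 : 'M[C]_(p, q)) a b = 0.
Proof. by rewrite /ent; case: (insub a : option 'I_p) => // i; case: (insub b :
  option 'I_q) => // j; rewrite mxE. Qed.

Definition fun_mx p q (f : nat -> nat -> C) : 'M[C]_(p, q) := \matrix_(i, j) f i j.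

Lemma ent_fun_mx p q f a b : (a < p)%N -> (b < q)%N -> ent (fun_mx p q f) a b = f a b.
Proof. by move=> ha hb; rewrite -[a]/(val (Ordinal ha)) -[b]/(val (Ordinal hb)) ent_ord mxE. Qed.

Lemma entT p q (Z : 'M[C]_(p, q)) a b : ent Z^T a b = ent Z b a.
Proof.
by rewrite /ent; case: (insub a : option 'I_q) => [i|]; case: (insub b :
  option 'I_p) => [j|] //; rewrite mxE.
Qed.

Lemma entD p q (Z W : 'M[C]_(p, q)) a b : ent (Z + W) a b = ent Z a b + ent W a b.
Proof.
by rewrite /ent; case: (insub a : option 'I_p) => [i|]; case: (insub b : option 'I_q) => [j|];
  rewrite ?mxE ?addr0.
Qed.

Lemma entZ p q k (Z : 'M[C]_(p, q)) a b : ent (k *: Z) a b = k * ent Z a b.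
Proof.
by rewrite /ent; case: (insub a : option 'I_p) => [i|]; case: (insub b : option 'I_q) => [j|];
  rewrite ?mxE ?mulr0.
Qed.

Lemma entN p q (Z : 'M[C]_(p, q)) a b : ent (- Z) a b = - ent Z a b.
Proof. by rewrite -scaleN1r entZ mulN1r. Qed.

Local Notation N n := (jordan_mx n 0 : 'M[C]_n).

Lemma jordanE n l : jordan_mx n l = l%:M + N n.
Proof.
apply/matrixP=> i j; rewrite !mxE; case: eqP => _ /=; first by rewrite addr0.
by rewrite add0r.
Qed.

Lemma shift_lE p q (Z : 'M[C]_(p, q)) (i : 'I_p) j : (N p *m Z) i j = ent Z i.+1 j.
Proof.
rewrite mxE; case: (ltnP i.+1 p) => [lt_ip | ge_ip].
  rewrite (bigD1 (Ordinal lt_ip)) //= big1 => [|k /negP k_neq]; last first.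
    rewrite mxE; case: eqP => // _; rewrite ?mul0r //; case: eqP => // e.
      by case: k_neq; apply/eqP/val_inj.
    by rewrite mul0r.
  rewrite mxE -val_eqE /= eqn_leq ltnn andbF eqxx mul1r addr0.
  by rewrite -(ent_ord Z (Ordinal lt_ip)).
rewrite ent_out ?ge_ip // big1 // => k _; rewrite mxE; case: eqP; rewrite ?mul0r // => _.
by case: eqP; rewrite ?mul0r // => e; have := ltn_ord k; lia.
Qed.

Lemma ent_shift_l p q (Z : 'M[C]_(p, q)) a b : ent (N p *m Z) a b = ent Z a.+1 b.
Proof.
case: (ltnP a p) => [lt_ap | ge_ap]; last by rewrite !ent_out ?ge_ap // leqW.
case: (ltnP b q) => [lt_bq | ge_bq]; last by rewrite !ent_out ?ge_bq ?orbT.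
by rewrite -[a]/(val (Ordinal lt_ap)) -[b]/(val (Ordinal lt_bq)) ent_ord shift_lE.
Qed.

Lemma ent_shift_r p q (Z : 'M[C]_(p, q)) a b : ent (Z *m (N q)^T) a b = ent Z a b.+1.
Proof. by rewrite -[Z *m _]trmxK trmx_mul trmxK entT ent_shift_l entT. Qed.

(** The common normal form of the equations between two summands of type H or
Gamma.  The coefficient de vanishes exactly when the two eigenvalues involved
allow nonzero solutions. *)
Definition corner_sys p q (al be ga de : C) (Z : 'M[C]_(p, q)) : Prop :=
  al *: (N p *m Z) + be *: (Z *m (N q)^T) + ga *: (N p *m Z *m (N q)^T) + de *: Z = 0.

Lemma corner_sysP p q al be ga de (Z : 'M[C]_(p, q)) :
  corner_sys al be ga de Z <->
  (forall a b, al * ent Z a.+1 b + be * ent Z a b.+1 + ga * ent Z a.+1 b.+1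
               + de * ent Z a b = 0).
Proof.
have E a b : ent (al *: (N p *m Z) + be *: (Z *m (N q)^T) +
    ga *: (N p *m Z *m (N q)^T) + de *: Z) a b =
    al * ent Z a.+1 b + be * ent Z a b.+1 + ga * ent Z a.+1 b.+1 + de * ent Z a b.
  by rewrite !entD !entZ !ent_shift_r !ent_shift_l.
split=> [h a b|h]; first by rewrite -E h ent0.
by apply: entP => a b _ _; rewrite E h ent0.
Qed.

Lemma corner_sysT p q al be ga de (Z : 'M[C]_(p, q)) :
  corner_sys al be ga de Z -> corner_sys be al ga de Z^T.
Proof.
move=> /corner_sysP h; apply/corner_sysP => a b; rewrite !entT -[RHS](h b a); ring.
Qed.

Lemma corner_sys0 p q al be ga de : corner_sys al be ga de (0 : 'M[C]_(p, q)).
Proof. by rewrite /corner_sys !(mulmx0, mul0mx, scaler0, addr0). Qed.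

(** An entry is a combination of entries on later antidiagonals, so all entries
vanish by descending induction on the antidiagonal. *)
Lemma corner_sys_vanish p q al be ga de (Z : 'M[C]_(p, q)) :
  de != 0 -> corner_sys al be ga de Z -> Z = 0.
Proof.
move=> de0 /corner_sysP h.
suff H k a b : (p + q <= a + b + k)%N -> ent Z a b = 0.
  by apply: entP => a b _ _; rewrite ent0 (H (p + q)%N) // leq_addl.
elim: k a b => [|k IH] a b le_pq.
  by apply: ent_out; lia.
have := h a b; rewrite !(IH _.+1, IH _ _.+1); try lia.
by rewrite !mulr0 !add0r => /eqP; rewrite mulf_eq0 (negPf de0) => /eqP.
Qed.

(** Each row is computed from the previous one, from right to left, and every step
moves towards later antidiagonals. *)
Lemma corner_row_supp p q al be ga (Z : 'M[C]_(p, q)) k : al != 0 ->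
  corner_sys al be ga 0 Z -> (forall b, (k <= b)%N -> ent Z 0 b = 0) ->
  forall a b, (k <= a + b)%N -> ent Z a b = 0.
Proof.
move=> al0 /corner_sysP h Z0; elim=> [b|a IH b]; first by rewrite add0n; apply: Z0.
move=> le_k; have [d] : exists d, (q <= b + d)%N by exists q; lia.
elim: d b le_k => [|d IHd] b le_k le_q; first by apply: ent_out; lia.
have := h a b; rewrite IH ?(IHd b.+1); try lia.
by rewrite !mulr0 mul0r !addr0 => /eqP; rewrite mulf_eq0 (negPf al0) => /eqP.
Qed.

(** The row following f in a solution, computed from right to left: the value at k
is the entry in column q - k, so that the recursion starts outside the matrix. *)
Fixpoint next_row (al be ga : C) q (f : nat -> C) (k : nat) : C :=
  if k is k'.+1 then - (be * f (q - k')%N + ga * next_row al be ga q f k') / al else 0.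

Definition next_rows al be ga q (f : nat -> C) (a : nat) : nat -> C :=
  iter a (fun g b => next_row al be ga q g (q - b)) f.

(** The support shrinks by one column at each row.  Row q is therefore zero, which is
what makes the relation hold at the last row of a matrix with at least q rows. *)
Lemma next_rows_supp al be ga q f : (forall b, (q <= b)%N -> f b = 0) ->
  forall a b, (q <= a + b)%N -> next_rows al be ga q f a b = 0.
Proof.
move=> f0; elim=> [|a IH] b; first exact: f0.
move=> le_q /=; have : (q - b <= a.+1)%N by lia.
elim: (q - b)%N => //= k IHk lt_ka; rewrite IHk 1?ltnW //.
by rewrite -/(next_rows al be ga q f a) IH ?mulr0 ?addr0 ?oppr0 ?mul0r //; lia.
Qed.

Lemma corner_row_ex p q al be ga (f : nat -> C) : al != 0 -> (q <= p)%N ->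
  exists2 Z : 'M[C]_(p, q), corner_sys al be ga 0 Z &
    forall b, (b < q)%N -> ent Z 0 b = f b.
Proof.
move=> al0 le_qp; pose f' b := if (b < q)%N then f b else 0.
have f'0 b : (q <= b)%N -> f' b = 0 by rewrite /f' ltnNge => ->.
pose z := next_rows al be ga q f'.
have z0 a b : (q <= a + b)%N -> z a b = 0 by apply: next_rows_supp.
have E a b : ent (fun_mx p q z) a b = z a b.
  case: (ltnP a p) => [lt_ap | ge_ap]; last by rewrite ent_out ?z0 ?ge_ap //; lia.
  case: (ltnP b q) => [lt_bq | ge_bq]; last by rewrite ent_out ?z0 ?ge_bq ?orbT //; lia.
  by rewrite ent_fun_mx.
exists (fun_mx p q z); last by move=> b lt_bq; rewrite E /z /= /f' lt_bq.
apply/corner_sysP => a b; rewrite !E mul0r addr0.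
case: (ltnP b q) => [lt_bq|le_qb]; last by rewrite !z0 ?mulr0 ?addr0 //; lia.
rewrite {1 3}/z /= -/(next_rows al be ga q f' a) -/z.
have -> : (q - b = (q - b.+1).+1)%N by lia.
rewrite /= subKn //; by field.
Qed.

(** The recurrence runs from the first row downwards, and it terminates in time when
there are at least as many rows as columns; in the other case the roles of rows
and columns are exchanged. *)
Lemma corner_unisolventNW p q al be ga (P : 'M[bool]_(p, q)) :
  al != 0 -> be != 0 -> corner_pattern NW predT P -> unisolvent (corner_sys al be ga 0) P.
Proof.
have row p' q' al' be' (P' : 'M_(p', q')) : al' != 0 -> (q' <= p')%N ->
    P' = corner_row NW predT p' q' -> unisolvent (corner_sys al' be' ga 0) P'.
  move=> al0 le_qp ->; split=> [Z hZ PZ|W].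
    apply: entP => a b lt_ap lt_bq; rewrite ent0.
    apply: (corner_row_supp al0 hZ (k := 0)) => // {lt_bq}b _.
    case: (ltnP b q') => [lt_bq|]; last by move=> h; apply: ent_out; rewrite h orbT.
    have lt0p : (0 < p')%N by lia.
    by rewrite -[0%N]/(val (Ordinal lt0p)) -[b]/(val (Ordinal lt_bq)) ent_ord PZ mxE.
  have [Z hZ Z0] := corner_row_ex be' ga (ent W 0) al0 le_qp.
  exists Z => // i j; rewrite mxE /= andbT => /eqP i0.
  by rewrite -!ent_ord i0 Z0.
move=> al0 be0 [] [le_pq PE]; last exact: row.
have [u x] : unisolvent (corner_sys be al ga 0) P^T.
  by apply: row => //; rewrite PE; apply/matrixP => i j; rewrite !mxE.
split=> [Z hZ PZ|W].
  apply: trmx_inj; rewrite trmx0; apply: u; first exact: corner_sysT.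
  by move=> i j; rewrite !mxE => /PZ; rewrite mxE.
have [Z hZ ZW] := x W^T; exists Z^T; first exact: corner_sysT.
by move=> i j Pij; rewrite mxE ZW mxE.
Qed.

Lemma corner_unisolvent c p q al be ga de (P : 'M[bool]_(p, q)) :
  (de = 0 -> al != 0 /\ be != 0) ->
  (if de == 0 then corner_pattern c predT P else P = zero_pattern p q) ->
  unisolvent (fun Z => corner_sys al be ga de (flip_mx (~~ is_top c) (~~ Defs.is_left c) Z)) P.
Proof.
case: (eqVneq de 0) => [-> [] // al0 be0|de0 _] hP.
  apply: unisolvent_flip; apply: corner_unisolventNW => //.
  exact: corner_pattern_flip.
rewrite hP; apply: unisolvent_zero; first by rewrite flip_mx0; apply: corner_sys0.
move=> Z /(corner_sys_vanish de0) h.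
by apply: (can_inj (@flip_mxK C p q _ _)); rewrite flip_mx0; exact: h.
Qed.

End Unisolvence.

(** * Symmetric corner systems *)

Section DiagSys.
Variable C : numClosedFieldType.
Local Notation N n := (jordan_mx n 0 : 'M[C]_n).

(** With A = 1 + ka N and B = et + rh N the equation is A Z = - B Z^T.  It implies
A Z A^T = B Z B^T, a corner system on which the map sending Z to - A^-1 B Z^T is
an involution with fixed points the solutions of diag_sys. *)
Definition diag_sys n (et ka rh : C) (Z : 'M[C]_n) : Prop :=
  Z + ka *: (N n *m Z) + et *: Z^T + rh *: (N n *m Z^T) = 0.

Lemma diag_sysP n et ka rh (Z : 'M[C]_n) :
  diag_sys et ka rh Z <->
  (forall a b, ent Z a b + ka * ent Z a.+1 b + et * ent Z b a + rh * ent Z b a.+1 = 0).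
Proof.
have E a b : ent (Z + ka *: (N n *m Z) + et *: Z^T + rh *: (N n *m Z^T)) a b =
    ent Z a b + ka * ent Z a.+1 b + et * ent Z b a + rh * ent Z b a.+1.
  by rewrite !entD !entZ !ent_shift_l !entT.
split=> [h a b|h]; first by rewrite -E h ent0.
by apply: entP => a b _ _; rewrite E h ent0.
Qed.

(** A Z A^T = - B Z^T A^T = - B (A Z)^T = B Z B^T, with A = 1 + ka N and
B = et + rh N, written out entrywise. *)
Lemma diag_corner_sys n et ka rh (Z : 'M[C]_n) : et ^+ 2 = 1 -> diag_sys et ka rh Z ->
  corner_sys (ka - et * rh) (ka - et * rh) (ka ^+ 2 - rh ^+ 2) 0 Z.
Proof.
move=> et2 /diag_sysP h; apply/corner_sysP => a b.
have h1 := h a b; have h2 := h a b.+1; have h3 := h b a; have h4 := h b a.+1.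
have : (1 - et ^+ 2) * ent Z a b = 0 by rewrite et2 subrr mul0r.
move=> h5.
(* The equation at (a, b), plus ka times the one at (a, b + 1), minus et times the
   one at (b, a), minus rh times the one at (b, a + 1). *)
transitivity ((ent Z a b + ka * ent Z a.+1 b + et * ent Z b a + rh * ent Z b a.+1)
  + ka * (ent Z a b.+1 + ka * ent Z a.+1 b.+1 + et * ent Z b.+1 a + rh * ent Z b.+1 a.+1)
  - et * (ent Z b a + ka * ent Z b.+1 a + et * ent Z a b + rh * ent Z a b.+1)
  - rh * (ent Z b a.+1 + ka * ent Z b.+1 a.+1 + et * ent Z a.+1 b + rh * ent Z a.+1 b.+1)
  - (1 - et ^+ 2) * ent Z a b).
  by ring.
by rewrite h1 h2 h3 h4 h5 !mulr0 !subr0 addr0.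
Qed.

(** On the last nonzero antidiagonal the term in N Z N^T disappears and the relation
says that neighbouring entries are opposite. *)
Lemma corner_antidiagonal p q al ga k (Z : 'M[C]_(p, q)) : al != 0 ->
  corner_sys al al ga 0 Z -> (forall a b, (k < a + b)%N -> ent Z a b = 0) ->
  forall a b, (a + b)%N = k -> ent Z a b = (-1) ^+ a * ent Z 0 k.
Proof.
move=> al0 /corner_sysP h Z0; elim=> [b <-|a IH b eq_k]; first by rewrite expr0 mul1r.
have := h a b; rewrite (Z0 a.+1 b.+1); last by lia.
rewrite (IH b.+1); last by lia.
rewrite mulr0 mul0r !addr0 -mulrDr => /eqP; rewrite mulf_eq0 (negPf al0) /=.
by rewrite addr_eq0 exprS mulN1r mulNr => /eqP.
Qed.

(** The last nonzero antidiagonal, of index k, alternates in sign by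
corner_antidiagonal, and diag_sys makes it symmetric or antisymmetric according
to the sign of et.  The two are compatible only if et (-1)^(k+1) = 1. *)
Lemma diag_top n et ka rh (Z : 'M[C]_n) k : et ^+ 2 = 1 -> ka != et * rh ->
  diag_sys et ka rh Z -> (forall a b, (k < a + b)%N -> ent Z a b = 0) ->
  (et * (-1) ^+ k.+1 == 1 -> ent Z 0 k = 0 \/ ent Z k 0 = 0) ->
  forall a b, (k <= a + b)%N -> ent Z a b = 0.
Proof.
move=> et2 ka_neq hZ Z0 star.
have al0 : ka - et * rh != 0 by rewrite subr_eq0.
have anti := corner_antidiagonal al0 (diag_corner_sys et2 hZ) Z0.
have sq : (-1 : C) ^+ k * (-1) ^+ k = 1 by rewrite -expr2 sqrr_sign.
have Zk : ent Z k 0 = (-1) ^+ k * ent Z 0 k by apply: anti; rewrite addn0.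
suff Z0k : ent Z 0 k = 0.
  move=> a b; rewrite leq_eqVlt => /orP[/eqP eq_k|]; last exact: Z0.
  by rewrite anti // Z0k mulr0.
case: (boolP (et * (-1) ^+ k.+1 == 1)) => [/star|nstar].
  by case=> // h; rewrite -[LHS]mul1r -sq -mulrA -Zk h mulr0.
have et1 : et * (-1) ^+ k = 1.
  have : (et * (-1) ^+ k) ^+ 2 == 1 by rewrite exprMn et2 sqrr_sign mulr1.
  rewrite sqrf_eq1 => /orP[/eqP //|/eqP e].
  by case/eqP: nstar; rewrite exprS mulrCA e mulN1r opprK.
have := (diag_sysP _ _ _ _).1 hZ 0%N k.
rewrite (Z0 1%N k) ?(Z0 k 1%N) ?add1n ?addn1 // !mulr0 !addr0 Zk mulrA et1 mul1r.
by move=> /eqP; rewrite -mulr2n mulrn_eq0 /= => /eqP.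
Qed.

Lemma diag_uniq n et ka rh (Z : 'M[C]_n) : et ^+ 2 = 1 -> ka != et * rh ->
  diag_sys et ka rh Z ->
  (forall k, (k < n)%N -> et * (-1) ^+ k.+1 == 1 -> ent Z 0 k = 0 \/ ent Z k 0 = 0) ->
  Z = 0.
Proof.
move=> et2 ka_neq hZ star.
suff H d k : (n + n <= k + d)%N -> forall a b, (k <= a + b)%N -> ent Z a b = 0.
  by apply: entP => a b _ _; rewrite ent0 (H (n + n)%N 0%N).
elim: d k => [|d IH] k le_n a b le_k; first by apply: ent_out; lia.
apply: (diag_top (k := k) et2 ka_neq hZ) => //; first by move=> *; apply: (IH k.+1); lia.
case: (ltnP k n) => [|ge_kn _]; first exact: star.
by left; rewrite ent_out // ge_kn orbT.
Qed.

(** If A Y A^T = B Y B^T then Z = Y A^T - B Y^T satisfies A Z = - B Z^T, because A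
and B are polynomials in N and commute.  On the last antidiagonal of Y the two
terms of Z add up if et (-1)^(k+1) = 1. *)
Lemma diag_witness n et ka rh k : et ^+ 2 = 1 -> ka != et * rh -> (k < n)%N ->
  et * (-1) ^+ k.+1 == 1 ->
  exists Z : 'M[C]_n, [/\ diag_sys et ka rh Z,
    forall a b, (k < a + b)%N -> ent Z a b = 0, ent Z 0 k = 1 & ent Z k 0 = (-1) ^+ k].
Proof.
move=> et2 ka_neq lt_kn /eqP star.
have al0 : ka - et * rh != 0 by rewrite subr_eq0.
have [Y hY Y0] := corner_row_ex (ka - et * rh) (ka ^+ 2 - rh ^+ 2)
  (fun b => (b == k)%:R / 2) al0 (leqnn n).
have Ysupp : forall a b, (k < a + b)%N -> ent Y a b = 0.
  apply: (corner_row_supp al0 hY) => b lt_kb; case: (ltnP b n) => [lt_bn|ge_bn].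
    by rewrite Y0 // gtn_eqF // mul0r.
  by rewrite ent_out // ge_bn orbT.
have Yk : ent Y k 0 = (-1) ^+ k / 2.
  by rewrite (corner_antidiagonal al0 hY Ysupp) ?addn0 // Y0 // eqxx mul1r.
have Y0k : ent Y 0 k = 1 / 2 by rewrite Y0 // eqxx.
have sq : (-1 : C) ^+ k * (-1) ^+ k = 1 by rewrite -expr2 sqrr_sign.
pose Z := Y + ka *: (Y *m (N n)^T) - et *: Y^T - rh *: (N n *m Y^T).
have ZE a b : ent Z a b = ent Y a b + ka * ent Y a b.+1 - et * ent Y b a - rh * ent Y b a.+1.
  by rewrite /Z !(entD, entN, entZ) ent_shift_r ent_shift_l !entT.
have et1 : et = - (-1) ^+ k.
  move: star; rewrite exprS mulrCA mulN1r => /eqP; rewrite eqr_oppLR => /eqP star.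
  by rewrite -[LHS]mulr1 -[1 in LHS]sq mulrA star mulN1r.
exists Z; split.
- apply/diag_sysP => a b; rewrite !ZE.
  have := (corner_sysP _ _ _ _ _).1 hY a b; have := (corner_sysP _ _ _ _ _).1 hY b a.
  move=> e1 e2.
  transitivity ((1 - et ^+ 2) * ent Y a b +
   ((ka - et * rh) * ent Y a.+1 b + (ka - et * rh) * ent Y a b.+1 +
     (ka ^+ 2 - rh ^+ 2) * ent Y a.+1 b.+1 + 0 * ent Y a b)); first by ring.
  by rewrite e2 et2 subrr mul0r addr0.
- by move=> a b lt_k; rewrite ZE !Ysupp ?mulr0 ?addr0 ?subr0 //; lia.
- rewrite ZE (Ysupp 0%N k.+1) ?(Ysupp k 1%N) ?addn1 // Yk Y0k et1 !mulr0 addr0 subr0.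
  by rewrite mulNr opprK mulrA sq mul1r; field.
rewrite ZE (Ysupp k 1%N) ?(Ysupp 0%N k.+1) ?addn1 // Yk Y0k et1 !mulr0 addr0 subr0.
by field.
Qed.

Lemma diag_sys0 n et ka rh : diag_sys et ka rh (0 : 'M[C]_n).
Proof. by rewrite /diag_sys trmx0 !mulmx0 !scaler0 !addr0. Qed.

(** The solutions of diag_witness have distinct last antidiagonals, hence the values
can be adjusted one antidiagonal after the other.  The flag r tells whether they
are prescribed on the first row or on the first column. *)
Lemma diag_ex (r : bool) n et ka rh m (W : nat -> C) : et ^+ 2 = 1 -> ka != et * rh ->
  (m <= n)%N ->
  exists Z : 'M[C]_n, [/\ diag_sys et ka rh Z,
    forall a b, (m <= a + b)%N -> ent Z a b = 0 &
    forall k, (k < m)%N -> et * (-1) ^+ k.+1 == 1 ->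
      (if r then ent Z 0 k else ent Z k 0) = W k].
Proof.
move=> et2 ka_neq; elim: m W => [|m IH] W le_mn.
  by exists 0; split=> // *; rewrite ?ent0 //; apply: diag_sys0.
case: (boolP (et * (-1) ^+ m.+1 == 1)) => star; last first.
  have [Z [hZ Z0 ZW]] := IH W (ltnW le_mn); exists Z; split=> //.
    by move=> *; apply: Z0; lia.
  move=> k; rewrite ltnS leq_eqVlt => /orP[/eqP->|]; first by rewrite (negPf star).
  exact: ZW.
have [Z1 [/diag_sysP hZ1 Z10 Z1r Z1c]] := diag_witness et2 ka_neq le_mn star.
(* The value of Z1 on the chosen line, at position m; it is its own inverse. *)
pose c : C := if r then 1 else (-1) ^+ m.
have cc : c * c = 1 by rewrite /c; case: (r); rewrite ?mulr1 // -expr2 sqrr_sign.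
pose line (Z : 'M[C]_n) k := if r then ent Z 0 k else ent Z k 0.
have [Z2 [/diag_sysP hZ2 Z20 Z2W]] := IH (fun k => W k - W m * c * line Z1 k) (ltnW le_mn).
exists ((W m * c) *: Z1 + Z2); split.
- apply/diag_sysP => a b; rewrite !entD !entZ.
  transitivity (W m * c * (ent Z1 a b + ka * ent Z1 a.+1 b + et * ent Z1 b a + rh * ent Z1 b a.+1)
   + (ent Z2 a b + ka * ent Z2 a.+1 b + et * ent Z2 b a + rh * ent Z2 b a.+1)); first by ring.
  by rewrite hZ1 hZ2 mulr0 addr0.
- by move=> a b le_m; rewrite entD entZ Z10 1?Z20 ?mulr0 ?addr0 // ltnW.
move=> k lt_km stark.
have -> : (if r then ent ((W m * c) *: Z1 + Z2) 0 k else ent ((W m * c) *: Z1 + Z2) k 0)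
   = W m * c * line Z1 k + line Z2 k.
  by rewrite /line; case: (r); rewrite entD entZ.
move: lt_km; rewrite ltnS leq_eqVlt => /orP[/eqP k_m|lt_km]; last first.
  by rewrite [line Z2 k]Z2W // addrC subrK.
have -> : line Z2 k = 0 by rewrite /line; case: (r); apply: Z20; lia.
have -> : line Z1 k = c by rewrite /line /c k_m; case: (r).
by rewrite -mulrA cc mulr1 addr0 k_m.
Qed.

Lemma diag_unisolvent n et ka rh s (P : 'M[bool]_n) : et ^+ 2 = 1 -> ka != et * rh ->
  (forall k, s k = (et * (-1) ^+ k == 1)) -> corner_pattern NW s P ->
  unisolvent (diag_sys et ka rh) P.
Proof.
move=> et2 ka_neq sE hP; split=> [Z hZ PZ|W].
  apply: (diag_uniq et2 ka_neq hZ) => k lt_kn; rewrite -sE => sk.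
  have lt0n : (0 < n)%N by lia.
  by case: hP => -[_ PE]; [right|left];
    rewrite -[k]/(val (Ordinal lt_kn)) -[0%N]/(val (Ordinal lt0n)) ent_ord PZ ?mxE // PE mxE.
have [r hr] : exists r : bool, forall i j, P i j -> let k := if r then val j else val i in
    [/\ s k.+1, val i = (if r then 0%N else k) & val j = (if r then k else 0%N)].
  by case: hP => -[_ ->]; [exists false|exists true] => i j; rewrite mxE /= => /andP[/eqP j0 si].
have [Z [hZ _ ZW]] := diag_ex r (fun k => if r then ent W 0 k else ent W k 0) et2 ka_neq (leqnn
  n).
exists Z => // i j /hr /= [sk ei ej].
have lt_k : ((if r then val j else val i) < n)%N by case: (r); apply: ltn_ord.
have := ZW _ lt_k; rewrite -sE => /(_ sk).
by rewrite -!ent_ord; move: ei ej {ZW lt_k sk}; case: (r) => /= [-> _|_ ->].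
Qed.

End DiagSys.

(** * Pairs of nilpotent Jordan blocks *)

Section JJ.
Variable C : numClosedFieldType.
Local Notation N n := (jordan_mx n 0 : 'M[C]_n).

(** The opposite shift introduces a zero first row. *)
Lemma ent_up_shift p q (Z : 'M[C]_(p, q)) a b : (a < p)%N ->
  ent ((N p)^T *m Z) a b = if a is a'.+1 then ent Z a' b else 0.
Proof.
move=> lt_ap; case: (ltnP b q) => [lt_bq|ge_bq]; last first.
  by rewrite ent_out ?ge_bq ?orbT //; case: (a) => // a'; rewrite ent_out // ge_bq orbT.
rewrite -[a in LHS]/(val (Ordinal lt_ap)) -[b in LHS]/(val (Ordinal lt_bq)) ent_ord mxE.
case: a lt_ap => [|a] lt_ap.
  rewrite big1 // => k _; rewrite !mxE; case: eqP => _; first by rewrite mul0r.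
  by rewrite mul0r.
have lt_a : (a < p)%N by lia.
rewrite (bigD1 (Ordinal lt_a)) //= big1 => [|k /negP k_neq].
  rewrite !mxE -val_eqE /= ltn_eqF // eqxx mul1r addr0.
  by rewrite -[a in RHS]/(val (Ordinal lt_a)) -[b in RHS]/(val (Ordinal lt_bq)) ent_ord.
rewrite !mxE; case: eqP => _; first by rewrite mul0r.
case: eqP => [/= [e]|]; last by rewrite mul0r.
by case: k_neq; apply/eqP/val_inj.
Qed.

Lemma J_J_sysP m n (X : 'M[C]_(n, m)) (Y : 'M[C]_(m, n)) :
  dual_sys2 (N m) (N n) X Y <->
  (forall a b, (a < m)%N -> (b < n)%N ->
     ent X b a.+1 + (if a is a'.+1 then ent Y a' b else 0) = 0 /\
     ent Y a b.+1 + (if b is b'.+1 then ent X b' a else 0) = 0).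
Proof.
split=> [[h1 h2] a b lt_am lt_bn|h].
  split.
    by rewrite -[X in _ + X](ent_up_shift _ _ lt_am) -entT -ent_shift_l -entD h1 ent0.
  by rewrite -[X in _ + X](ent_up_shift _ _ lt_bn) -entT -ent_shift_l -entD h2 ent0.
split; apply: entP => a b lt_a lt_b; rewrite entD ent_shift_l entT ent_up_shift // ent0.
  by case: (h _ _ lt_a lt_b).
by case: (h _ _ lt_b lt_a).
Qed.

(** A function on pairs (a, b) that is invariant under the step to (a + 2, b + 2).
It is determined by its values x on the row 0 and y on the column 0; chains that
start on the row 1 or the column 1 carry the value 0. *)
Definition chain_value (x y : nat -> C) (a b : nat) : C :=
  if (a <= b)%N then (if odd a then 0 else x (b - a)%N)
  else (if odd b then 0 else y (a - b)%N).

Lemma chain_valueSS x y a b : chain_value x y a.+2 b.+2 = chain_value x y a b.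
Proof. by rewrite /chain_value !ltnS !subSS /= !negbK. Qed.

(** The chains that run into an equation whose other member lies outside the matrix
carry the value 0. *)
Definition chains_cut m n (x y : nat -> C) : Prop :=
  [/\ y 1%N = 0,
      forall b, (b < n)%N -> ~~ odd b -> y (m - b)%N = 0,
      forall d, (d < n)%N -> ~~ odd (n - d) -> x d = 0 &
      ~~ odd n -> forall e, (0 < e)%N -> (e <= m - n + 1)%N -> y e = 0].

(** The matrices X^T and - Y are windows onto one function constant along chains,
the second one shifted by two rows; the equations compare the overlapping parts
of the windows and require zero where only one of them is present. *)
Lemma J_J_ex m n x y : (n <= m)%N -> chains_cut m n x y ->
  dual_sys2 (N m) (N n) (fun_mx n m (fun b a => chain_value x y a b))
    (fun_mx m n (fun a b => - chain_value x y a.+2 b)).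
Proof.
move=> le_nm [y1 c2 c3 c4]; apply/J_J_sysP => a b lt_am lt_bn; split.
  have [lt_a1|ge_a1] := ltnP a.+1 m.
    rewrite ent_fun_mx //; case: a lt_am lt_a1 => [|a] lt_am lt_a1.
      by rewrite addr0 /chain_value; case: b lt_bn.
    by rewrite ent_fun_mx ?subrr // ltnW.
  rewrite ent_out ?ge_a1 ?orbT // add0r; case: a lt_am ge_a1 => // a lt_am ge_a1.
  have -> : m = a.+2 by lia.
  rewrite ent_fun_mx ?(ltnW lt_am) //; apply/eqP; rewrite oppr_eq0; apply/eqP.
  have lt_ba : (b < a.+2)%N by lia.
  rewrite /chain_value leqNgt lt_ba /=; case: ifP => // /negbT ob.
  by have -> : a.+2 = m by [lia]; exact: c2.
have [lt_b1|ge_b1] := ltnP b.+1 n.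
  rewrite ent_fun_mx //; case: b lt_bn lt_b1 => [|b] lt_bn lt_b1.
    by rewrite addr0 /chain_value /= oppr0.
  by rewrite ent_fun_mx ?chain_valueSS ?addNr // ltnW.
rewrite ent_out ?ge_b1 ?orbT // add0r; case: b lt_bn ge_b1 => // b lt_bn ge_b1.
have nE : n = b.+2 by lia.
rewrite ent_fun_mx ?(ltnW lt_bn) // /chain_value; case: leqP => [le_ab|lt_ba]; case: ifP => //
  /negbT od.
  by apply: c3; [lia|lia].
by apply: c4; lia.
Qed.

(** Walking back along a chain one alternates between X and Y until the row or the
column 0 or 1 is reached. *)
Lemma J_J_shape m n (X : 'M[C]_(n, m)) (Y : 'M[C]_(m, n)) (le_nm : (n <= m)%N) :
  dual_sys2 (N m) (N n) X Y ->
  let x := ent X ^~ 0%N in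
  let y e := if e is e'.+2 then - ent Y e' 0 else 0 in
  [/\ chains_cut m n x y,
      forall a b, (a < m)%N -> (b < n)%N -> ent X b a = chain_value x y a b &
      forall a b, (a < m)%N -> (b < n)%N -> ent Y a b = - chain_value x y a.+2 b].
Proof.
move=> /J_J_sysP h x y.
have H k : forall a b, (a + b <= k)%N -> (a < m)%N -> (b < n)%N ->
    ent X b a = chain_value x y a b /\ ent Y a b = - chain_value x y a.+2 b.
  elim: k => [|k IH] a b le_k lt_am lt_bn.
    have -> : a = 0%N by lia.
    by have -> : b = 0%N by [lia]; rewrite /chain_value /= opprK.
  split.
    case: a le_k lt_am => [|[|a]] le_k lt_am; first by rewrite /chain_value /= subn0.
      have [e _] := h 0%N b (ltnW lt_am) lt_bn; rewrite addr0 in e; rewrite e /chain_value.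
      by case: b {le_k lt_bn e}.
    have [e _] := h a.+1 b (ltnW lt_am) lt_bn.
    have [_ e'] := IH a b ltac:(lia) ltac:(lia) lt_bn.
    by apply/eqP; rewrite -subr_eq0 -e' e.
  case: b le_k lt_bn => [|[|b]] le_k lt_bn; first by rewrite /chain_value /= opprK.
    by have [_ e] := h a 0%N lt_am (ltnW lt_bn); rewrite addr0 in e;
      rewrite e /chain_value /= oppr0.
  have [_ e] := h a b.+1 lt_am (ltnW lt_bn).
  have [e' _] := IH a b ltac:(lia) lt_am ltac:(lia).
  by rewrite chain_valueSS -e'; apply/eqP; rewrite -addr_eq0 e.
have HX a b lta ltb : ent X b a = chain_value x y a b := (H _ a b (leqnn _) lta ltb).1.
have HY a b lta ltb : ent Y a b = - chain_value x y a.+2 b := (H _ a b (leqnn _) lta ltb).2.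
have K b a : (b.+2 = n)%N -> (a < m)%N -> chain_value x y a b = 0.
  move=> nE lt_am; have [_] := h a b.+1 lt_am ltac:(lia).
  rewrite ent_out ?add0r; last by rewrite nE leqnn orbT.
  by rewrite HX //; lia.
split=> //; split=> //.
- move=> b lt_bn ob; have [m1|lt1m] := leqP m 1.
    have -> : b = 0%N by lia.
    by have -> : m = 1%N by lia.
  have [e _] := h m.-2.+1 b ltac:(lia) lt_bn.
  move: e; rewrite ent_out ?add0r; last by lia.
  rewrite HY; [|lia|lia] => /eqP; rewrite oppr_eq0 /chain_value leqNgt (_ : (b < m.-2.+2)%N);
    last by lia.
  by rewrite (negPf ob) /= (_ : m.-2.+2 = m) => [/eqP|]; last lia.
- move=> d lt_dn od; have := K n.-2 (n.-2 - d)%N ltac:(lia) ltac:(lia).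
  rewrite /chain_value leq_subr; case: ifP => [|_]; first by lia.
  by rewrite subKn //; lia.
- move=> on e lt0e le_e; case: (posnP n) => [n0|lt0n].
    by case: e lt0e le_e => [|[|e]] // _ _; rewrite /y ent_out ?oppr0 // n0 orbT.
  have := K n.-2 (e + n.-2)%N ltac:(lia) ltac:(lia).
  rewrite /chain_value leqNgt (_ : (n.-2 < e + n.-2)%N) /=; last by lia.
  by case: ifP => [|_]; [lia|rewrite addnK].
Qed.

(** The values of x are read on Q and those of y on PY, except that the chains which
end in the last row of X beyond column n, and do so only for odd n, are read on
P_pattern. *)
Lemma J_J_unisolvent m n (Q PX : 'M[bool]_(n, m)) (PY : 'M[bool]_(m, n)) : (n <= m)%N ->
  corner_pattern SW odd Q -> corner_pattern SW odd PY ->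
  PX = (if odd n then pattern_sum Q (P_pattern n m) else Q) ->
  unisolvent2 (dual_sys2 (N m) (N n)) PX PY.
Proof.
move=> le_nm hQ hPY PXE.
have QX i j : Q i j -> PX i j by rewrite PXE; case: ifP => // _; rewrite mxE => ->.
have PX_tail (i : 'I_n) (j : 'I_m) : odd n -> val i = n.-1 -> (n < j)%N -> PX i j.
  by move=> on ei ej; rewrite PXE on !mxE ei eqxx ej orbT.
have inPX i j : PX i j -> Q i j \/ [/\ odd n, val i = n.-1 & (n < j)%N].
  rewrite PXE; case: ifP => on; last by left.
  by rewrite !mxE => /orP[|/andP[/eqP]]; [left|right].
(* For m = n the stars of Q may lie on the last row instead of the first column;
   rX records which, and PY is treated likewise with rY. *)
have [rX [rXE1 rXE2]] : exists r : bool,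
    (forall i j, Q i j -> ~~ odd j /\ odd (n - i) /\
      if r then m = n /\ val i = n.-1 else val j = 0%N) /\
    (forall d, (d < n)%N -> odd (n - d) -> if r then
        m = n /\ (forall i j, val i = n.-1 -> val j = (n.-1 - d)%N -> Q i j)
      else forall i j, val i = d -> val j = 0%N -> Q i j).
  case: hQ => -[h ->]; [exists false|exists true]; split=> [i j|d lt_dn od]; rewrite ?mxE /=.
  - by move=> /andP[/eqP -> ->].
  - by move=> i j ei ej; rewrite mxE /= ei ej eqxx.
  - move=> /andP[/eqP ei oj]; have := ltn_ord i; split; first by lia.
    by split; [lia|split=> //; lia].
  - by split; [lia|move=> i j ei ej; rewrite mxE /= ei ej eqxx /=; lia].
have [rY [rYE1 rYE2]] : exists r : bool,
    (forall i j, PY i j -> odd (m - i) /\ ~~ odd j /\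
      if r then val i = m.-1 else m = n /\ val j = 0%N) /\
    (forall b, (b < n)%N -> ~~ odd b -> if r then
        (forall i j, val i = m.-1 -> val j = b -> PY i j)
      else m = n /\ forall i j, val i = (m.-1 - b)%N -> val j = 0%N -> PY i j).
  case: hPY => -[h ->]; [exists false|exists true]; split=> [i j|b lt_bn ob]; rewrite ?mxE /=.
  - by move=> /andP[/eqP ej oi]; rewrite ej; split=> //; split=> //; split=> //; lia.
  - split; first by lia.
    by move=> i j ei ej; have := ltn_ord i; rewrite mxE /= ei ej eqxx /=; lia.
  - move=> /andP[/eqP ei oj]; have := ltn_ord i; split; first by lia.
    by split.
  - by move=> i j ei ej; rewrite mxE /= ei ej eqxx.
split=> [X Y hXY PX0 PY0|WX WY].
  have X0 a b : (a < n)%N -> (b < m)%N -> (forall i j, val i = a -> val j = b -> PX i j) ->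
      ent X a b = 0.
    move=> lt_a lt_b hP; rewrite -[a]/(val (Ordinal lt_a)) -[b]/(val (Ordinal lt_b)).
    by rewrite ent_ord PX0 ?mxE // hP.
  have Y0 a b : (a < m)%N -> (b < n)%N -> (forall i j, val i = a -> val j = b -> PY i j) ->
      ent Y a b = 0.
    move=> lt_a lt_b hP; rewrite -[a]/(val (Ordinal lt_a)) -[b]/(val (Ordinal lt_b)).
    by rewrite ent_ord PY0 ?mxE // hP.
  have [] := J_J_shape le_nm hXY.
  set x := ent X ^~ 0%N; set y := (fun e => _) => -[y1 c2 c3 c4] HX HY.
  have x0 d : (d < n)%N -> x d = 0.
    move=> lt_dn; case: (boolP (odd (n - d))) => [od|]; last exact: c3.
    have := rXE2 d lt_dn od; case: (rX) => [[mn hQd]|hQd].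
      have := X0 n.-1 (n.-1 - d)%N ltac:(lia) ltac:(lia) (fun i j ei ej => QX _ _ (hQd i j ei
        ej)).
      rewrite HX; [|lia|lia]; rewrite /chain_value leq_subr; case: ifP => [|_]; first by lia.
      by rewrite subKn //; lia.
    by apply: X0 => //; [lia|move=> i j ei ej; apply/QX/hQd].
  (* The value y e is read off where the chain starting at row e of column 0 leaves
     the matrices: on P_pattern if e <= m - n (for odd n), and otherwise on the last row of Y,
     which it meets in column m + 1 - e. *)
  have y0 e : (0 < e)%N -> (e <= m.+1)%N -> y e = 0.
    move=> lt0e le_em; have [le_e|lt_e] := leqP e (m - n).
      case: (boolP (odd n)) => [on|en]; last by apply: c4; lia.
      case: (eqVneq e 1%N) => [->//|e1].
      have := X0 n.-1 (e + n.-1)%N ltac:(lia) ltac:(lia).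
      rewrite HX; [|lia|lia]; rewrite /chain_value leqNgt (_ : (n.-1 < e + n.-1)%N) /=; last by
        lia.
      case: ifP => [|_]; first by lia.
      by rewrite addnK; apply => i j ei ej; apply: PX_tail => //; lia.
    case: (boolP (odd (m.+1 - e))) => oe.
      by have := c2 (m - e)%N ltac:(lia) ltac:(lia); rewrite subKn //; lia.
    case: (eqVneq (m.+1 - e)%N n) => ne; first by apply: c4; lia.
    have := rYE2 (m.+1 - e)%N ltac:(lia) oe; case: (rY) => [hPe|[mn hPe]].
      have := Y0 m.-1 (m.+1 - e)%N ltac:(lia) ltac:(lia) hPe.
      rewrite HY; [|lia|lia]; rewrite /chain_value leqNgt (_ : (m.+1 - e < m.-1.+2)%N) /=;
        last by lia.
      rewrite (negPf oe) => /eqP; rewrite oppr_eq0 => /eqP <-; congr y; lia.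
    case: (eqVneq e 1%N) => [->//|e1].
    have := Y0 (m.-1 - (m.+1 - e))%N 0%N ltac:(lia) ltac:(lia) hPe.
    rewrite HY; [|lia|lia]; rewrite /chain_value (_ : (_.+2 <= 0)%N = false) // (_ : odd 0 =
      false) //.
    by move=> /eqP; rewrite oppr_eq0 => /eqP <-; congr y; lia.
  have phi0 a b : (a <= m.+1)%N -> (b < n)%N -> chain_value x y a b = 0.
    move=> le_am lt_bn; rewrite /chain_value; case: leqP => h; case: ifP => // _.
      by apply: x0; lia.
    by apply: y0; lia.
  split; apply: entP => a b lta ltb; rewrite ent0 ?HX ?HY ?phi0 ?oppr0 //; lia.
(* The prescribed values determine x and y; every chain outside the range of the
   stars gets the value 0. *)
pose x d := if (d < n)%N && odd (n - d) then
  (if rX then ent WX n.-1 (n.-1 - d) else ent WX d 0) else 0.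
pose y e := if (1 < e)%N then
    if (e <= m - n)%N then if odd n then ent WX n.-1 (e + n.-1) else 0
    else if ~~ odd (m.+1 - e) && (m.+1 - e < n)%N then
      - (if rY then ent WY m.-1 (m.+1 - e) else ent WY (e - 2) 0)
    else 0
  else 0.
have hk : chains_cut m n x y.
  split=> //.
  - move=> b lt_bn ob; rewrite /y; case: ifP => // lt1; case: ifP => [|_]; first by lia.
    by case: ifP => //; lia.
  - by move=> d lt_dn od; rewrite /x (negPf od) andbF.
  - move=> on e lt0e le_e; rewrite /y; case: ifP => // _; case: ifP => [_|];
    first by rewrite (negPf on).
    by case: ifP => //; lia.
exists (fun_mx n m (fun b a => chain_value x y a b)), (fun_mx m n (fun a b => - chain_value x y
  a.+2 b)).
split; first exact: J_J_ex.
  move=> i j Pij; have := ltn_ord i; have := ltn_ord j; rewrite mxE -!ent_ord => ltj lti.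
  case: (inPX _ _ Pij) => [/rXE1[oj [oi]]|[on ei lt_nj]].
    case: (boolP rX) => hr => [[mn ei]|ej].
      rewrite ei /chain_value (_ : (j <= n.-1)%N); last by lia.
      rewrite (negPf oj) /x hr (_ : _ && _); last by lia.
      by rewrite subKn //; lia.
    by rewrite ej /chain_value /= /x (negPf hr) subn0 lti oi.
  rewrite ei /chain_value leqNgt (_ : (n.-1 < j)%N) /=; last by lia.
  rewrite (_ : odd n.-1 = false); last by lia.
  rewrite /y (_ : (1 < j - n.-1)%N); last by lia.
  by rewrite (_ : (j - n.-1 <= m - n)%N) ?on ?subnK //; lia.
move=> i j Pij; have := ltn_ord i; have := ltn_ord j; rewrite mxE -!ent_ord => ltj lti.
have [oi [oj]] := rYE1 _ _ Pij; rewrite /chain_value.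
case: (boolP rY) => hr => [ei|[mn ej]].
  rewrite ei leqNgt (_ : (j < m.-1.+2)%N) /=; last by lia.
  rewrite (negPf oj) /y hr (_ : (1 < _)%N); last by lia.
  rewrite (_ : (_ <= m - n)%N = false); last by lia.
  rewrite (_ : _ && _); last by lia.
  by rewrite opprK; congr ent; lia.
rewrite ej /= /y /= (negPf hr) (_ : (_ <= m - n)%N = false); last by lia.
rewrite (_ : _ && _); last by lia.
by rewrite opprK; congr ent; lia.
Qed.

Lemma dual_sys2B m n (A : 'M[C]_m) (B : 'M[C]_n) X X' Y Y' :
  dual_sys2 A B X Y -> dual_sys2 A B X' Y' -> dual_sys2 A B (X - X') (Y - Y').
Proof.
move=> [h1 h2] [h3 h4]; split; rewrite linearB /= !mulmxBr addrACA -opprD.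
  by rewrite h1 h3 subrr.
by rewrite h2 h4 subrr.
Qed.

(** A solution for one block is a solution for the pair of two equal blocks in which
X = Y.  Exchanging X and Y preserves the equations of the pair, so by uniqueness
a solution with the same prescribed values in both blocks has X = Y. *)
Lemma J_diag_unisolvent n (P : 'M[bool]_n) : corner_pattern SW odd P ->
  unisolvent (dual_sys (N n)) P.
Proof.
move=> hP.
have PE : P = if odd n then pattern_sum P (P_pattern n n) else P.
  case: ifP => // _; apply/matrixP => i j; rewrite !mxE.
  by rewrite (ltnNge n j) ltnW ?ltn_ord // andbF orbF.
have [u x] := J_J_unisolvent (leqnn n) hP hP PE; split=> [Z hZ PZ|W].
  by have [] := u Z Z (conj hZ hZ) PZ PZ.
have [X [Y [hXY XW YW]]] := x W W.
have hYX : dual_sys2 (N n) (N n) Y X by case: hXY.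
have [||XY _] := u _ _ (dual_sys2B hXY hYX).
- by move=> i j Pij; rewrite !mxE XW // YW // subrr.
- by move=> i j Pij; rewrite !mxE XW // YW // subrr.
have {}XY : X = Y by apply/eqP; rewrite -subr_eq0 XY.
by exists X; rewrite // /dual_sys; case: hXY; rewrite XY.
Qed.
End JJ.

(** * Summands of the canonical matrix *)

Section Blocks.
Variable C : numClosedFieldType.
Local Notation N n := (jordan_mx n 0 : 'M[C]_n).

(** The first equation determines Y from X, and substituting it in the second leaves
an equation for X alone; all the stars can therefore be placed in X. *)
Lemma unisolvent2_unit m n (A : 'M[C]_m) (B : 'M[C]_n) PX : A \in unitmx ->
  unisolvent (fun X : 'M_(n, m) => B^T *m X *m A = B *m X *m A^T) PX ->
  unisolvent2 (dual_sys2 A B) PX (zero_pattern m n).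
Proof.
move=> Au [u x]; have ATu : A^T \in unitmx by rewrite unitmx_tr.
have E X Y : dual_sys2 A B X Y <-> Y = - (invmx A^T *m (A *m X^T)) /\
    B^T *m X *m A = B *m X *m A^T.
  have EY : A *m X^T + A^T *m Y = 0 <-> Y = - (invmx A^T *m (A *m X^T)).
    split=> [/eqP|->]; last by rewrite mulmxN mulKVmx // subrr.
    by rewrite addrC addr_eq0 => /eqP e; rewrite -(mulKmx ATu Y) e mulmxN.
  have EX : A *m X^T + A^T *m Y = 0 ->
      (B *m Y^T + B^T *m X = 0 <-> B^T *m X *m A = B *m X *m A^T).
    move=> /(congr1 trmx); rewrite linearD /= !trmx_mul !trmxK trmx0 => /eqP.
    rewrite addrC addr_eq0 => /eqP e.
    have E1 : (B *m Y^T + B^T *m X) *m A = B^T *m X *m A - B *m X *m A^T.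
      by rewrite mulmxDl -(mulmxA B) e mulmxN mulmxA addrC.
    split=> [h|/eqP]; first by apply/eqP; rewrite -subr_eq0 -E1 h mul0mx.
    by rewrite -subr_eq0 -E1 => /eqP h; rewrite -(mulmxK Au (_ + _)) h mul0mx.
  by split=> [[h1 h2]|[/EY h1 h2]]; split=> //; [apply/EY|apply/EX|apply/EX].
split=> [X Y /E[YE hX] PX0 _|WX WY].
  have X0 := u _ hX PX0; split=> //.
  by rewrite YE X0 trmx0 !mulmx0 oppr0.
have [X hX XW] := x WX; exists X, (- (invmx A^T *m (A *m X^T))); split=> //.
  exact/E.
by move=> i j; rewrite mxE.
Qed.

Lemma jordan_unit n (l : C) : l != 0 -> jordan_mx n l \in unitmx.
Proof.
move=> l0; rewrite -unitmx_tr unitmxE det_trig; last first.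
  apply/is_trig_mxP => i j lt_ij; rewrite !mxE; case: eqP => [e|_].
    by rewrite e ltnn in lt_ij.
  by case: eqP => // e; lia.
rewrite unitfE; apply/prodf_neq0 => i _; by rewrite !mxE eqxx.
Qed.

Lemma H_unit m (l : C) : l != 0 -> H_mx m l \in unitmx.
Proof.
move=> l0; have : H_mx m l *m block_mx 0 (invmx (jordan_mx m l)) 1%:M 0 = 1%:M.
  rewrite mulmx_block !mul0mx !mul1mx !mulmx0 !addr0 !add0r mulmxV ?jordan_unit //.
  by rewrite -scalar_mx_block.
by case/mulmx1_unit.
Qed.

(** The matrix G in the factorizations Gamma = gamma_sign G (1 + N) and
Gamma^T = G (1 - N), which allow one to work with N instead of the cosquare of
Gamma. *)
Definition alt_antidiag n : 'M[C]_n := \matrix_(i, j) (if (i + j).+1 == n then (-1) ^+ i else 0).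
(** The eigenvalue of the cosquare of Gamma_n. *)
Definition gamma_sign n : C := (-1) ^+ n.+1.

Lemma alt_antidiag_mulE n q (M : 'M[C]_(n, q)) i j : (alt_antidiag n *m M) i j =
  (-1) ^+ i * M (rev_ord i) j.
Proof.
rewrite mxE (bigD1 (rev_ord i)) //= big1 => [|k /negP k_neq].
  rewrite mxE /= addr0 (_ : _ == n) //; have := ltn_ord i; lia.
rewrite mxE; case: eqP => [e|]; last by rewrite mul0r.
by case: k_neq; apply/eqP/val_inj => /=; lia.
Qed.

Lemma alt_antidiag_unit n : alt_antidiag n \in unitmx.
Proof.
have : alt_antidiag n *m (alt_antidiag n)^T = 1%:M.
  apply/matrixP => i j; rewrite alt_antidiag_mulE !mxE -val_eqE /=.
  have := ltn_ord i; have := ltn_ord j => ltj lti.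
  case: (eqVneq (i : nat) j) => [e|ne].
    rewrite e (_ : (_ == n) = true); last by lia.
    by rewrite -expr2 sqrr_sign.
  by rewrite (_ : (_ == n) = false) ?mulr0 //; lia.
by case/mulmx1_unit.
Qed.

Lemma sign_odd_eq a b : odd a = odd b -> (-1) ^+ a = (-1) ^+ b :> C.
Proof. by move=> e; rewrite -signr_odd e signr_odd. Qed.

Lemma sign_eq1 k : ((-1) ^+ k == 1 :> C) = ~~ odd k.
Proof.
rewrite -signr_odd; case: (odd k); rewrite ?expr0 ?eqxx // expr1.
by rewrite eq_sym -addr_eq0 -mulr2n pnatr_eq0.
Qed.

Lemma gamma_sign_sqr n : gamma_sign n * gamma_sign n = 1.
Proof. by rewrite /gamma_sign -expr2 sqrr_sign. Qed.

Lemma gamma_sign_neq0 n : gamma_sign n != 0.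
Proof. by rewrite /gamma_sign signr_eq0. Qed.

Lemma gamma_trE n : (gamma_mx C n)^T = alt_antidiag n *m (1%:M - N n).
Proof.
apply/matrixP => i j; rewrite alt_antidiag_mulE !mxE -val_eqE /=.
have := ltn_ord i; have := ltn_ord j => ltj lti.
case: eqP => [e|ne1] /=.
  rewrite (_ : _ == _) /=; last by lia.
  rewrite subr0 mulr1; congr (_ ^+ _); lia.
case: eqP => [e|ne2] /=.
  rewrite (_ : (_ == _) = false) /=; last by lia.
  rewrite (_ : (_ == _)) /=; last by lia.
  rewrite sub0r mulrN1; have -> : (i = (n - j.+1).+1 :> nat)%N by lia.
  by rewrite exprS mulN1r opprK.
rewrite (_ : (n - i.+1 == j)%N = false); last by lia.
rewrite (_ : ((n - i.+1).+1 == j)%N = false) /=; last by lia.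
by rewrite subr0 mulr0.
Qed.

Lemma gammaE n : gamma_mx C n = gamma_sign n *: (alt_antidiag n *m (1%:M + N n)).
Proof.
apply/matrixP => i j; rewrite mxE [in RHS]mxE alt_antidiag_mulE !mxE -val_eqE /=.
have := ltn_ord i; have := ltn_ord j => ltj lti.
have E : gamma_sign n * (-1) ^+ i = (-1) ^+ (n - i.+1).
  rewrite /gamma_sign -exprD; apply: sign_odd_eq; lia.
case: eqP => [e|ne1] /=.
  rewrite (_ : _ == _) /=; last by lia.
  by rewrite addr0 mulr1 E.
case: eqP => [e|ne2] /=.
  rewrite (_ : (_ == _) = false) /=; last by lia.
  rewrite (_ : (_ == _)) /=; last by lia.
  by rewrite add0r mulr1 E.
rewrite (_ : (n - i.+1 == j)%N = false); last by lia.
rewrite (_ : ((n - i.+1).+1 == j)%N = false) /=; last by lia.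
by rewrite addr0 !mulr0.
Qed.

Lemma gamma_unit n : gamma_mx C n \in unitmx.
Proof.
by rewrite gammaE unitmxZ ?unitfE ?gamma_sign_neq0 //
  unitmx_mul alt_antidiag_unit -jordanE jordan_unit ?oner_neq0.
Qed.

Lemma ent_eqP p q (Z W : 'M[C]_(p, q)) :
  Z = W <-> (forall a b, ent Z a b = ent W a b).
Proof. by split=> [->//|h]; apply: entP. Qed.

Lemma ent_jordan_l p q (la : C) (Z : 'M[C]_(p, q)) a b :
  ent (jordan_mx p la *m Z) a b = la * ent Z a b + ent Z a.+1 b.
Proof. by rewrite jordanE mulmxDl mul_scalar_mx entD entZ ent_shift_l. Qed.

Lemma ent_jordan_r p q (la : C) (Z : 'M[C]_(p, q)) a b :
  ent (Z *m (jordan_mx q la)^T) a b = la * ent Z a b + ent Z a b.+1.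
Proof. by rewrite -[Z *m _]trmxK trmx_mul trmxK entT ent_jordan_l !entT. Qed.

Lemma prod_sysP p q (mu la : C) (Z : 'M[C]_(p, q)) :
  Z = jordan_mx p mu *m Z *m (jordan_mx q la)^T <-> corner_sys la mu 1 (la * mu - 1) Z.
Proof.
rewrite corner_sysP; split=> [/ent_eqP h a b|h].
  by have := h a b; rewrite ent_jordan_r !ent_jordan_l => /eqP; rewrite -subr_eq0 => /eqP e;
     rewrite -[RHS]oppr0 -e; ring.
apply/ent_eqP => a b; apply/eqP; rewrite ent_jordan_r !ent_jordan_l -subr_eq0.
by apply/eqP; rewrite -[RHS]oppr0 -(h a b); ring.
Qed.

Lemma com_sysP p q (mu la : C) (Z : 'M[C]_(p, q)) :
  jordan_mx p mu *m Z = Z *m (jordan_mx q la)^T <-> corner_sys 1 (-1) 0 (mu - la) Z.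
Proof.
rewrite corner_sysP; split=> [/ent_eqP h a b|h].
  have := h a b; rewrite ent_jordan_r !ent_jordan_l => /eqP; rewrite -subr_eq0 => /eqP e.
  by rewrite -[RHS]e; ring.
apply/ent_eqP => a b; apply/eqP; rewrite ent_jordan_r !ent_jordan_l -subr_eq0.
by apply/eqP; rewrite -[RHS](h a b); ring.
Qed.

Lemma zero_pattern_sub m1 m2 n1 n2 (X := zero_pattern (m1 + m2) (n1 + n2)) :
  [/\ ulsubmx X = zero_pattern _ _, ursubmx X = zero_pattern _ _,
      dlsubmx X = zero_pattern _ _ & drsubmx X = zero_pattern _ _].
Proof. by split; apply/matrixP=> i j; rewrite !mxE. Qed.

Lemma zero_pattern_row m n1 n2 (X := zero_pattern m (n1 + n2)) :
  lsubmx X = zero_pattern _ _ /\ rsubmx X = zero_pattern _ _.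
Proof. by split; apply/matrixP=> i j; rewrite !mxE. Qed.

Lemma flip_eq p q r c (Z W : 'M[C]_(p, q)) : flip_mx r c Z = flip_mx r c W <-> Z = W.
Proof. by split=> [/(can_inj (@flip_mxK C p q r c))|->]. Qed.

Lemma and4_iff (a a' b b' c c' d d' : Prop) : (a <-> a') -> (b <-> b') -> (c <-> c') ->
  (d <-> d') -> [/\ a, b, c & d] <-> [/\ a', b', c' & d'].
Proof. by move=> [? ?] [? ?] [? ?] [? ?]; split=> -[] *; split; auto. Qed.

(** H_mx is block antidiagonal, so the four blocks of X decouple; each of them
satisfies a product or a commutation equation with Jordan blocks, brought to the
corner NW by a flip. *)
Lemma H_H_sysP m n (la mu : C) (X : 'M[C]_(n + n, m + m)) :
  (H_mx n mu)^T *m X *m H_mx m la = H_mx n mu *m X *m (H_mx m la)^T <->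
  [/\ corner_sys la mu 1 (la * mu - 1) (flip_mx false false (ulsubmx X)),
      corner_sys 1 (-1) 0 (mu - la) (flip_mx false true (ursubmx X)),
      corner_sys 1 (-1) 0 (mu - la) (flip_mx true false (dlsubmx X)) &
      corner_sys la mu 1 (la * mu - 1) (flip_mx true true (drsubmx X))].
Proof.
set X1 := ulsubmx X; set X2 := ursubmx X; set X3 := dlsubmx X; set X4 := drsubmx X.
have E1 : X1 = jordan_mx n mu *m X1 *m (jordan_mx m la)^T <->
    corner_sys la mu 1 (la * mu - 1) (flip_mx false false X1).
  by rewrite flip_mxFF prod_sysP.
have E2 : X2 *m jordan_mx m la = jordan_mx n mu *m X2 <->
    corner_sys 1 (-1) 0 (mu - la) (flip_mx false true X2).
  rewrite -com_sysP -(flip_eq false true (X2 *m _)) (flip_mulmxl _ _ _ _ true) flip_jordan.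
  by rewrite (flip_mulmxl _ _ _ _ false) flip_mxFF; split=> ->.
have E3 : (jordan_mx n mu)^T *m X3 = X3 *m (jordan_mx m la)^T <->
    corner_sys 1 (-1) 0 (mu - la) (flip_mx true false X3).
  rewrite -com_sysP -(flip_eq true false (_ *m X3)) (flip_mulmxl _ _ _ _ true).
  by rewrite -flip_mxT flip_jordan trmxK (flip_mulmxl _ _ X3 _ false) flip_mxFF.
have E4 : X4 = (jordan_mx n mu)^T *m X4 *m jordan_mx m la <->
    corner_sys la mu 1 (la * mu - 1) (flip_mx true true X4).
  rewrite -prod_sysP -(flip_eq true true X4) (flip_mulmxl _ _ _ _ true).
  by rewrite (flip_mulmxl _ _ _ X4 true) -[flip_mx true true _^T]flip_mxT !flip_jordan trmxK.
apply: iff_trans (and4_iff E1 E2 E3 E4).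
rewrite -{1 2}[X]submxK /H_mx !tr_block_mx !trmx0 !trmx1 !mulmx_block.
rewrite !(mul0mx, mulmx0, mul1mx, mulmx1, add0r, addr0) -/X1 -/X2 -/X3 -/X4.
split=> [/eq_block_mx[e1 e2 e3 e4]|[e1 e2 e3 e4]]; first by split.
by rewrite -e1 e2 e3 -e4.
Qed.

Lemma H_H_unisolvent m n (la mu : C) (X : 'M[bool]_(n + n, m + m)) Y :
  la != 0 -> mu != 0 -> offdiag_pattern (b := HBlock m la) (b' := HBlock n mu) X Y ->
  unisolvent2 (dual_sys2 (H_mx m la) (H_mx n mu)) X Y.
Proof.
move=> la0 mu0 [-> hX]; apply: unisolvent2_unit; first exact: H_unit.
have muE : (la == mu^-1) = (la * mu - 1 == 0).
  by rewrite subr_eq0 -(inj_eq (mulIf mu0)) mulVf.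
have laE : (la == mu) = (mu - la == 0) by rewrite subr_eq0 eq_sym.
have n1 : (1 : C) != 0 by exact: oner_neq0.
have nm1 : (-1 : C) != 0 by rewrite oppr_eq0.
have [P1 P2 P3 P4] : [/\
  (if la * mu - 1 == 0 then corner_pattern NW predT (ulsubmx X) else ulsubmx X =
    zero_pattern _ _),
  (if mu - la == 0 then corner_pattern NE predT (ursubmx X) else ursubmx X = zero_pattern _ _),
  (if mu - la == 0 then corner_pattern SW predT (dlsubmx X) else dlsubmx X = zero_pattern _ _) &
  (if la * mu - 1 == 0 then corner_pattern SE predT (drsubmx X) else drsubmx X =
    zero_pattern _ _)].
  move: hX; rewrite -muE -laE; case: (eqVneq la mu) => [e|ne] /=.
    rewrite -e; case: (boolP ((la == 1) || (la == -1))) => h1.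
      by rewrite (_ : la == la^-1) //; case/orP: h1 => /eqP->; rewrite ?invrN invr1.
    rewrite (_ : (la == la^-1) = false) //; apply: contraNF h1 => /eqP h.
    by rewrite -sqrf_eq1 expr2 {1}h mulVf.
  case: (eqVneq la mu^-1) => [e|ne2] /=; last first.
    by move=> ->; have [-> -> -> ->] := zero_pattern_sub n n m m.
  rewrite ifF //; apply: contraNF ne => h; rewrite -[mu]invrK -e.
  by case/orP: h => /eqP->; rewrite ?invrN invr1.
apply: (unisolvent_block
  (E11 := fun Z => corner_sys la mu 1 (la * mu - 1) (flip_mx false false Z))
  (E12 := fun Z => corner_sys 1 (-1) 0 (mu - la) (flip_mx false true Z))
  (E21 := fun Z => corner_sys 1 (-1) 0 (mu - la) (flip_mx true false Z))
  (E22 := fun Z => corner_sys la mu 1 (la * mu - 1) (flip_mx true true Z))).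
- exact: H_H_sysP.
- exact: (corner_unisolvent (c := NW)).
- exact: (corner_unisolvent (c := NE)).
- exact: (corner_unisolvent (c := SW)).
exact: (corner_unisolvent (c := SE)).
Qed.

Lemma ent_1B_l p q (Z : 'M[C]_(p, q)) a b :
  ent ((1%:M - N p) *m Z) a b = ent Z a b - ent Z a.+1 b.
Proof. by rewrite mulmxBl mul1mx entD entN ent_shift_l. Qed.

Lemma ent_1D_l p q (Z : 'M[C]_(p, q)) a b :
  ent ((1%:M + N p) *m Z) a b = ent Z a b + ent Z a.+1 b.
Proof. by rewrite mulmxDl mul1mx entD ent_shift_l. Qed.

Lemma ent_1B_r p q (Z : 'M[C]_(p, q)) a b :
  ent (Z *m (1%:M - (N q)^T)) a b = ent Z a b - ent Z a b.+1.
Proof. by rewrite mulmxBr mulmx1 entD entN ent_shift_r. Qed.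

Lemma ent_1D_r p q (Z : 'M[C]_(p, q)) a b :
  ent (Z *m (1%:M + (N q)^T)) a b = ent Z a b + ent Z a b.+1.
Proof. by rewrite mulmxDr mulmx1 entD ent_shift_r. Qed.

(** Substituting Gamma = gamma_sign G (1 + N) and Gamma^T = G (1 - N) and cancelling
the invertible factors G leaves (1 - N) X (1 - N^T) = s (1 + N) X (1 + N^T). *)
Lemma gamma_gamma_sysP m n (X : 'M[C]_(n, m)) (s := gamma_sign n * gamma_sign m) :
  (gamma_mx C n)^T *m X *m gamma_mx C m = gamma_mx C n *m X *m (gamma_mx C m)^T <->
  corner_sys (- (1 + s)) (- (1 + s)) (1 - s) (1 - s) X.
Proof.
have gE : gamma_mx C m = (1%:M - (N m)^T) *m (alt_antidiag m)^T.
  by rewrite -[gamma_mx C m]trmxK gamma_trE trmx_mul linearB /= tr_scalar_mx.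
have gTE : (gamma_mx C m)^T = gamma_sign m *: ((1%:M + (N m)^T) *m (alt_antidiag m)^T).
  by rewrite gammaE linearZ /= trmx_mul linearD /= tr_scalar_mx.
rewrite gTE gE gamma_trE gammaE -!scalemxAl -!scalemxAr scalerA -/s.
set L := (X in X = _); set R := (X in _ = X).
have -> : L = alt_antidiag n *m ((1%:M - N n) *m X *m (1%:M - (N m)^T)) *m (alt_antidiag m)^T.
  by rewrite /L !mulmxA.
have -> : R = alt_antidiag n *m (s *: ((1%:M + N n) *m X *m (1%:M + (N m)^T))) *m (alt_antidiag
  m)^T.
  by rewrite /R -scalemxAr -scalemxAl !mulmxA.
have GTu : (alt_antidiag m)^T \in unitmx by rewrite unitmx_tr alt_antidiag_unit.
have -> : forall U V : 'M_(n, m), alt_antidiag n *m U *m (alt_antidiag m)^T =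
  alt_antidiag n *m V *m (alt_antidiag m)^T <-> U = V.
  move=> U V; split=> [|->//] /(can_inj (mulmxK GTu)).
  exact: (can_inj (mulKmx (alt_antidiag_unit n))).
rewrite corner_sysP ent_eqP; split=> h a b; have {h} := h a b.
  rewrite entZ ent_1B_r !ent_1B_l ent_1D_r !ent_1D_l => /eqP; rewrite -subr_eq0 => /eqP e.
  by rewrite -[RHS]e; ring.
rewrite entZ ent_1B_r !ent_1B_l ent_1D_r !ent_1D_l => e; apply/eqP; rewrite -subr_eq0.
by apply/eqP; rewrite -[RHS]e; ring.
Qed.

Lemma gamma_gamma_unisolvent m n (X : 'M[bool]_(n, m)) Y :
  offdiag_pattern (b := @GammaBlock C m) (b' := @GammaBlock C n) X Y ->
  unisolvent2 (dual_sys2 (gamma_mx C m) (gamma_mx C n)) X Y.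
Proof.
move=> [-> hX]; apply: unisolvent2_unit; first exact: gamma_unit.
apply: (eq_unisolvent (fun Z => iff_sym (gamma_gamma_sysP Z))).
have sE : gamma_sign n * gamma_sign m = (-1) ^+ (odd m (+) odd n).
  by rewrite /gamma_sign -exprD; apply: sign_odd_eq; lia.
apply: (eq_unisolvent (E := fun Z => corner_sys (- (1 + gamma_sign n * gamma_sign m)) (- (1 +
  gamma_sign n * gamma_sign m))
   (1 - gamma_sign n * gamma_sign m) (1 - gamma_sign n * gamma_sign m) (flip_mx false false Z))).
  by move=> Z; rewrite flip_mxFF.
apply: (corner_unisolvent (c := NW)); move: hX; rewrite sE; case: (_ (+) _).
- by move=> _ /eqP; rewrite expr1 opprK -mulr2n pnatr_eq0.
- by rewrite expr0 oppr_eq0 -mulr2n pnatr_eq0.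
- by move=> ->; rewrite expr1 opprK -mulr2n pnatr_eq0.
by rewrite expr0 subrr eqxx.
Qed.

Lemma gamma_diag_unisolvent n (P : 'M[bool]_n) :
  diag_pattern (b := @GammaBlock C n) P -> unisolvent (dual_sys (gamma_mx C n)) P.
Proof.
move=> hP; apply: (eq_unisolvent (E := diag_sys (gamma_sign n) (-1) (gamma_sign n))).
  move=> Z; rewrite /dual_sys gamma_trE gammaE -scalemxAl -!mulmxA scalemxAr -mulmxDr.
  have -> (U : 'M_n) : alt_antidiag n *m U = 0 <-> U = 0.
    by split=> [h|->]; [rewrite -(mulKmx (alt_antidiag_unit n) U) h mulmx0 | rewrite mulmx0].
  rewrite diag_sysP ent_eqP; split=> h a b; have {h} := h a b.
    by rewrite entD entZ ent_1D_l ent_1B_l !entT ent0 => e; rewrite -[RHS]e; ring.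
  by rewrite entD entZ ent_1D_l ent_1B_l !entT ent0 => e; rewrite -[RHS]e; ring.
apply: (diag_unisolvent (s := if odd n then even else odd)).
- by rewrite expr2 gamma_sign_sqr.
- by rewrite gamma_sign_sqr eq_sym -addr_eq0 -mulr2n pnatr_eq0.
- by move=> k; rewrite /gamma_sign -exprD sign_eq1 oddD /even /=; case: (odd n); case: (odd k).
by move: hP => /=; case: (odd n).
Qed.

Lemma H_gamma_sysP m n (la : C) (X : 'M[C]_(n, m + m)) (e := gamma_sign n) :
  (gamma_mx C n)^T *m X *m H_mx m la = gamma_mx C n *m X *m (H_mx m la)^T <->
  corner_sys (- (1 + e * la)) (- e) (- e) (1 - e * la) (flip_mx false false (lsubmx X)) /\
  corner_sys (- (la + e)) 1 (- 1) (la - e) (flip_mx false true (rsubmx X)).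
Proof.
set X1 := lsubmx X; set X2 := rsubmx X.
have E1 : (1%:M - N n) *m X1 = e *: ((1%:M + N n) *m X1 *m (jordan_mx m la)^T) <->
    corner_sys (- (1 + e * la)) (- e) (- e) (1 - e * la) (flip_mx false false X1).
  rewrite flip_mxFF corner_sysP ent_eqP; split=> h a b; have {h} := h a b.
    rewrite entZ ent_jordan_r !ent_1B_l !ent_1D_l => /eqP; rewrite -subr_eq0 => /eqP h.
    by rewrite -[RHS]h; ring.
  rewrite entZ ent_jordan_r !ent_1B_l !ent_1D_l => h; apply/eqP; rewrite -subr_eq0.
  by apply/eqP; rewrite -[RHS]h; ring.
have E2 : (1%:M - N n) *m X2 *m jordan_mx m la = e *: ((1%:M + N n) *m X2) <->
    corner_sys (- (la + e)) 1 (- 1) (la - e) (flip_mx false true X2).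
  have flipZ (U : 'M[C]_(n, m)) : flip_mx false true (e *: U) = e *: flip_mx false true U.
    by apply/matrixP => i j; rewrite !mxE.
  rewrite -(flip_eq false true (_ *m jordan_mx m la)) flipZ (flip_mulmxl _ _ _ _ true).
  rewrite flip_jordan (flip_mulmxl _ _ _ X2 false) (flip_mulmxl _ _ _ X2 false) !flip_mxFF.
  rewrite corner_sysP ent_eqP; split=> h a b; have {h} := h a b.
    rewrite entZ ent_jordan_r !ent_1B_l !ent_1D_l => /eqP; rewrite -subr_eq0 => /eqP h.
    by rewrite -[RHS]h; ring.
  rewrite entZ ent_jordan_r !ent_1B_l !ent_1D_l => h; apply/eqP; rewrite -subr_eq0.
  by apply/eqP; rewrite -[RHS]h; ring.
have and2 (a b c d : Prop) : (a <-> b) -> (c <-> d) -> a /\ c <-> b /\ d by tauto.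
apply: iff_trans (and2 _ _ _ _ E1 E2).
rewrite gamma_trE gammaE -!mulmxA -scalemxAl -!mulmxA scalemxAr.
have GU (U V : 'M_(n, m + m)) : alt_antidiag n *m U = alt_antidiag n *m V <-> U = V.
  by split=> [/(can_inj (mulKmx (alt_antidiag_unit n)))|->].
rewrite GU -{1 2}[X]hsubmxK -/X1 -/X2 /H_mx !tr_block_mx !trmx0 !trmx1 !mul_row_block.
rewrite !(mul0mx, mulmx0, mul1mx, mulmx1, add0r, addr0) !mul_mx_row scale_row_mx.
rewrite mulmxA [_ *m (X1 *m _)]mulmxA.
by split=> [/eq_row_mx[e1 e2]|[e1 e2]]; [split|rewrite e1 e2].
Qed.

Lemma H_gamma_unisolvent m n (la : C) (X : 'M[bool]_(n, m + m)) Y : la != 0 ->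
  offdiag_pattern (b := HBlock m la) (b' := @GammaBlock C n) X Y ->
  unisolvent2 (dual_sys2 (H_mx m la) (gamma_mx C n)) X Y.
Proof.
move=> la0 [-> hX]; apply: unisolvent2_unit; first exact: H_unit.
have n1 : (1 : C) != 0 by exact: oner_neq0.
have E1 : (1 - gamma_sign n * la == 0) = (la == gamma_sign n).
  by rewrite subr_eq0 -{1}(gamma_sign_sqr n) (inj_eq (mulfI (gamma_sign_neq0 n))) eq_sym.
have E2 : (la - gamma_sign n == 0) = (la == gamma_sign n) by rewrite subr_eq0.
apply: (unisolvent_row
  (E1 := fun Z => corner_sys (- (1 + gamma_sign n * la)) (- gamma_sign n) (- gamma_sign n) (1 -
    gamma_sign n * la)
    (flip_mx false false Z))
  (E2 := fun Z => corner_sys (- (la + gamma_sign n)) 1 (- 1) (la - gamma_sign n) (flip_mx false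
    true Z))).
- exact: H_gamma_sysP.
- apply: (corner_unisolvent (c := NW)).
    move/eqP; rewrite E1 => /eqP ->; rewrite gamma_sign_sqr !oppr_eq0 -mulr2n pnatr_eq0.
    by rewrite gamma_sign_neq0.
  move: hX; rewrite E1 -/(gamma_sign n); case: ifP => [_ []//|_ ->].
  by have [] := zero_pattern_row n m m.
apply: (corner_unisolvent (c := NE)).
  move/eqP; rewrite E2 => /eqP ->; rewrite oppr_eq0 -mulr2n mulrn_eq0 /= n1.
  by rewrite gamma_sign_neq0.
move: hX; rewrite E2 -/(gamma_sign n); case: ifP => [_ []//|_ ->].
by have [] := zero_pattern_row n m m.
Qed.

(** The lower left block commutes with the transposed Jordan block, as in the case of
a pair, and determines the upper right one.  The upper left block solves
Z = - J Z^T, hence Z = J Z J^T: it vanishes unless the square of the eigenvalue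
is 1, and then diag_unisolvent applies.  The lower right block solves the same
equation after a half-turn and a transposition. *)
Lemma H_diag_unisolvent m (la : C) (P : 'M[bool]_(m + m)) : la != 0 ->
  diag_pattern (b := HBlock m la) P -> unisolvent (dual_sys (H_mx m la)) P.
Proof.
move=> la0 hP.
pose E1 (Z : 'M[C]_m) := Z + jordan_mx m la *m Z^T = 0.
have E1_diag Z : E1 Z <-> diag_sys la 0 1 Z.
  rewrite /E1 diag_sysP ent_eqP; split=> h a b; have {h} := h a b.
    by rewrite entD ent_jordan_l !entT ent0 => h; rewrite -[RHS]h; ring.
  by rewrite entD ent_jordan_l !entT ent0 => h; rewrite -[RHS]h; ring.
have E1_zero Z : la ^+ 2 != 1 -> E1 Z -> Z = 0.
  move=> la2; rewrite /E1 => /eqP; rewrite addr_eq0 => /eqP e.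
  have : Z = jordan_mx m la *m Z *m (jordan_mx m la)^T.
    by rewrite {1}e {1}e linearN /= trmx_mul trmxK mulmxN opprK mulmxA.
  by move/prod_sysP; apply: corner_sys_vanish; rewrite subr_eq0 -expr2.
pose P1 (Q : 'M[bool]_m) c := if la == 1 then corner_pattern c even Q
  else if la == -1 then corner_pattern c odd Q else Q = zero_pattern m m.
have E1_uni Q : P1 Q NW -> unisolvent E1 Q.
  have main s : la ^+ 2 = 1 -> (forall k, s k = (la * (-1) ^+ k == 1)) ->
      corner_pattern NW s Q -> unisolvent E1 Q.
    move=> la2 sE hQ; apply: (eq_unisolvent (fun Z => iff_sym (E1_diag Z))).
    by apply: (diag_unisolvent (s := s)) => //; rewrite mulr1 eq_sym.
  rewrite /P1; case: eqVneq => [la1|la1].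
    apply: main; first by rewrite la1 expr1n.
    by move=> k; rewrite la1 mul1r sign_eq1.
  case: eqVneq => [lam1|lam1].
    apply: main; first by rewrite lam1 sqrrN expr1n.
    by move=> k; rewrite lam1 -exprS sign_eq1 /= negbK.
  move=> ->; apply: unisolvent_zero; first by rewrite /E1 trmx0 mulmx0 addr0.
  by move=> Z; apply: E1_zero; rewrite sqrf_eq1 negb_or la1 lam1.
have [P11 P12 P21 P22] : [/\ P1 (ulsubmx P) NW, ursubmx P = zero_pattern m m,
    corner_pattern SW predT (dlsubmx P) & P1 (drsubmx P) SE].
  by move: hP; rewrite /P1 /=; case: ifP => _; [|case: ifP => _]; case.
apply: (unisolvent_block_dep (E11 := E1) (f := fun Z => - (jordan_mx m la *m Z^T))
   (E21 := fun Z => corner_sys 1 (-1) 0 (la - la) (flip_mx true false Z))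
   (E22 := fun Z => E1 (flip_mx true true Z)^T)) => //.
- move=> Z; set Z1 := ulsubmx Z; set Z2 := ursubmx Z; set Z3 := dlsubmx Z; set Z4 := drsubmx Z.
  have E3 : (jordan_mx m la)^T *m Z3 = Z3 *m (jordan_mx m la)^T <->
      corner_sys 1 (-1) 0 (la - la) (flip_mx true false Z3).
    rewrite -com_sysP -(flip_eq true false (_ *m Z3)) (flip_mulmxl _ _ _ _ true).
    by rewrite -flip_mxT flip_jordan trmxK (flip_mulmxl _ _ Z3 _ false) flip_mxFF.
  have E4 : Z4^T + (jordan_mx m la)^T *m Z4 = 0 <-> E1 (flip_mx true true Z4)^T.
    have JE : jordan_mx m la = flip_mx true true (jordan_mx m la)^T.
      by rewrite -flip_mxT flip_jordan trmxK.
    rewrite /E1 trmxK flip_mxT [in X in _ <-> X]JE.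
    rewrite -(flip_mulmxl _ _ _ Z4 true); set U := (_ + _); set V := (_ + _).
    have -> : V = flip_mx true true U by apply/matrixP => i j; rewrite !mxE.
    by rewrite -[X in _ <-> _ = X](flip_mx0 C m m true true) flip_eq.
  apply: iff_trans (and4_iff (iff_refl _) (iff_refl _) E3 E4).
  rewrite /dual_sys -{1 2}[Z]submxK /H_mx !tr_block_mx !trmx0 !trmx1 !mulmx_block.
  rewrite !(mul0mx, mulmx0, mul1mx, mulmx1, add0r, addr0) -/Z1 -/Z2 -/Z3 -/Z4.
  rewrite add_block_mx -block_mx0 /E1.
  split=> [/eq_block_mx[e1 e2 e3 e4]|[e1 e2 e3 e4]].
    have Z2E : Z2 = - (jordan_mx m la *m Z3^T).
      by apply/eqP; rewrite -addr_eq0 addrC e4.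
    split=> //; first by rewrite addrC.
    move: e1; rewrite Z2E linearN /= trmx_mul trmxK addrC => /eqP.
    by rewrite subr_eq0 => /eqP.
  rewrite e2 linearN /= trmx_mul trmxK -e3 addNr subrr; congr block_mx => //.
  by rewrite addrC.
- by rewrite trmx0 mulmx0 oppr0.
- exact: E1_uni.
- apply: (corner_unisolvent (c := SW)); last by rewrite subrr eqxx.
  by rewrite oppr_eq0 oner_neq0.
apply: (unisolvent_flip (E := fun Z => E1 Z^T)); apply: unisolventT; apply: E1_uni.
move: P22; rewrite /P1.
have NWT s (Q : 'M[bool]_m) : corner_pattern SE s Q ->
  corner_pattern NW s (flip_mx true true Q)^T.
  move/corner_pattern_flip => [] [h ->]; [right|left]; split=> //;
  by apply/matrixP => i j; rewrite !mxE.
case: ifP => _; first exact: NWT.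
case: ifP => _; first exact: NWT.
by move=> ->; apply/matrixP => i j; rewrite !mxE.
Qed.

(** With K = A^T A^-1, row a - 1 of X equals row a + 1 of X K for 0 <= a < n, rows
outside the matrix being zero.  Counting from 0, the odd rows vanish, starting
from the equation for a = 0.  The even rows are images of each other under powers
of K; they vanish when n is even because row n does, and when n is odd they are
determined by the first or by the last of them. *)
Lemma unit_J_unisolvent m n (A : 'M[C]_m) (P : 'M[bool]_(n, m)) : A \in unitmx ->
  (if odd n then updown_pattern P else P = zero_pattern _ _) ->
  unisolvent (fun X : 'M_(n, m) => (N n)^T *m X *m A = N n *m X *m A^T) P.
Proof.
move=> Au hP; pose K := A^T *m invmx A.
have Ku : K \in unitmx by rewrite unitmx_mul unitmx_tr unitmx_inv Au.
apply: (eq_unisolvent (E := fun X : 'M_(n, m) => (N n)^T *m X = N n *m (X *m K))).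
  move=> X; rewrite /K !mulmxA; split=> [->|h]; first by rewrite mulmxKV.
  by rewrite -h mulmxK.
pose zero_row (X : 'M[C]_(n, m)) a := forall b, ent X a b = 0.
have zero_rowK X U a : zero_row X a -> zero_row (X *m U) a.
  move=> h b; case: (ltnP a n) => [lt_an|ge_an]; last by rewrite ent_out ?ge_an.
  case: (ltnP b m) => [lt_bm|ge_bm]; last by rewrite ent_out ?ge_bm ?orbT.
  rewrite -[a]/(val (Ordinal lt_an)) -[b]/(val (Ordinal lt_bm)) ent_ord mxE big1 // => k _.
  by rewrite -ent_ord h mul0r.
have zrK' X a : zero_row (X *m K) a -> zero_row X a.
  by move=> /(zero_rowK _ (invmx K)); rewrite mulmxK.
split=> [X /ent_eqP hX PX|W].
  have step a : (a < n)%N -> forall b,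
      (if a is a'.+1 then ent X a' b else 0) = ent (X *m K) a.+1 b.
    by move=> lt_an b; have := hX a b; rewrite ent_shift_l ent_up_shift.
  have up a : (a.+1 < n)%N -> zero_row X a -> zero_row X a.+2.
    by move=> lt_an h; apply: zrK' => b; rewrite -step // h.
  have dn a : (a.+1 < n)%N -> zero_row X a.+2 -> zero_row X a.
    by move=> lt_an h b; have /= := step a.+1 lt_an b => ->; apply: (zero_rowK _ K _ h).
  have out a : (n <= a)%N -> zero_row X a by move=> h b; rewrite ent_out ?h.
  have ups k a : zero_row X a -> zero_row X (a + k.*2)%N.
    elim: k => [|k IH] h; first by rewrite double0 addn0.
    case: (ltnP (a + k.*2).+1 n) => [lt|ge]; last by apply: out; rewrite doubleS; lia.
    by rewrite doubleS !addnS; apply: up => //; apply: IH.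
  have dns k a : (a + k.*2 <= n)%N -> zero_row X (a + k.*2)%N -> zero_row X a.
    elim: k a => [|k IH] a le_n; first by rewrite double0 addn0.
    by rewrite doubleS !addnS -!addSn => /IH h; apply: dn; [lia|apply: h; lia].
  have odd0 a : odd a -> zero_row X a.
    move=> oa; have -> : a = (1 + (a./2).*2)%N by rewrite -[LHS]odd_double_half oa.
    apply: ups; case: (posnP n) => [n0|lt0n]; first by apply: out; lia.
    by apply: zrK' => b; rewrite -(step 0%N).
  have even0 a : (a <= n)%N -> ~~ odd a -> zero_row X a.
    move=> le_an ea; case: (boolP (odd n)) hP => on hP; last first.
      have h : (a + ((n - a)./2).*2 = n)%N by lia.
      by apply: (dns (n - a)./2); rewrite h //; apply: out.
    have row0 (i : 'I_n) : (forall j, P i j) -> zero_row X i.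
      move=> Pi b; case: (ltnP b m) => [lt_bm|ge_bm]; last by rewrite ent_out ?ge_bm ?orbT.
      by rewrite -[b]/(val (Ordinal lt_bm)) ent_ord PX // mxE.
    have lt0n : (0 < n)%N by case: (n) on.
    have lt1n : (n.-1 < n)%N by lia.
    case: hP => PE.
      have -> : a = (0 + (a./2).*2)%N by lia.
      by apply: ups; apply: (row0 (Ordinal lt0n)) => j; rewrite PE mxE.
    have h : a = n.+1 \/ (a + ((n.-1 - a)./2).*2 = n.-1)%N by lia.
    case: h => [e|h]; first by lia.
    apply: (dns (n.-1 - a)./2); first by lia.
    by rewrite h; apply: (row0 (Ordinal lt1n)) => j; rewrite PE mxE.
  apply: entP => a b lt_an _; rewrite ent0; case: (boolP (odd a)) => oa; first exact: odd0.
  by apply: even0 => //; apply: ltnW.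
move: hP; case: ifP => on hP; last first.
  by exists 0; rewrite ?mul0mx ?mulmx0 // => i j; rewrite hP mxE.
have lt0n : (0 < n)%N by case: (n) on.
have lt1n : (n.-1 < n)%N by lia.
have main (w : 'rV[C]_m) : exists2 X : 'M_(n, m), (N n)^T *m X = N n *m (X *m K) &
    forall i : 'I_n, ~~ odd i -> row i X = iter i./2 (mulmx ^~ (invmx K)) w.
  pose f k := iter k (mulmx ^~ (invmx K)) w.
  pose X : 'M_(n, m) := \matrix_(i < n) (if odd i then 0 else f i./2).
  have rX i : row i X = if odd i then 0 else f i./2 by rewrite rowK.
  exists X => [|i /negPf oi]; last by rewrite rX oi.
  have zodd a : odd a -> zero_row X a.
    move=> oa b; case: (ltnP a n) => [lt_an|ge_an]; last by rewrite ent_out ?ge_an.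
    case: (ltnP b m) => [lt_bm|ge_bm]; last by rewrite ent_out ?ge_bm ?orbT.
    by rewrite -[a]/(val (Ordinal lt_an)) -[b]/(val (Ordinal lt_bm)) ent_ord !mxE /= oa mxE.
  apply: entP => a b lt_an lt_bm; rewrite ent_up_shift // ent_shift_l.
  case: a lt_an => [|a] lt_an; first by rewrite (zero_rowK _ K) //; apply: zodd.
  case: (boolP (odd a)) => oa; first by rewrite zodd // (zero_rowK _ K) //; apply: zodd;
    rewrite /= negbK.
  have lt_a2 : (a.+2 < n)%N by lia.
  have lt_a : (a < n)%N by lia.
  rewrite -[a in LHS]/(val (Ordinal lt_a)) -[a.+2]/(val (Ordinal lt_a2)).
  rewrite -[b]/(val (Ordinal lt_bm)) !ent_ord.
  have : row (Ordinal lt_a) X = row (Ordinal lt_a2) (X *m K).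
    by rewrite row_mul !rX /= negbK (negPf oa) /= mulmxKV.
  by move/rowP/(_ (Ordinal lt_bm)); rewrite !mxE => ->; apply: eq_bigr => k _; rewrite !mxE.
case: hP => PE.
  have [X hX XE] := main (row (Ordinal lt0n) W); exists X => // i j.
  rewrite PE mxE => /eqP i0; have {}i0 : i = Ordinal lt0n by apply: val_inj.
  by have := XE i; rewrite i0 => /(_ isT) /rowP/(_ j); rewrite !mxE.
pose k := n.-1./2.
have [X hX XE] := main (iter k (mulmx ^~ K) (row (Ordinal lt1n) W)); exists X => // i j.
rewrite PE mxE => /eqP i0; have {}i0 : i = Ordinal lt1n by apply: val_inj.
have cancel_iter k' (w : 'rV[C]_m) : iter k' (mulmx ^~ (invmx K)) (iter k' (mulmx ^~ K) w) = w.
  by elim: k' w => // k' IH w; rewrite iterSr [iter k'.+1 (mulmx ^~ K) w]iterS mulmxK.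
have oi : ~~ odd (Ordinal lt1n) by rewrite /=; lia.
by have := XE _ oi; rewrite i0 cancel_iter => /rowP/(_ j); rewrite !mxE.
Qed.

Lemma diag_block_unisolvent (b : block C) P : valid_block b -> diag_pattern P ->
  unisolvent (dual_sys (block_matrix b)) P.
Proof.
case: b P => [m l|n|n] P /=; last by move=> _; apply: J_diag_unisolvent.
- by case/and3P => _ l0 _ hP; apply: H_diag_unisolvent.
by move=> _ hP; apply: gamma_diag_unisolvent.
Qed.

Lemma offdiag_block_unisolvent (b b' : block C) X Y : valid_block b -> valid_block b' ->
  may_precede b b' -> @offdiag_pattern C b b' X Y ->
  unisolvent2 (dual_sys2 (block_matrix b) (block_matrix b')) X Y.
Proof.
case: b X Y => [m l|m|m]; case: b' => [n u|n|n] //= X Y.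
- by move=> /and3P[_ l0 _] /and3P[_ u0 _] _ ?; apply: H_H_unisolvent.
- by move=> /and3P[_ l0 _] _ _ ?; apply: H_gamma_unisolvent.
- move=> /and3P[_ l0 _] _ _ [-> hX]; apply: unisolvent2_unit; first exact: H_unit.
  by apply: unit_J_unisolvent; rewrite ?H_unit.
- by move=> *; apply: gamma_gamma_unisolvent.
- move=> _ _ _ [-> hX]; apply: unisolvent2_unit; first exact: gamma_unit.
  by apply: unit_J_unisolvent; rewrite ?gamma_unit.
move=> _ _ le_nm [hY hX].
have [Q hQ XE] : exists2 Q, corner_pattern SW odd Q &
    X = if odd n then pattern_sum Q (P_pattern n m) else Q.
  by move: hX; case: ifP => _ // hX; exists X.
exact: J_J_unisolvent hQ hY XE.
Qed.

End Blocks.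

(** * Assembling the blocks *)

Section Global.
Variables (C : numClosedFieldType) (t : nat) (p_ : 'I_t -> nat).
Let s := (\sum_i p_ i)%N.

(** For a block diagonal matrix the equation only links the blocks in positions
(i, j) and (j, i). *)
Lemma dual_sys_block (A : forall i, 'M[C]_(p_ i)) (Z : 'M_s) :
  dual_sys (\mxdiag_i A i) Z <->
  forall i j, A i *m (submxblock Z j i)^T + (A i)^T *m submxblock Z i j = 0.
Proof.
rewrite /dual_sys tr_mxdiag -{1 2}[Z]submxblockK tr_mxblock !mul_mxdiag_mxblock -mxblockD.
split=> [h i j|h]; last first.
  by rewrite -[RHS]mxblock0; apply: eq_mxblock => i j; apply: h.
by have := congr1 (fun M => submxblock M i j) h; rewrite mxblockK submxblock0.
Qed.

(** Solutions are chosen independently for every diagonal block and for every pair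
of opposite blocks. *)
Lemma block_unisolvent (A : forall i, 'M[C]_(p_ i)) (P : 'M[bool]_s) :
  (forall i, unisolvent (dual_sys (A i)) (submxblock P i i)) ->
  (forall i j : 'I_t, (i < j)%N ->
     unisolvent2 (dual_sys2 (A i) (A j)) (submxblock P j i) (submxblock P i j)) ->
  unisolvent (dual_sys (\mxdiag_i A i)) P.
Proof.
move=> hd ho; split=> [Z /dual_sys_block hZ PZ|W].
  have PZb i j : agree_on (submxblock P i j) (submxblock Z i j) 0.
    by move=> a b; rewrite !mxE => /PZ ->; rewrite mxE.
  apply/mxblockP => i j; rewrite submxblock0; case: (ltngtP i j) => [lt_ij|lt_ji|/val_inj <-].
  - by have [u _] := ho _ _ lt_ij; have [] := u (submxblock Z j i) (submxblock Z i j)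
      (conj (hZ i j) (hZ j i)) (PZb _ _) (PZb _ _).
  - by have [u _] := ho _ _ lt_ji; have [] := u (submxblock Z i j) (submxblock Z j i)
      (conj (hZ j i) (hZ i j)) (PZb _ _) (PZb _ _).
  by have [u _] := hd i; apply: u => //; apply: hZ.
pose Wb i j := submxblock W i j.
have exD i : exists Z, dual_sys (A i) Z /\ agree_on (submxblock P i i) Z (Wb i i).
  by have [_ x] := hd i; have [Z h1 h2] := x (Wb i i); exists Z.
pose D i := sval (cid (exD i)); have hD i := svalP (cid (exD i)).
have exO (i j : 'I_t) : exists XY : 'M[C]_(p_ j, p_ i) * 'M[C]_(p_ i, p_ j), (i < j)%N ->
   [/\ dual_sys2 (A i) (A j) XY.1 XY.2, agree_on (submxblock P j i) XY.1 (Wb j i) &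
       agree_on (submxblock P i j) XY.2 (Wb i j)].
  case: (ltnP i j) => [lt_ij|_]; last by exists (0, 0).
  by have [_ x] := ho _ _ lt_ij; have [X [Y h]] := x (Wb j i) (Wb i j); exists (X, Y).
pose O i j := sval (cid (exO i j)); have hO i j := svalP (cid (exO i j)).
(* The diagonal block D i has type p_ i x p_ i; conform_mx casts it to the type
   required for i and j, which only matters for i = j. *)
pose Zb i j : 'M[C]_(p_ i, p_ j) := if (i < j)%N then (O i j).2 else
  if (j < i)%N then (O j i).1 else conform_mx 0 (D i).
have Zbd i : Zb i i = D i by rewrite /Zb ltnn conform_mx_id.
have Zbu (i j : 'I_t) : (i < j)%N -> Zb i j = (O i j).2 by rewrite /Zb => ->.
have Zbl (i j : 'I_t) : (i < j)%N -> Zb j i = (O i j).1.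
  by move=> h; rewrite /Zb h ltnNge ltnW.
exists (\mxblock_(i, j) Zb i j).
  apply/dual_sys_block => i j; rewrite !mxblockK.
  case: (ltngtP i j) => [lt_ij|lt_ji|/val_inj <-].
  - by rewrite (Zbu _ _ lt_ij) (Zbl _ _ lt_ij); have [[]] := hO _ _ lt_ij.
  - by rewrite (Zbu _ _ lt_ji) (Zbl _ _ lt_ji); have [[]] := hO _ _ lt_ji.
  by rewrite Zbd; have [] := hD i.
have agreeb i j : agree_on (submxblock P i j) (Zb i j) (Wb i j).
  case: (ltngtP i j) => [lt_ij|lt_ji|/val_inj <-].
  - by rewrite Zbu //; have [] := hO _ _ lt_ij.
  - by rewrite Zbl //; have [] := hO _ _ lt_ji.
  by rewrite Zbd; have [] := hD i.
move=> a b Pab; rewrite -(submxblockK W) [LHS]mxE [RHS]mxE; apply: agreeb.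
by move: Pab; rewrite -{1}(submxblockK P) mxE.
Qed.

End Global.

Theorem canonical_unisolvent (C : numClosedFieldType) t (B : 'I_t -> block C) P :
  canonical_blocks B -> canonical_pattern P -> unisolvent (dual_sys (canonical_mx B)) P.
Proof.
move=> [hv hm] [hd ho]; apply: block_unisolvent => [i|i j lt_ij].
  exact: diag_block_unisolvent.
by apply: offdiag_block_unisolvent; auto.
Qed.

(** * Geometric limits of complex numbers *)

Definition dyadic (C : numClosedFieldType) k : C := 2^-1 ^+ k.

(** What the power series arguments need from the field: the powers of 1/2 become
arbitrarily small, and a sequence with geometrically decreasing increments
converges. *)
Definition geometrically_complete (C : numClosedFieldType) : Prop :=
  (forall M e : C, 0 < e -> exists K, `|M| * dyadic C K < e) /\
  (forall (u : nat -> C) (M : C), (forall k, `|u k.+1 - u k| <= M * dyadic C k) ->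
     exists l, forall k, `|u k - l| <= 4 * M * dyadic C k).

Section Half.
Variable C : numClosedFieldType.
Local Notation dyadic := (dyadic C).

Lemma dyadic_gt0 k : 0 < dyadic k.
Proof. by rewrite exprn_gt0 // invr_gt0. Qed.

Lemma dyadic_ge0 k : 0 <= dyadic k.
Proof. exact: ltW (dyadic_gt0 k). Qed.

Lemma dyadic_le j k : (j <= k)%N -> dyadic k <= dyadic j.
Proof.
by move=> le_jk; apply: ler_wiXn2l => //; rewrite ?invr_ge0 // invf_le1 ?ler1n.
Qed.

(** Passage to the limit in an inequality with a geometric error term. *)
Lemma le_dyadic_le (x y M : C) : geometrically_complete C ->
  x \is Num.real -> y \is Num.real ->
  (forall K, x <= y + M * dyadic K) -> 0 <= M -> x <= y.
Proof.
move=> Cc xr yr h M0; rewrite real_leNgt //; apply/negP => lt_yx.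
have [K] := Cc.1 M (x - y) ltac:(by rewrite subr_gt0).
rewrite ger0_norm // ltrBrDl => /lt_le_trans /(_ (h K)).
by rewrite ltxx.
Qed.

Lemma small_eq0 (x M : C) : geometrically_complete C ->
  0 <= M -> (forall K, `|x| <= M * dyadic K) -> x = 0.
Proof.
move=> Cc M0 h; apply/eqP; rewrite -normr_le0; apply: (@le_dyadic_le _ _ M Cc) => //.
  exact: normr_real.
by move=> K; rewrite add0r.
Qed.

End Half.

Section Complex.
Local Open Scope complex_scope.
Variable R : realType.
Local Notation C := R[i].
Local Notation dyadic := (dyadic C).

Lemma dyadicR k : dyadic k = (2^-1 ^+ k : R)%:C.
Proof. by rewrite /dyadic rmorphXn /= fmorphV rmorph_nat. Qed.

Lemma exists_dyadic_lt (M e : C) : 0 < e -> exists K, `|M| * dyadic K < e.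
Proof.
move=> e0; have x0 : 0 <= `|M| / e by rewrite divr_ge0 // ltW.
have xR : (complex.Re (`|M| / e))%:C = `|M| / e by apply: RRe_real; apply: ger0_real.
have r0 : 0 <= complex.Re (`|M| / e) by rewrite -lecR xR.
exists (Num.bound (complex.Re (`|M| / e))).
set K := Num.bound _; have : `|M| / e < K%:R.
  by rewrite -xR -[K%:R](rmorph_nat (real_complex R)) ltcR; apply: archi_boundP.
rewrite ltr_pdivrMr // => h; rewrite /dyadic exprVn ltr_pdivrMr ?exprn_gt0 //.
apply: lt_le_trans h _; rewrite mulrC ler_pM2l // -natrX ler_nat.
exact/ltnW/ltn_expl.
Qed.

(** With w k twice the k-th bound, u - w is nondecreasing and u + w is nonincreasing,
so the supremum of u - w lies between them. *)
Lemma real_geom_limit (u : nat -> R) (m : R) :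
  (forall k, `|u k.+1 - u k| <= m * 2^-1 ^+ k) ->
  exists l, forall k, `|u k - l| <= 2 * m * 2^-1 ^+ k.
Proof.
move=> hu; pose w k := 2 * m * 2^-1 ^+ k : R.
have wS k : w k = w k.+1 + m * 2^-1 ^+ k by rewrite /w exprS; field.
have w0 k : 0 <= w k.
  have := le_trans (normr_ge0 _) (hu k); rewrite /w -mulrA => h.
  by rewrite mulr_ge0.
have up j k : (j <= k)%N -> u j - w j <= u k - w k.
  move=> /subnK <-; elim: (k - j)%N => // d IH; apply: le_trans IH _; rewrite addSn.
  by have := hu (d + j)%N; have := wS (d + j)%N; rewrite ler_norml => -> /andP[]; lra.
have dn j k : (j <= k)%N -> u k + w k <= u j + w j.
  move=> /subnK <-; elim: (k - j)%N => // d IH; apply: le_trans _ IH; rewrite addSn.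
  by have := hu (d + j)%N; have := wS (d + j)%N; rewrite ler_norml => -> /andP[]; lra.
have lr j k : u j - w j <= u k + w k.
  case: (leqP j k) => [le_jk|/ltnW le_kj].
    by have := up _ _ le_jk; have := w0 k; lra.
  by have := dn _ _ le_kj; have := w0 j; lra.
pose A := [set x | exists k, x = u k - w k]%classic.
have ubA k : ubound A (u k + w k) by move=> x [j ->].
have A0 : (A !=set0)%classic by exists (u 0%N - w 0%N), 0%N.
exists (sup A) => k; rewrite -/(w k).
have h1 : u k - w k <= sup A by apply: ub_le_sup; [exists (u 0%N + w 0%N)|exists k].
have h2 : sup A <= u k + w k by apply: ge_sup.
by rewrite ler_norml; apply/andP; split; lra.
Qed.

Lemma Im_le_norm (z : C) : (`|complex.Im z|%:C <= `|z|).
Proof.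
rewrite normc_def lecR -sqrtr_sqr ler_sqrt; last by rewrite addr_ge0 ?sqr_ge0.
by rewrite lerDr sqr_ge0.
Qed.

Lemma norm_le_ReIm (z : C) : `|z| <= `|complex.Re z|%:C + `|complex.Im z|%:C.
Proof.
rewrite normc_def -rmorphD /= lecR -[leRHS]ger0_norm ?addr_ge0 // -sqrtr_sqr.
rewrite ler_sqrt ?sqr_ge0 // sqrrD !real_normK ?num_real // lerD2r lerDl mulrn_wge0 //.
by rewrite mulr_ge0.
Qed.

Lemma geom_limit (u : nat -> C) (M : C) :
  (forall k, `|u k.+1 - u k| <= M * dyadic k) ->
  exists l, forall k, `|u k - l| <= 4 * M * dyadic k.
Proof.
move=> hu; have M0 : 0 <= M.
  by have := le_trans (normr_ge0 _) (hu 0%N); rewrite /dyadic expr0 mulr1.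
have MR : M = (complex.Re M)%:C by rewrite RRe_real // ger0_real.
have [a ha] : exists l, forall k, `|complex.Re (u k) - l| <= 2 * complex.Re M * 2^-1 ^+ k.
  apply: real_geom_limit => k; rewrite -lecR rmorphM /= -MR -dyadicR.
  by apply: le_trans (hu k); apply: le_trans (normc_ge_Re _); case: (u k.+1) (u k) => [? ?] [? ?].
have [b hb] : exists l, forall k, `|complex.Im (u k) - l| <= 2 * complex.Re M * 2^-1 ^+ k.
  apply: real_geom_limit => k; rewrite -lecR rmorphM /= -MR -dyadicR.
  by apply: le_trans (hu k); apply: le_trans (Im_le_norm _); case: (u k.+1) (u k) => [? ?] [? ?].
exists (a +i* b) => k; apply: le_trans (norm_le_ReIm _) _.
have := lerD (ha k) (hb k); rewrite -lecR rmorphD /= => h.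
have -> : 4 * M * dyadic k =
    (2 * complex.Re M * 2^-1 ^+ k + 2 * complex.Re M * 2^-1 ^+ k)%:C.
  by rewrite dyadicR {1}MR -[4]/(4%:R) -(rmorph_nat (real_complex R)) -!rmorphM /=;
    congr (_%:C); ring.
by case: (u k) h => ? ?.
Qed.

Lemma complex_complete : geometrically_complete C.
Proof. by split; [exact: exists_dyadic_lt|exact: geom_limit]. Qed.

End Complex.

(** * Holomorphic functions *)

Section Holomorphic.
Variables (C : numClosedFieldType) (n : nat).
Local Notation M := 'M[C]_n.

Definition mx_lt (E : M) (e : C) := forall i j, `|E i j| < e.

(** Neighborhoods of 0 in terms of the entries. *)
Lemma near0P (Q : M -> Prop) :
  (\forall E \near (0 : M), Q E) <-> exists2 e : C, 0 < e & forall E, mx_lt E e -> Q E.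
Proof.
split=> [/nbhs_ballP[e /= e0 h]|[e e0 h]].
  exists e => // E Ee; apply: h; split=> // i j; rewrite /ball /= mxE sub0r normrN.
  exact: Ee.
apply/nbhs_ballP; exists e => //= E [_ Ee]; apply: h => i j.
by have := Ee i j; rewrite /ball /= mxE sub0r normrN.
Qed.

Lemma totallyP (a : 'M[nat]_n -> C) (l : C) :
  (summability.partial_sum a @ summability.totally --> l)%classic <->
  forall e : C, 0 < e -> exists J0 : {fset 'M[nat]_n}, forall J : {fset 'M[nat]_n},
    fsubset J0 J -> `|l - \sum_(m <- J) a m| < e.
Proof.
have E J : summability.partial_sum a J = \sum_(m <- J) a m.
  by rewrite /summability.partial_sum big_seq_fsetE.
have FF := @summability.totally_filter 'M[nat]_n.
rewrite cvgrPdist_lt; split=> h e e0.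
  by have [J0 _ hJ] := h e e0; exists J0 => J /hJ; rewrite /= E.
by have [J0 hJ] := h e e0; exists J0 => // J /hJ; rewrite /= E.
Qed.

End Holomorphic.

Section HoloClosure.
Variables (C : numClosedFieldType) (n : nat).
Local Notation M := 'M[C]_n.

Lemma holomorphic_near (f g : M -> C) : (\forall E \near (0 : M), f E = g E) ->
  holomorphic_at0 f -> holomorphic_at0 g.
Proof.
move=> /near0P[e1 e10 h1] [a /near0P[e2 e20 h2]]; exists a; apply/near0P.
have er : e1 >=< e2 by rewrite real_comparable ?gtr0_real.
exists (Num.min e1 e2) => [|E Ee]; first by rewrite comparable_lt_min ?e10.
have E1 : mx_lt E e1 by move=> i j; have := Ee i j; rewrite comparable_lt_min // => /andP[].
have E2 : mx_lt E e2 by move=> i j; have := Ee i j; rewrite comparable_lt_min // => /andP[].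
by rewrite -h1 //; apply: h2.
Qed.

(** Both series are controlled by the same finite sets of exponents: take unions. *)
Lemma holomorphic_linear (f g : M -> C) (c : C) : holomorphic_at0 f -> holomorphic_at0 g ->
  holomorphic_at0 (fun E => c * f E + g E).
Proof.
move=> [a /near0P[e1 e10 h1]] [b /near0P[e2 e20 h2]].
exists (fun m => c * a m + b m); apply/near0P.
have er : e1 >=< e2 by rewrite real_comparable ?gtr0_real.
exists (Num.min e1 e2) => [|E Ee]; first by rewrite comparable_lt_min ?e10.
have E1 : mx_lt E e1 by move=> i j; have := Ee i j; rewrite comparable_lt_min // => /andP[].
have E2 : mx_lt E e2 by move=> i j; have := Ee i j; rewrite comparable_lt_min // => /andP[].
apply/totallyP => e e0; pose k := 2 * (1 + `|c|).
have k0 : 0 < k by rewrite mulr_gt0 // ltr_pwDl.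
have ek0 : 0 < e / k by rewrite divr_gt0.
have [J1 hJ1] := (totallyP _ _).1 (h1 E E1) _ ek0.
have [J2 hJ2] := (totallyP _ _).1 (h2 E E2) _ ek0.
exists (J1 `|` J2)%fset => J; rewrite fsubUset => /andP[/hJ1 d1 /hJ2 d2].
rewrite (eq_bigr (fun m => c * (a m * mx_monomial E m) + b m * mx_monomial E m)); last first.
  by move=> m _; rewrite mulrDl mulrA.
rewrite big_split /= -mulr_sumr opprD addrACA -mulrBr.
apply: le_lt_trans (ler_normD _ _) _; rewrite normrM.
apply: (@le_lt_trans _ _ ((1 + `|c|) * (e / k))).
  rewrite mulrDl mul1r [leLHS]addrC; apply: lerD; first exact: ltW.
  by rewrite ler_wpM2l // ltW.
have -> : (1 + `|c|) * (e / k) = e / 2.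
  by rewrite /k; field; rewrite gt_eqF // ltr_pwDl.
by rewrite ltr_pdivrMr // ltr_pMr // ltr1n.
Qed.

Lemma holomorphic_cst (c : C) : holomorphic_at0 (fun _ : M => c).
Proof.
exists (fun m => if m == 0 then c else 0); apply/near0P; exists 1 => // E _.
apply/totallyP => e e0; exists [fset 0]%fset => J /fsubsetP/(_ 0);
  rewrite inE eqxx => /(_ isT) J0.
rewrite (bigD1_seq 0) ?fset_uniq //= eqxx big1 => [|m /negPf->]; last by rewrite mul0r.
rewrite /mx_monomial big1 ?mulr1 ?addr0 ?subrr ?normr0 // => i _.
by rewrite big1 // => j _; rewrite mxE expr0.
Qed.

Lemma holomorphic_sum (I : Type) (r : seq I) (c : I -> C) (f : I -> M -> C) :
  (forall i, holomorphic_at0 (f i)) -> holomorphic_at0 (fun E => \sum_(i <- r) c i * f i E).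
Proof.
move=> hf; elim: r => [|i r IH].
  have -> : (fun E : M => \sum_(i <- [::]) c i * f i E) = fun _ => 0.
    by apply/funext => E; rewrite big_nil.
  exact: holomorphic_cst.
have -> : (fun E : M => \sum_(j <- i :: r) c j * f j E) =
    fun E => c i * f i E + \sum_(j <- r) c j * f j E.
  by apply/funext => E; rewrite big_cons.
exact: holomorphic_linear.
Qed.

End HoloClosure.


(** * Polynomials as lists of terms, and Picard iteration *)

Section Terms.
Variables (C : numClosedFieldType) (n : nat).
Local Notation M := 'M[C]_n.
Local Notation term := (C * 'M[nat]_n)%type.
Implicit Types (s : seq term) (E : M).

Definition mx_deg (m : 'M[nat]_n) : nat := (\sum_i \sum_j m i j)%N.

Lemma mx_degD m m' : mx_deg (m + m') = (mx_deg m + mx_deg m')%N.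
Proof.
rewrite /mx_deg -big_split /=; apply: eq_bigr => i _.
by rewrite -big_split /=; apply: eq_bigr => j _; rewrite mxE.
Qed.

Lemma mx_monomialD E m m' :
  mx_monomial E (m + m') = mx_monomial E m * mx_monomial E m'.
Proof.
rewrite /mx_monomial -big_split /=; apply: eq_bigr => i _.
by rewrite -big_split /=; apply: eq_bigr => j _; rewrite mxE -exprD.
Qed.

Lemma norm_monomial_le E m (x : C) : (forall i j, `|E i j| <= x) ->
  `|mx_monomial E m| <= x ^+ mx_deg m.
Proof.
move=> Ex; rewrite /mx_monomial /mx_deg expr_sum normr_prod; apply: ler_prod => i _.
rewrite normr_ge0 expr_sum normr_prod; apply: ler_prod => j _.
by rewrite normr_ge0 normrX lerXn2r // ?nnegrE ?normr_ge0 // (le_trans _ (Ex i j)).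
Qed.

(** A polynomial in the entries of E is given by a list of pairs of a coefficient and
a matrix of exponents, in any order and with repetitions.  Products are then
plain lists of products of terms, on which the weighted norm is multiplicative
and which truncation does not reorder. *)
Definition terms_eval s E : C := \sum_(t <- s) t.1 * mx_monomial E t.2.
Definition terms_norm (r : C) s : C := \sum_(t <- s) `|t.1| * r ^+ mx_deg t.2.
Definition terms_scale (c : C) s : seq term := [seq (c * t.1, t.2) | t <- s].
Definition terms_mul s s' : seq term := [seq (x.1 * y.1, x.2 + y.2) | x <- s, y <- s'].
Definition terms_min_deg k s := all (fun t => (k <= mx_deg t.2)%N) s.
Definition terms_trunc k s : seq term := [seq t <- s | (mx_deg t.2 <= k)%N].
Definition terms_coef s m : C := \sum_(t <- s | t.2 == m) t.1.

Lemma terms_eval_cat s s' E : terms_eval (s ++ s') E = terms_eval s E + terms_eval s' E.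
Proof. by rewrite /terms_eval big_cat. Qed.

Lemma terms_eval_scale c s E : terms_eval (terms_scale c s) E = c * terms_eval s E.
Proof. by rewrite /terms_eval big_map mulr_sumr; apply: eq_bigr => t _; rewrite mulrA. Qed.

Lemma terms_eval_mul s s' E : terms_eval (terms_mul s s') E = terms_eval s E * terms_eval s' E.
Proof.
rewrite /terms_eval /terms_mul big_allpairs_dep mulr_suml; apply: eq_bigr => x _.
by rewrite mulr_sumr; apply: eq_bigr => y _; rewrite mx_monomialD mulrACA.
Qed.

Lemma terms_eval_filterID (a : pred term) s E :
  terms_eval s E = terms_eval [seq t <- s | a t] E + terms_eval [seq t <- s | ~~ a t] E.
Proof. by rewrite /terms_eval !big_filter [LHS](bigID a). Qed.

Lemma terms_norm_cat r s s' : terms_norm r (s ++ s') = terms_norm r s + terms_norm r s'.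
Proof. by rewrite /terms_norm big_cat. Qed.

Lemma terms_norm_scale r c s : terms_norm r (terms_scale c s) = `|c| * terms_norm r s.
Proof. by rewrite /terms_norm big_map mulr_sumr; apply: eq_bigr => t _; rewrite normrM mulrA. Qed.

Lemma terms_norm_mul r s s' : terms_norm r (terms_mul s s') = terms_norm r s * terms_norm r s'.
Proof.
rewrite /terms_norm /terms_mul big_allpairs_dep mulr_suml; apply: eq_bigr => x _.
by rewrite mulr_sumr; apply: eq_bigr => y _; rewrite mx_degD exprD normrM mulrACA.
Qed.

Lemma terms_norm_ge0 r s : 0 <= r -> 0 <= terms_norm r s.
Proof. by move=> r0; apply: sumr_ge0 => t _; rewrite mulr_ge0 ?exprn_ge0. Qed.

Lemma terms_norm_filter r (a : pred term) s : 0 <= r -> terms_norm r [seq t <- s | a t] <=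
  terms_norm r s.
Proof.
move=> r0; rewrite /terms_norm big_filter; rewrite [leRHS](bigID a) /= lerDl.
by apply: sumr_ge0 => t _; rewrite mulr_ge0 ?exprn_ge0.
Qed.

(** Contracting the argument by x <= 1 gains a factor x^k on polynomials without
terms of degree below k. *)
Lemma norm_eval_le k s E (x r : C) : terms_min_deg k s -> 0 <= x -> x <= 1 -> 0 <= r ->
  (forall i j, `|E i j| <= x * r) -> `|terms_eval s E| <= x ^+ k * terms_norm r s.
Proof.
move=> hs x0 x1 r0 Er; rewrite /terms_eval /terms_norm mulr_sumr.
apply: le_trans (ler_norm_sum _ _ _) _; rewrite big_seq [leRHS]big_seq.
apply: ler_sum => t ts; rewrite normrM mulrCA ler_wpM2l //.
apply: le_trans (norm_monomial_le _ Er) _; rewrite exprMn ler_wpM2r ?exprn_ge0 //.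
by apply: ler_wiXn2l => //; have /allP := hs; apply.
Qed.

Lemma terms_eval_big (I : Type) (r : seq I) (F : I -> seq term) E :
  terms_eval (\big[cat/[::]]_(i <- r) F i) E = \sum_(i <- r) terms_eval (F i) E.
Proof. by rewrite (big_morph (terms_eval^~ E) (fun s s' => terms_eval_cat s s' E) (id1 := 0))
  // /terms_eval big_nil. Qed.

Lemma terms_norm_big (I : Type) (r : seq I) (F : I -> seq term) x :
  terms_norm x (\big[cat/[::]]_(i <- r) F i) = \sum_(i <- r) terms_norm x (F i).
Proof. by rewrite (big_morph (terms_norm x) (terms_norm_cat x) (id1 := 0)) //
  /terms_norm big_nil. Qed.

Lemma terms_trunc_cat k s s' : terms_trunc k (s ++ s') = terms_trunc k s ++ terms_trunc k s'.
Proof. exact: filter_cat. Qed.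

Lemma terms_trunc_big k (I : Type) (r : seq I) (F : I -> seq term) :
  terms_trunc k (\big[cat/[::]]_(i <- r) F i) = \big[cat/[::]]_(i <- r) terms_trunc k (F i).
Proof. by rewrite (big_morph (terms_trunc k) (terms_trunc_cat k) (id1 := [::])). Qed.

Lemma terms_trunc_scale k c s : terms_trunc k (terms_scale c s) = terms_scale c (terms_trunc k s).
Proof. by rewrite /terms_trunc /terms_scale filter_map. Qed.

Lemma terms_trunc_eq0 k s : terms_min_deg k.+1 s -> terms_trunc k s = [::].
Proof.
move=> hs; apply/eqP; rewrite -(negbK (_ == _)) -has_filter; apply/hasPn => t ts.
by rewrite -ltnNge; have /allP := hs; apply.
Qed.

(** Factors without constant term: a product of degree at most k only involves terms
of smaller degree. *)
Lemma terms_trunc_mul k s s' : terms_min_deg 1 s -> terms_min_deg 1 s' ->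
  terms_trunc k (terms_mul s s') = terms_trunc k (terms_mul (terms_trunc k.-1 s) (terms_trunc
    k.-1 s')).
Proof.
move=> hs hs'; elim: s hs => //= x s IH /andP[hx hs].
rewrite /terms_mul allpairs_cons terms_trunc_cat -/(terms_mul s s') IH //.
case: ifP => hxk.
  rewrite allpairs_cons terms_trunc_cat; congr (_ ++ _).
  rewrite /terms_trunc !filter_map; congr map; rewrite -filter_predI.
  apply: eq_in_filter => y ys' /=; rewrite mx_degD.
  by have := allP hs' y ys'; move: hx hxk; lia.
rewrite terms_trunc_eq0 //; apply/allP => z /mapP[y ys' ->] /=; rewrite mx_degD.
by have := allP hs' y ys'; move: hx hxk; lia.
Qed.

Lemma terms_min_deg_cat k s s' : terms_min_deg k (s ++ s') =
  terms_min_deg k s && terms_min_deg k s'.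
Proof. exact: all_cat. Qed.

Lemma terms_min_deg_big k (I : Type) (r : seq I) (F : I -> seq term) :
  (forall i, terms_min_deg k (F i)) -> terms_min_deg k (\big[cat/[::]]_(i <- r) F i).
Proof. by move=> h; elim/big_ind: _ => // s s' hs hs'; rewrite terms_min_deg_cat hs. Qed.

Lemma terms_min_deg_mul k k' s s' : terms_min_deg k s -> terms_min_deg k' s' ->
  terms_min_deg (k + k') (terms_mul s s').
Proof.
move=> hs hs'; apply/allP => t /allpairsP[[x y] /= [xs ys' ->]] /=; rewrite mx_degD.
by have := allP hs x xs; have := allP hs' y ys' => /= *; lia.
Qed.

Lemma terms_min_deg_scale k c s : terms_min_deg k (terms_scale c s) = terms_min_deg k s.
Proof. by rewrite /terms_min_deg all_map. Qed.

Lemma terms_min_deg_le j k s : (j <= k)%N -> terms_min_deg k s -> terms_min_deg j s.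
Proof. by move=> le_jk; apply: sub_all => t; apply: leq_trans. Qed.

Lemma terms_coef_trunc k s m : (mx_deg m <= k)%N -> terms_coef (terms_trunc k s) m =
  terms_coef s m.
Proof.
move=> le_m; rewrite /terms_coef big_filter_cond; apply: eq_bigl => t /=.
by case: (eqVneq t.2 m) => [->|]; rewrite ?andbF // le_m.
Qed.

(** Summing over a finite set of exponents amounts to keeping the terms that carry
one of these exponents. *)
Lemma sum_coef s (J : {fset 'M[nat]_n}) E :
  \sum_(m <- J) terms_coef s m * mx_monomial E m = terms_eval [seq t <- s | t.2 \in J] E.
Proof.
have E1 m : terms_coef s m * mx_monomial E m =
    \sum_(t <- s) (if t.2 == m then t.1 * mx_monomial E t.2 else 0).
  rewrite -big_mkcond /= mulr_suml; apply: eq_bigr => t /eqP ->; done.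
rewrite (eq_bigr _ (fun m _ => E1 m)) exchange_big /= /terms_eval big_filter [RHS]big_mkcond.
apply: eq_bigr => t _; case: ifP => tJ.
  rewrite (bigD1_seq t.2) ?fset_uniq //= eqxx big1 ?addr0 // => m /negPf.
  by rewrite eq_sym => ->.
by rewrite big_seq big1 // => m mJ; case: eqP => // e; rewrite e mJ in tJ.
Qed.

Section Picard.
Variables (I : finType) (l : I -> seq term) (b : I -> I -> I -> C).

(** Iterates of the map sending y to l + b (y, y), from y = 0. *)
Fixpoint picard (K : nat) (k : I) : seq term :=
  if K is K'.+1 then
    l k ++ \big[cat/[::]]_(ij : I * I)
      terms_scale (b k ij.1 ij.2) (terms_mul (picard K' ij.1) (picard K' ij.2))
  else [::].

Lemma picardS K k : picard K.+1 k = l k ++ \big[cat/[::]]_(ij : I * I)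
  terms_scale (b k ij.1 ij.2) (terms_mul (picard K ij.1) (picard K ij.2)).
Proof. by []. Qed.

Lemma picard_min_deg K k : (forall k, terms_min_deg 1 (l k)) -> terms_min_deg 1 (picard K k).
Proof.
move=> l1; elim: K k => // K IH k; rewrite picardS terms_min_deg_cat l1 /=;
  apply: terms_min_deg_big => ij.
by rewrite terms_min_deg_scale; apply: (terms_min_deg_le _ (terms_min_deg_mul (IH _) (IH _))).
Qed.

(** One more iteration does not change the terms of degree at most K, since in a
product they come from terms of degree below K. *)
Lemma picard_stable K k i : (forall k, terms_min_deg 1 (l k)) -> (k <= K)%N ->
  terms_trunc k (picard K.+1 i) = terms_trunc k (picard K i).
Proof.
move=> l1; elim: K k i => [|K IH] k i le_k.
  by rewrite !terms_trunc_eq0 ?picard_min_deg // (_ : k = 0%N) ?picard_min_deg //; lia.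
rewrite (picardS K.+1) (picardS K) !terms_trunc_cat !terms_trunc_big; congr (_ ++ _).
apply: eq_bigr => ij _; rewrite !terms_trunc_scale; congr terms_scale.
rewrite [LHS]terms_trunc_mul ?picard_min_deg // [RHS]terms_trunc_mul ?picard_min_deg //.
by rewrite !IH //; lia.
Qed.

Lemma picard_trunc K K' i : (forall k, terms_min_deg 1 (l k)) -> (K <= K')%N ->
  terms_trunc K (picard K' i) = terms_trunc K (picard K i).
Proof.
move=> l1 /subnK <-; elim: (K' - K)%N => // d IH.
by rewrite addSn picard_stable // leq_addl.
Qed.

Lemma terms_eval_picardS K k E : terms_eval (picard K.+1 k) E = terms_eval (l k) E +
  \sum_(ij : I * I) b k ij.1 ij.2 * (terms_eval (picard K ij.1) E * terms_eval (picard K ij.2) E).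
Proof.
rewrite picardS terms_eval_cat terms_eval_big; congr (_ + _); apply: eq_bigr => ij _.
by rewrite terms_eval_scale terms_eval_mul.
Qed.

(** The ball of radius rho is stable under the iteration. *)
Lemma terms_norm_picard (r rho : C) : 0 <= r -> 0 <= rho ->
  (forall k, terms_norm r (l k) + \sum_(ij : I * I) `|b k ij.1 ij.2| * (rho * rho) <= rho) ->
  forall K k, terms_norm r (picard K k) <= rho.
Proof.
move=> r0 rho0 h; elim=> [|K IH] k; first by rewrite /terms_norm big_nil.
rewrite picardS terms_norm_cat terms_norm_big; apply: le_trans (h k); rewrite lerD2l.
by apply: ler_sum => ij _; rewrite terms_norm_scale terms_norm_mul ler_wpM2l //
  ler_pM ?terms_norm_ge0.
Qed.

End Picard.

End Terms.

(** * Analytic solution of quadratic fixed-point equations *)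

Section QuadFixpoint.
Variables (C : numClosedFieldType) (n : nat).
Local Notation M := 'M[C]_n.
Local Notation term := (C * 'M[nat]_n)%type.
Local Notation dyadic := (dyadic C).

(** The coefficient of an exponent of degree d in the solution is the one of the d-th
Picard iterate, and of all later ones by picard_trunc.  All iterates have weighted
norm at most rho, so for arguments of half the radius the terms of degree above K
contribute at most a multiple of 2^-K.  Therefore the iterates converge
geometrically, the series has the same limit, and the equation satisfied by
consecutive iterates passes to the limit. *)
Lemma quadratic_fixpoint (I : finType) (l : I -> seq term) (b : I -> I -> I -> C) :
  geometrically_complete C -> (forall k, terms_min_deg 1 (l k)) ->
  exists y : M -> I -> C,
    [/\ forall k, holomorphic_at0 (fun E => y E k),
        exists r : C, 0 < r /\ forall (x : C) (E : M), 0 <= x -> x <= 1 ->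
          (forall i j, `|E i j| <= x * r) -> forall k, `|y E k| <= x
      & \forall E \near (0 : M), forall k, y E k = terms_eval (l k) E +
          \sum_(ij : I * I) b k ij.1 ij.2 * (y E ij.1 * y E ij.2)].
Proof.
move=> Cc l1.
(* With b bounded by B, the radius rho = 1 / (2 B) satisfies B rho^2 = rho / 2, and
   r is chosen so that the linear part has norm at most rho / 2. *)
pose B : C := 1 + \sum_k \sum_(ij : I * I) `|b k ij.1 ij.2|.
pose L : C := 1 + \sum_k terms_norm 1 (l k).
have B1 : 1 <= B by rewrite lerDl sumr_ge0 // => k _; rewrite sumr_ge0.
have L1 : 1 <= L by rewrite lerDl sumr_ge0 // => k _; rewrite terms_norm_ge0.
have B0 : 0 < B := lt_le_trans ltr01 B1.
have L0 : 0 < L := lt_le_trans ltr01 L1.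
pose rho : C := (2 * B)^-1; pose r : C := rho / (2 * L).
have rho0 : 0 < rho by rewrite invr_gt0 mulr_gt0.
have r0 : 0 < r by rewrite divr_gt0 // mulr_gt0.
have rho1 : rho <= 1.
  rewrite invf_le1 ?mulr_gt0 // -[leLHS]mulr1; apply: ler_pM => //; exact: ler1n.
have r1 : r <= 1.
  rewrite ler_pdivrMr ?mulr_gt0 // mul1r; apply: le_trans rho1 _.
  rewrite -[leLHS]mulr1; apply: ler_pM => //; exact: ler1n.
have Bk k : \sum_(ij : I * I) `|b k ij.1 ij.2| <= B.
  rewrite /B (bigD1 k) //= addrA (addrC 1) -addrA lerDl addr_ge0 //.
  by rewrite sumr_ge0 // => k' _; rewrite sumr_ge0.
have lk k : terms_norm r (l k) <= r * L.
  apply: (@le_trans _ _ (r * terms_norm 1 (l k))).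
    rewrite /terms_norm mulr_sumr big_seq [leRHS]big_seq; apply: ler_sum => t tl.
    rewrite expr1n mulr1 mulrC ler_wpM2r //.
    by rewrite -[leRHS]expr1; apply: ler_wiXn2l => //; [exact: ltW|exact: (allP (l1 k))].
  rewrite ler_wpM2l ?(ltW r0) // /L (bigD1 k) //= addrA (addrC 1) -addrA lerDl addr_ge0 //.
  by rewrite sumr_ge0 // => k' _; rewrite terms_norm_ge0.
have hrho k : terms_norm r (l k) + \sum_(ij : I * I) `|b k ij.1 ij.2| * (rho * rho) <= rho.
  have rhoE : rho = r * L + B * (rho * rho).
    by rewrite /r /rho; field; rewrite !gt_eqF.
  rewrite [leRHS]rhoE.
  rewrite -mulr_suml; apply: lerD; first exact: lk.
  by rewrite ler_wpM2r // mulr_ge0 // ltW.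
pose P := picard l b.
have P1 K k : terms_min_deg 1 (P K k) := picard_min_deg b K k l1.
have Pr K k : terms_norm r (P K k) <= rho.
  by apply: terms_norm_picard => //; exact: ltW.
have Pbound (x : C) (E : M) K k : 0 <= x -> x <= 1 -> (forall i j, `|E i j| <= x * r) ->
    `|terms_eval (P K k) E| <= x * rho.
  move=> x0 x1 Er; have := norm_eval_le (P1 K k) x0 x1 (ltW r0) Er.
  by rewrite expr1 => h; apply: le_trans h _; rewrite ler_wpM2l.
pose small (E : M) := forall i j, `|E i j| <= dyadic 1 * r.
have tail (s : seq term) K (E : M) : terms_min_deg K s -> terms_norm r s <= rho -> small E ->
  `|terms_eval s E| <= rho * dyadic K.
  move=> hs hr Er; have h1 : (2^-1 : C) <= 1 by rewrite invf_le1 ?ler1n.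
  have := norm_eval_le hs (ltW (dyadic_gt0 _ 1)) h1 (ltW r0) Er.
  move=> h; apply: le_trans h _; rewrite /dyadic expr1 mulrC ler_wpM2r // exprn_ge0 //.
  by rewrite invr_ge0.
(* Whatever terms of degree above K are kept in a later iterate, they contribute
   little. *)
have Ptail K K' k (a : pred term) (E : M) : (K <= K')%N -> small E ->
    {in terms_trunc K (P K k), forall t, a t} ->
    `|terms_eval [seq t <- P K' k | a t] E - terms_eval (terms_trunc K (P K k)) E| <=
      rho * dyadic K.
  move=> le_K sE aK; pose hi := [seq t <- [seq t <- P K' k | a t] | ~~ (mx_deg t.2 <= K)%N].
  have -> : terms_eval [seq t <- P K' k | a t] E =
    terms_eval (terms_trunc K (P K k)) E + terms_eval hi E.
    have -> : terms_trunc K (P K k) = [seq t <- [seq t <- P K' k | a t] | (mx_deg t.2 <= K)%N].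
      rewrite -(picard_trunc b k l1 le_K) -filter_predI.
      apply: eq_in_filter => t tP /=; case: leqP => //= h.
      apply/esym/aK; rewrite -(picard_trunc b k l1 le_K) mem_filter h; exact: tP.
    exact: terms_eval_filterID.
  rewrite addrC addKr; apply: tail => //.
    by apply/allP => t; rewrite mem_filter -ltnNge => /andP[/ltnW].
  by apply: le_trans (Pr K' k); rewrite /hi;
    do 2![apply: le_trans (terms_norm_filter _ _ (ltW r0)) _].
have Ptrunc K K' k E : (K <= K')%N -> small E ->
    `|terms_eval (P K' k) E - terms_eval (terms_trunc K (P K k)) E| <= rho * dyadic K.
  by move=> le_K sE; rewrite -[P K' k]filter_predT; apply: Ptail.
have step E k K : small E -> `|terms_eval (P K.+1 k) E - terms_eval (P K k) E| <=
  2 * rho * dyadic K.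
  move=> sE; have h1 := Ptrunc K K.+1 k E (leqnSn _) sE; have h2 := Ptrunc K K k E (leqnn _) sE.
  apply: le_trans (ler_distD (terms_eval (terms_trunc K (P K k)) E) _ _) _.
  by rewrite -mulrA mulr2n mulrDl !mul1r lerD // distrC.
have /choice[y hy] : forall Ek : (M * I)%type, exists v : C, small Ek.1 ->
    forall K, `|terms_eval (P K Ek.2) Ek.1 - v| <= 4 * (2 * rho) * dyadic K.
  move=> -[E k] /=; have [sE|nsE] := pselect (small E); last by exists 0.
  by have [v hv] := Cc.2 _ _ (fun K => step E k K sE); exists v.
pose m1 : C := 4 * (2 * rho).
have m10 : 0 <= m1 by rewrite !mulr_ge0 // ltW.
have hyE E k K : small E -> `|terms_eval (P K k) E - y (E, k)| <= m1 * dyadic K.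
  by move=> sE; apply: (hy (E, k)).
have e0 : 0 < dyadic 1 * r by rewrite mulr_gt0 ?dyadic_gt0.
have lt_small E : mx_lt E (dyadic 1 * r) -> small E by move=> h i j; apply/ltW/h.
have half1 : dyadic 1 <= 1 by have := @dyadic_le C 0 1 isT; rewrite [dyadic 0]expr0.
have ybound (x : C) (E : M) k : 0 <= x -> x <= 1 ->
    (forall i j, `|E i j| <= x * (dyadic 1 * r)) -> `|y (E, k)| <= x.
  move=> x0 x1 Er; have sE : small E.
    by move=> i j; apply: le_trans (Er i j) _; rewrite ler_piMl // ltW.
  have Er' i j : `|E i j| <= x * r.
    by apply: le_trans (Er i j) _; rewrite ler_wpM2l // ler_piMl // ltW.
  apply: (@le_dyadic_le _ _ _ m1 Cc) => //; first exact: normr_real.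
    by rewrite ger0_real.
  move=> K; have := Pbound x E K k x0 x1 Er'; have := hyE E k K sE.
  rewrite distrC => h1 h2.
  apply: le_trans (_ : _ <= `|terms_eval (P K k) E| + `|y (E, k) - terms_eval (P K k) E|) _.
    by rewrite -[X in `|X| <= _](subrK (terms_eval (P K k) E)) addrC ler_normD.
  apply: lerD => //; apply: le_trans h2 _; exact: ler_piMr.
exists (fun E k => y (E, k)); split.
- move=> k; exists (fun m => terms_coef (P (mx_deg m) k) m); apply/near0P.
  exists (dyadic 1 * r) => // E /lt_small sE; apply/totallyP => e e_gt0.
  have [K hK] := Cc.1 (m1 + 2 * rho) e e_gt0.
  exists [fset m in [seq t.2 | t <- P K k]]%fset => J /fsubsetP sub.
  pose K' := maxn K (\max_(m <- J) mx_deg m).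
  have -> : \sum_(m <- J) terms_coef (P (mx_deg m) k) m * mx_monomial E m =
      \sum_(m <- J) terms_coef (P K' k) m * mx_monomial E m.
    rewrite big_seq [RHS]big_seq; apply: eq_bigr => m mJ; congr (_ * _).
    rewrite -(terms_coef_trunc _ (leqnn (mx_deg m))) -(terms_coef_trunc (P K' k) (leqnn (mx_deg
      m))).
    have le_m : (mx_deg m <= K')%N.
      by rewrite leq_max; apply/orP; right; rewrite (big_rem m) //= leq_maxl.
    by rewrite /P (picard_trunc b k l1 le_m).
  rewrite sum_coef; apply: le_lt_trans hK.
  have h1 := Ptail K K' k (fun t => t.2 \in J) E (leq_maxl _ _) sE.
  have h2 := Ptrunc K K k E (leqnn K) sE; have h3 := hyE E k K sE.
  rewrite [ `|m1 + _| ]ger0_norm ?addr_ge0 ?mulr_ge0 ?(ltW rho0) // mulrDl.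
  apply: le_trans (ler_distD (terms_eval (P K k) E) _ _) _; apply: lerD; first by rewrite distrC.
  apply: le_trans (ler_distD (terms_eval (terms_trunc K (P K k)) E) _ _) _.
  rewrite -mulrA mulr2n mulrDl !mul1r; apply: lerD => //; rewrite distrC; apply: h1 => t.
  rewrite mem_filter => /andP[_ tP]; apply: sub; rewrite !inE /=.
  exact: map_f.
- by exists (dyadic 1 * r); split=> // x E x0 x1 Er k; apply: ybound.
apply/near0P; exists (dyadic 1 * r) => // E ltE k; have sE := lt_small _ ltE.
apply/eqP; rewrite -subr_eq0; apply/eqP.
pose m2 : C := m1 + \sum_(ij : I * I) `|b k ij.1 ij.2| * (2 * m1).
have y1 i : `|y (E, i)| <= 1 by apply: ybound => // i' j'; rewrite mul1r.
have P1' K i : `|terms_eval (P K i) E| <= 1.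
  apply: le_trans (Pbound 1 E K i ler01 (lexx _) _) _; last by rewrite mul1r.
  by move=> i' j'; rewrite mul1r; apply: le_trans (sE i' j') _; rewrite ler_piMl // ltW.
apply: (@small_eq0 _ _ m2 Cc).
  by rewrite addr_ge0 // sumr_ge0 // => ij _; rewrite mulr_ge0 // mulr_ge0.
move=> K.
have -> : y (E, k) - (terms_eval (l k) E + \sum_(ij :
  I * I) b k ij.1 ij.2 * (y (E, ij.1) * y (E, ij.2)))
  = (y (E, k) - terms_eval (P K.+1 k) E) + \sum_(ij : I * I) b k ij.1 ij.2 *
     (terms_eval (P K ij.1) E * terms_eval (P K ij.2) E - y (E, ij.1) * y (E, ij.2)).
  rewrite terms_eval_picardS (eq_bigr _ (fun ij _ => mulrBr (b k ij.1 ij.2) _ _)) sumrB.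
  by ring.
apply: le_trans (ler_normD _ _) _; rewrite /m2 mulrDl; apply: lerD.
  rewrite distrC; apply: le_trans (hyE _ _ _ sE) _; rewrite ler_wpM2l //.
  exact: dyadic_le.
rewrite mulr_suml; apply: le_trans (ler_norm_sum _ _ _) _; apply: ler_sum => ij _.
rewrite normrM -mulrA ler_wpM2l //.
set p1 := terms_eval _ E; set p2 := terms_eval _ E; set y1' := y _; set y2' := y _.
have -> : p1 * p2 - y1' * y2' = p1 * (p2 - y2') + (p1 - y1') * y2' by ring.
apply: le_trans (ler_normD _ _) _; rewrite !normrM -mulrA mulr2n mulrDl !mul1r; apply: lerD.
  by rewrite -[leRHS]mul1r; apply: ler_pM; rewrite ?P1' //; apply: hyE.
by rewrite -[leRHS]mulr1; apply: ler_pM; rewrite ?y1 //; apply: hyE.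
Qed.

End QuadFixpoint.

Section LinearExpansion.
Variable C : numClosedFieldType.

Lemma linear_expand p q (V : lmodType C) (f : 'M[C]_(p, q) -> V) (U : 'M[C]_(p, q)) :
  (forall a u v, f (a *: u + v) = a *: f u + f v) ->
  f U = \sum_(k : 'I_p * 'I_q) U k.1 k.2 *: f (delta_mx k.1 k.2).
Proof.
move=> hf; have f0 : f 0 = 0.
  by have := hf (-1) 0 0; rewrite scaleN1r oppr0 addr0 scaleN1r addNr.
rewrite {1}[U]matrix_sum_delta pair_bigA /=.
elim/big_rec2: _ => // k u v _ <-; exact: hf.
Qed.

End LinearExpansion.

Section QuadMx.
Variables (C : numClosedFieldType) (n : nat).
Local Notation M := 'M[C]_n.

(** A bilinear map is a quadratic form in the entries, with coefficients its values
on the elementary matrices. *)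
Lemma quadratic_fixpoint_mx p q (L : M -> 'M[C]_(p, q))
    (be : 'M[C]_(p, q) -> 'M[C]_(p, q) -> 'M[C]_(p, q)) :
  geometrically_complete C ->
  (forall a u v, L (a *: u + v) = a *: L u + L v) ->
  (forall w a u v, be w (a *: u + v) = a *: be w u + be w v) ->
  (forall w a u v, be (a *: u + v) w = a *: be u w + be v w) ->
  exists y : M -> 'M[C]_(p, q),
    [/\ forall i j, holomorphic_at0 (fun E => y E i j),
        exists r : C, 0 < r /\ forall (x : C) (E : M), 0 <= x -> x <= 1 ->
          (forall i j, `|E i j| <= x * r) -> forall i j, `|y E i j| <= x
      & \forall E \near (0 : M), y E = L E + be (y E) (y E)].
Proof.
move=> Cc hL hbr hbl; pose I := ('I_p * 'I_q)%type.
pose l (k : I) := [seq (L (delta_mx ab.1 ab.2) k.1 k.2, delta_mx ab.1 ab.2 : 'M[nat]_n)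
  | ab <- enum [set: 'I_n * 'I_n]].
pose b (k i j : I) := be (delta_mx i.1 i.2) (delta_mx j.1 j.2) k.1 k.2.
have mono (E : M) a c : mx_monomial E (delta_mx a c) = E a c.
  rewrite /mx_monomial (bigD1 a) //= [X in _ * X]big1 ?mulr1 => [|i /negPf ia]; last first.
    by rewrite big1 // => j _; rewrite mxE ia expr0.
  rewrite (bigD1 c) //= big1 ?mulr1 => [|j /negPf jc]; first by rewrite mxE !eqxx expr1.
  by rewrite mxE jc andbF expr0.
have l1 k : terms_min_deg 1 (l k).
  apply/allP => t /mapP[[a c] _ ->] /=; rewrite /mx_deg (bigD1 a) //= (bigD1 c) //= mxE !eqxx.
  by rewrite /= -addnA.
have evl k E : terms_eval (l k) E = L E k.1 k.2.
  rewrite (linear_expand E hL) summxE /terms_eval big_map big_enum /=.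
  rewrite (eq_bigl predT) => [|ab]; last by rewrite inE.
  by apply: eq_bigr => ab _; rewrite mxE mono mulrC.
have [y [hol [r [r0 hr]] eqn]] := quadratic_fixpoint b Cc l1.
exists (fun E => \matrix_(i, j) y E (i, j)); split.
- move=> i j; rewrite (_ : (fun E => _) = fun E => y E (i, j)); first exact: hol.
  by apply/funext => E; rewrite mxE.
- by exists r; split=> // x E x0 x1 Er i j; rewrite mxE; apply: hr.
case/near0P: eqn => e e0 he; apply/near0P; exists e => // E /he h.
apply/matrixP => i j; rewrite !mxE h evl; congr (_ + _).
set U := (\matrix_(i, j) _).
rewrite (linear_expand U (hbr U)) summxE.
rewrite (eq_bigr (fun k2 : I => \sum_(k1 : I) U k1.1 k1.2 * U k2.1 k2.2 * b (i, j) k1 k2));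
  last first.
  move=> k2 _; have E2 : be U (delta_mx k2.1 k2.2) = \sum_(k1 : I) U k1.1 k1.2 *:
      be (delta_mx k1.1 k1.2) (delta_mx k2.1 k2.2) by exact: (linear_expand U (hbl _)).
  rewrite [LHS]mxE E2 summxE mulr_sumr; apply: eq_bigr => k1 _.
  by rewrite [X in _ * X = _]mxE mulrA [U k2.1 _ * _]mulrC.
rewrite exchange_big pair_bigA /=; apply: eq_bigr => -[[a1 a2] [b1 b2]] _ /=.
by rewrite !mxE mulrC.
Qed.

End QuadMx.

(** * The tangent space of a congruence class *)

Section TangentSpace.
Variables (C : numClosedFieldType) (n : nat).
Local Notation M := 'M[C]_n.

(** The map sending Z to A Z^T + A^T Z is the adjoint of the one sending X to
X^T A + A X; this identifies dual_sys as the orthogonal of the tangent space. *)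
Lemma tangent_adjoint (A X Z : M) :
  \tr ((X^T *m A + A *m X)^T *m Z) = \tr (X^T *m (A *m Z^T + A^T *m Z)).
Proof.
rewrite linearD /= !trmx_mul trmxK mulmxDl mulmxDr !mxtraceD; congr (_ + _).
  by rewrite -mxtrace_tr !trmx_mul trmxK mxtrace_mulC mulmxA.
by rewrite mulmxA.
Qed.

Lemma trace_form_eq0 (Z : M) : (forall X : M, \tr (X^T *m Z) = 0) -> Z = 0.
Proof.
move=> h; apply/matrixP => i j; rewrite mxE -[RHS](h (delta_mx i j)) trmx_delta.
rewrite /mxtrace (bigD1 j) //= big1 => [|k /negPf kj]; last first.
  by rewrite mxE big1 // => l _; rewrite mxE kj mul0r.
rewrite addr0 mxE (bigD1 i) //= big1 => [|l /negPf li]; first by rewrite mxE !eqxx mul1r addr0.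
by rewrite mxE li andbF mul0r.
Qed.

Lemma trace_form_sum (U Z : M) : \tr (U^T *m Z) = \sum_i \sum_j U i j * Z i j.
Proof.
rewrite exchange_big; apply: eq_bigr => j _.
by rewrite mxE; apply: eq_bigr => i _; rewrite mxE.
Qed.

Lemma mxvec_trace (U Z : M) : (mxvec U *m (mxvec Z)^T) 0 0 = \tr (U^T *m Z).
Proof.
rewrite trace_form_sum mxE (reindex _ (curry_mxvec_bij _ _)) /= pair_bigA /=.
by apply: eq_bigr => -[i j] _; rewrite [(mxvec Z)^T _ _]mxE !mxvecE.
Qed.

(** By duality the tangent space and the matrices supported on P span all matrices.
Completing X by a tangent vector so as to fit P is then a solvable linear system,
and a pseudo-inverse solves it linearly in X. *)
Lemma tangent_complement (A : M) (P : 'M[bool]_n) :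
  (forall Z, dual_sys A Z -> agree_on P Z 0 -> Z = 0) ->
  exists2 g : M -> M, (forall a u v, g (a *: u + v) = a *: g u + g v) &
    forall X, fits_pattern P (X + ((g X)^T *m A + A *m g X)).
Proof.
move=> uniqP.
pose T := lin_mx (mulmxr A \o trmx \+ mulmx A : M -> M).
pose D := diag_mx (mxvec (\matrix_(i, j) (P i j)%:R : M)).
have TE X : mxvec X *m T = mxvec (X^T *m A + A *m X) by rewrite mul_vec_lin.
have full : row_full (col_mx T D).
  rewrite /row_full -mxrank_tr; apply/(@inj_row_free _ _ _ (col_mx T D)^T) => v.
  move=> /(congr1 trmx); rewrite trmx_mul trmxK trmx0 mul_col_mx -[X in _ = X]vsubmxK.
  move=> /eq_col_mx; rewrite !linear0 => -[vT vD].
  rewrite -[v]vec_mxK; apply/eqP; rewrite mxvec_eq0; apply/eqP; apply: uniqP.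
    apply: trace_form_eq0 => X; rewrite -tangent_adjoint.
    by rewrite -mxvec_trace vec_mxK -TE -mulmxA vT mulmx0 mxE.
  move=> i j Pij; rewrite !mxE; have /matrixP/(_ (mxvec_index i j) 0) := vD.
  by rewrite mul_diag_mx !mxE mxvecE mxE Pij mul1r.
pose G := pinvmx (col_mx T D).
exists (fun X => - vec_mx (lsubmx (mxvec X *m G))).
  by move=> a u v; rewrite !linearP /= mulmxDl -scalemxAl !linearP.
move=> X i j nP.
have : mxvec X *m G *m col_mx T D = mxvec X by rewrite mulmxKpV // submx_full.
rewrite -{1}[mxvec X *m G]hsubmxK mul_row_col => XE.
set g := - _; have gE : g^T *m A + A *m g = - vec_mx (lsubmx (mxvec X *m G) *m T).
  rewrite /g -[lsubmx _ in RHS]vec_mxK TE mxvecK.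
  by rewrite linearN /= mulNmx mulmxN -opprD.
have XE2 : X = vec_mx (lsubmx (mxvec X *m G) *m T) + vec_mx (rsubmx (mxvec X *m G) *m D).
  by rewrite -linearD /= XE mxvecK.
rewrite gE {1}XE2 addrAC subrr add0r mxE mul_mx_diag mxE mxvecE [X in _ * X]mxE.
by rewrite (negPf nP) mulr0.
Qed.

End TangentSpace.

(** * Existence of the reduction *)

Section Existence.
Variables (C : numClosedFieldType) (n : nat).
Local Notation M := 'M[C]_n.

(** The l^1 norm of a row vector v with v = - v D would be strictly smaller than
itself. *)
Lemma unitmx_perturb (D : M) (d : C) : (forall i j, `|D i j| <= d) -> n%:R * d < 1 ->
  1%:M + D \in unitmx.
Proof.
move=> Dd nd1; rewrite -row_free_unit; apply: inj_row_free => v.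
rewrite mulmxDr mulmx1 => /eqP; rewrite addr_eq0 => /eqP vE.
have S0 : 0 <= \sum_j `|v 0 j| by apply: sumr_ge0.
have le : \sum_j `|v 0 j| <= n%:R * d * \sum_j `|v 0 j|.
  have -> : n%:R * d * \sum_j `|v 0 j| = \sum_(j < n) \sum_i `|v 0 i| * d.
    by rewrite sumr_const card_ord -mulr_suml -mulr_natl; ring.
  apply: ler_sum => j _; rewrite {1}vE !mxE normrN; apply: le_trans (ler_norm_sum _ _ _) _.
  by apply: ler_sum => i _; rewrite normrM ler_wpM2l.
have /eqP : \sum_j `|v 0 j| = 0.
  apply/eqP; rewrite eq_le S0 andbT; move: le.
  rewrite -subr_le0 -{1}[\sum_j _]mul1r -mulrBl pmulr_rle0 // subr_gt0.
  exact: nd1.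
rewrite psumr_eq0 // => /allP h; apply/matrixP => i j; rewrite mxE (ord1 i).
by have := h j (mem_index_enum _); rewrite normr_eq0 => /eqP.
Qed.

Lemma addr4ACA (V : zmodType) (p1 p2 p3 p4 q1 q2 q3 q4 : V) :
  (p1 + q1) + (p2 + q2) + (p3 + q3) + (p4 + q4) = (p1 + p2 + p3 + p4) + (q1 + q2 + q3 + q4).
Proof. by rewrite (addrACA p1) (addrACA (p1 + p2)) (addrACA (p1 + p2 + p3)). Qed.

(** The unknowns of the fixed-point equation are W = E', V = E' C and Y, placed side
by side in one matrix U, where C = g(Y); the product C^T E' C of degree three is
then C^T V. *)
Theorem exists_holomorphic_reduction (A Acan S : M) (P : 'M[bool]_n) : geometrically_complete C ->
  S \in unitmx -> S^T *m A *m S = Acan ->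
  (forall Z, dual_sys Acan Z -> agree_on P Z 0 -> Z = 0) ->
  exists F, reduces_to A Acan S P F.
Proof.
move=> Cc Su SA /tangent_complement[g glin gP].
pose X := 'M[C]_(n, n + (n + n)).
pose W (U : X) : M := lsubmx U; pose V (U : X) : M := lsubmx (rsubmx U).
pose Y (U : X) : M := rsubmx (rsubmx U).
pose L (E : M) : X := row_mx (S^T *m E *m S) (row_mx 0 (S^T *m E *m S)).
pose be (U U' : X) : X := row_mx 0 (row_mx (W U *m g (Y U'))
  ((g (Y U))^T *m W U' + W U *m g (Y U') + (g (Y U))^T *m Acan *m g (Y U') + (g (Y U))^T *m V
    U')).
have WL a u v : W (a *: u + v) = a *: W u + W v by rewrite /W linearP.
have VL a u v : V (a *: u + v) = a *: V u + V v by rewrite /V !linearP.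
have YL a u v : Y (a *: u + v) = a *: Y u + Y v by rewrite /Y !linearP.
have [|||y [hol [r [r0 hr]] eqn]] := @quadratic_fixpoint_mx C n n (n + (n + n)) L be Cc.
- move=> a u v; rewrite /L mulmxDr mulmxDl -scalemxAr -scalemxAl.
  by rewrite !scale_row_mx !add_row_mx scaler0 addr0.
- move=> w a u v; rewrite /be !scale_row_mx !add_row_mx scaler0 addr0 !(WL, VL, YL, glin).
  by rewrite !mulmxDr -!scalemxAr !scalerDr addr4ACA.
- move=> w a u v; rewrite /be !scale_row_mx !add_row_mx scaler0 addr0 !(WL, VL, YL, glin).
  by rewrite !(linearD, linearZ) /= !mulmxDl -!scalemxAl addr4ACA.
pose F (E : M) := S *m (1%:M + g (Y (y E))).
have g0 : g 0 = 0 by have := glin (-1) 0 0; rewrite scaleN1r oppr0 addr0 scaleN1r addNr.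
have hF i j : holomorphic_at0 (fun E => F E i j).
  pose f U := S *m g (Y U).
  have flin a u v : f (a *: u + v) = a *: f u + f v.
    by rewrite /f YL glin mulmxDr -scalemxAr.
  have -> : (fun E => F E i j) = fun E => 1 * S i j +
      \sum_(k : 'I_n * 'I_(n + (n + n))) f (delta_mx k.1 k.2) i j * y E k.1 k.2.
    apply/funext => E; rewrite /F mulmxDr mulmx1 mxE mul1r; congr (_ + _).
    rewrite -/(f (y E)) (linear_expand (y E) flin) summxE; apply: eq_bigr => k _.
    by rewrite mxE mulrC.
  apply: holomorphic_linear; first exact: holomorphic_cst.
  by apply: holomorphic_sum => k; apply: hol.
have y00 : y 0 = 0.
  apply/matrixP => i j; rewrite mxE; apply/eqP; rewrite -normr_le0.
  by apply: hr => // i' j'; rewrite mxE normr0 mul0r.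
have F0 : F 0 = S by rewrite /F y00 /Y !linear0 g0 addr0 mulmx1.
have defE : \forall E \near (0 : M), deformation A Acan F E =
    Y (y E) + ((g (Y (y E)))^T *m Acan + Acan *m g (Y (y E))).
  case/near0P: eqn => e e0 he; apply/near0P; exists e => // E /he h.
  have WE : W (y E) = S^T *m E *m S by rewrite h /L /be /W add_row_mx row_mxKl addr0.
  have VE : V (y E) = W (y E) *m g (Y (y E)).
    by rewrite {1}h /L /be {1}/V add_row_mx row_mxKr add_row_mx row_mxKl add0r.
  have YE : Y (y E) = W (y E) + ((g (Y (y E)))^T *m W (y E) + W (y E) *m g (Y (y E)) +
      (g (Y (y E)))^T *m Acan *m g (Y (y E)) + (g (Y (y E)))^T *m V (y E)).
    by rewrite [in LHS]h /L /be {1}/Y add_row_mx row_mxKr add_row_mx row_mxKr WE.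
  set c := g _ in VE YE *; rewrite YE VE /deformation /F -/c WE -SA.
  have -> : (S *m (1%:M + c))^T *m (A + E) *m (S *m (1%:M + c)) =
    (1%:M + c^T) *m (S^T *m A *m S + S^T *m E *m S) *m (1%:M + c).
    have -> : (S *m (1%:M + c))^T = (1%:M + c^T) *m S^T.
      by rewrite trmx_mul [(1%:M + c)^T]linearD /= trmx1.
    by rewrite -[X in _ = _ *m X *m _]mulmxDl -mulmxDr !mulmxA.
  set B := S^T *m A *m S; set E' := S^T *m E *m S.
  rewrite !(mulmxDl, mulmxDr, mul1mx, mulmx1) !mulmxA.
  move: (c^T *m B) (c^T *m E') (B *m c) (E' *m c) (c^T *m B *m c) (c^T *m E' *m c).
  by move=> x1 x2 x3 x4 x5 x6; apply/matrixP => i j; rewrite !mxE; ring.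
exists F; split.
(* A bound for the linear map sending y to g (Y y), so that 1 + g (Y y) is
   invertible as soon as y is small enough. *)
- split=> //; pose gb := 1 + \sum_(k : 'I_n * 'I_(n + (n + n))) \sum_i \sum_j
      `|g (Y (delta_mx k.1 k.2)) i j|.
  have gb1 : 1 <= gb.
    by rewrite lerDl; apply: sumr_ge0 => k _; apply: sumr_ge0 => i _; apply: sumr_ge0.
  have gb0 : 0 < gb := lt_le_trans ltr01 gb1.
  have gy (x : C) E : 0 <= x -> (forall i j, `|y E i j| <= x) ->
      forall i j, `|g (Y (y E)) i j| <= x * gb.
    move=> x0 yx i j; have gYL a u v : g (Y (a *: u + v)) = a *: g (Y u) + g (Y v).
      by rewrite YL glin.
    have -> : g (Y (y E)) = \sum_(k : 'I_n * 'I_(n + (n + n))) y E k.1 k.2 *: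
        g (Y (delta_mx k.1 k.2)) by exact: (linear_expand (y E) gYL).
    rewrite summxE; apply: le_trans (ler_norm_sum _ _ _) _.
    rewrite mulrDr mulr1 mulr_sumr -[leLHS]add0r; apply: lerD => //.
    apply: ler_sum => k _; rewrite mxE normrM; apply: ler_pM => //.
    rewrite (bigD1 i) //= (bigD1 j) //= -addrA lerDl addr_ge0 ?sumr_ge0 // => i' _.
    exact: sumr_ge0.
  pose x : C := (n.+1%:R * gb)^-1.
  have x0 : 0 < x by rewrite invr_gt0 mulr_gt0 // ltr0Sn.
  have x1 : x <= 1.
    rewrite invf_le1 ?mulr_gt0 ?ltr0Sn // -[leLHS]mulr1; apply: ler_pM => //.
    by rewrite ler1n.
  apply/near0P; exists (x * r); first exact: mulr_gt0.
  move=> E Ex; rewrite /F unitmx_mul Su /=; apply: (@unitmx_perturb _ (x * gb)).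
    apply: gy; first exact: ltW.
    by apply: hr => [||i j]; rewrite ?(ltW x0) // ltW.
  have -> : x * gb = n.+1%:R^-1 by rewrite /x invfM -mulrA mulVf ?mulr1 // gt_eqF.
  by rewrite ltr_pdivrMr ?ltr0Sn // mul1r ltr_nat.
- case/near0P: defE => e e0 he; apply/near0P; exists e => // E /he ->.
  exact: gP.
move=> i j; pose f U := Y U + ((g (Y U))^T *m Acan + Acan *m g (Y U)).
have flin a u v : f (a *: u + v) = a *: f u + f v.
  rewrite /f YL glin [(a *: _ + _)^T]linearP mulmxDl mulmxDr -scalemxAl -scalemxAr.
  move: (_ *m Acan) (_ *m Acan) (Acan *m _) (Acan *m _) => x1 x2 x3 x4.
  by apply/matrixP => i' j'; rewrite !mxE; ring.
have hf : holomorphic_at0 (fun E => 1 * 0 +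
      \sum_(k : 'I_n * 'I_(n + (n + n))) f (delta_mx k.1 k.2) i j * y E k.1 k.2).
  apply: holomorphic_linear; first exact: holomorphic_cst.
  by apply: holomorphic_sum => k; apply: hol.
apply: holomorphic_near hf; case/near0P: defE => e e0 he; apply/near0P; exists e => // E /he ->.
rewrite -/(f (y E)) (linear_expand (y E) flin) summxE mulr0 add0r; apply: eq_bigr => k _.
by rewrite [RHS]mxE mulrC.
Qed.

End Existence.

(** * First-order expansions *)

Section Jets.
Variable C : numClosedFieldType.

(** First-order expansion for small s > 0 with a remainder in O(s^2).  Only real
positive s are considered: this is enough to differentiate, and the remainder is
a function e so that products expand by ring identities. *)
Definition has_jet (f : C -> C) (c l : C) : Prop :=
  exists (e : C -> C) (K r : C), [/\ 0 < r, r <= 1 & forall s, 0 < s -> s <= r ->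
    f s = c + s * l + s ^+ 2 * e s /\ `|e s| <= K].

Lemma jet_cst c : has_jet (fun _ => c) c 0.
Proof. by exists (fun _ => 0), 0, 1; split=> // s _ _; rewrite normr0 !mulr0 !addr0. Qed.

Lemma jet_id : has_jet id 0 1.
Proof. by exists (fun _ => 0), 0, 1; split=> // s _ _;
  rewrite normr0 mulr1 mulr0 add0r addr0. Qed.

Lemma jet_common f g c l c' l' : has_jet f c l -> has_jet g c' l' ->
  exists (e e' : C -> C) (K K' r : C), [/\ 0 < r, r <= 1 & forall s, 0 < s -> s <= r ->
    [/\ f s = c + s * l + s ^+ 2 * e s, `|e s| <= K,
        g s = c' + s * l' + s ^+ 2 * e' s & `|e' s| <= K']].
Proof.
move=> [e [K [r [r0 r1 h]]]] [e' [K' [r' [r'0 r'1 h']]]].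
exists e, e', K, K'; have rr : r >=< r' by rewrite real_comparable ?gtr0_real.
exists (Num.min r r'); split; first by rewrite comparable_lt_min ?r0.
  by apply: le_trans r1; rewrite comparable_ge_min // lexx.
move=> s s0; rewrite comparable_le_min // => /andP[/(h s s0)[? ?] /(h' s s0)[? ?]].
by split.
Qed.

Lemma jetD f g c l c' l' : has_jet f c l -> has_jet g c' l' ->
  has_jet (fun s => f s + g s) (c + c') (l + l').
Proof.
move=> hf hg; have [e [e' [K [K' [r [r0 r1 h]]]]]] := jet_common hf hg.
exists (fun s => e s + e' s), (K + K'), r; split=> // s s0 sr.
have [-> eK -> e'K] := h s s0 sr; split; first by ring.
by apply: le_trans (ler_normD _ _) _; apply: lerD.
Qed.

Lemma jetM f g c l c' l' : has_jet f c l -> has_jet g c' l' ->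
  has_jet (fun s => f s * g s) (c * c') (c * l' + l * c').
Proof.
move=> hf hg; have [e [e' [K [K' [r [r0 r1 h]]]]]] := jet_common hf hg.
exists (fun s => l * l' + c * e' s + e s * c' + s * (l * e' s + e s * l') + s ^+ 2 * (e s * e'
  s)).
exists (`|l| * `|l'| + `|c| * K' + K * `|c'| + 1 * (`|l| * K' + K * `|l'|) + 1 * (K * K')), r.
split=> // s s0 sr; have [-> eK -> e'K] := h s s0 sr; split; first by ring.
have s1 : `|s| <= 1 by rewrite gtr0_norm // (le_trans sr).
have n2 : `|s ^+ 2| <= 1 by rewrite normrX exprn_ile1.
have K0 : 0 <= K := le_trans (normr_ge0 _) eK.
have K'0 : 0 <= K' := le_trans (normr_ge0 _) e'K.
by do ![apply: le_trans (ler_normD _ _) _; apply: lerD | rewrite normrM; apply: ler_pM].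
Qed.

Lemma jet_sum (I : Type) (r : seq I) (f : I -> C -> C) (c l : I -> C) :
  (forall i, has_jet (f i) (c i) (l i)) ->
  has_jet (fun s => \sum_(i <- r) f i s) (\sum_(i <- r) c i) (\sum_(i <- r) l i).
Proof.
move=> h; elim: r => [|i r IH].
  rewrite !big_nil (_ : (fun s => _) = fun _ => 0); first exact: jet_cst.
  by apply/funext => s; rewrite big_nil.
rewrite !big_cons (_ : (fun s => _) = fun s => f i s + \sum_(j <- r) f j s); first exact: jetD.
by apply/funext => s; rewrite big_cons.
Qed.

Definition mx_jet p q (F : C -> 'M[C]_(p, q)) (U L : 'M[C]_(p, q)) : Prop :=
  forall i j, has_jet (fun s => F s i j) (U i j) (L i j).

Lemma mx_jetM p q r (F : C -> 'M[C]_(p, q)) (G : C -> 'M[C]_(q, r)) U L U' L' :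
  mx_jet F U L -> mx_jet G U' L' ->
  mx_jet (fun s => F s *m G s) (U *m U') (U *m L' + L *m U').
Proof.
move=> hF hG i j; rewrite (_ : (fun s => _) = fun s => \sum_k F s i k * G s k j); last first.
  by apply/funext => s; rewrite mxE.
rewrite !mxE -big_split /=; apply: jet_sum => k; exact: jetM.
Qed.

Lemma mx_jetT p q (F : C -> 'M[C]_(p, q)) U L : mx_jet F U L ->
  mx_jet (fun s => (F s)^T) U^T L^T.
Proof.
move=> hF i j; rewrite (_ : (fun s => _) = fun s => F s j i) ?mxE //.
by apply/funext => s; rewrite mxE.
Qed.

(** If 0 = s l + O(s^2) for all small s then l = O(s). *)
Lemma jet_unique0 f l : geometrically_complete C -> has_jet f 0 l ->
  (exists2 r : C, 0 < r & forall s, 0 < s -> s <= r -> f s = 0) -> l = 0.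
Proof.
move=> Cc [e [K [r [r0 r1 h]]]] [r' r'0 h'].
have rr : r >=< r' by rewrite real_comparable ?gtr0_real.
pose t := Num.min r r'; have t0 : 0 < t by rewrite comparable_lt_min ?r0.
have tr : t <= r by rewrite comparable_ge_min // lexx.
have tr' : t <= r' by rewrite comparable_ge_min // lexx orbT.
have K0 : 0 <= K by have [_] := h _ r0 (lexx _); apply: le_trans.
apply: (@small_eq0 _ _ (t * K) Cc); first by rewrite mulr_ge0 // ltW.
move=> k; pose s := t * dyadic C k.
have d0 := dyadic_gt0 C k.
have s0 : 0 < s by rewrite mulr_gt0.
have st : s <= t.
  rewrite -[leRHS]mulr1 ler_wpM2l ?(ltW t0) //.
  by have := @dyadic_le C 0 k isT; rewrite [dyadic C 0]expr0.
have [fE eK] := h s s0 (le_trans st tr).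
move: fE; rewrite h' ?(le_trans st) // add0r => /esym/eqP.
rewrite expr2 -mulrA -mulrDr mulf_eq0 gt_eqF //= addr_eq0 => /eqP ->.
by rewrite normrN normrM gtr0_norm // [leRHS]mulrAC ler_wpM2l // ltW.
Qed.

End Jets.

Section HolomorphicJet.
Variables (C : numClosedFieldType) (n : nat).
Local Notation M := 'M[C]_n.

Lemma mx_monomialZ s (E : M) m : mx_monomial (s *: E) m = s ^+ mx_deg m * mx_monomial E m.
Proof.
rewrite /mx_monomial /mx_deg expr_sum -big_split /=; apply: eq_bigr => i _.
rewrite expr_sum -big_split /=; apply: eq_bigr => j _.
by rewrite mxE exprMn.
Qed.

Lemma sum_dyadic N : \sum_(d < N) dyadic C d <= 2.
Proof.
have -> : \sum_(d < N) dyadic C d = 2 - 2 * dyadic C N.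
  elim: N => [|N IH]; first by rewrite big_ord0 /dyadic expr0 mulr1 subrr.
  by rewrite big_ord_recr /= IH /dyadic exprS; field.
by rewrite lerBlDr lerDl mulr_ge0 // ltW // dyadic_gt0.
Qed.

Lemma fset_low_degree : exists J1 : {fset 'M[nat]_n},
  forall m, (mx_deg m <= 1)%N -> m \in J1.
Proof.
exists [fset m in [seq map_mx (@nat_of_ord 2) x | x : 'M['I_2]_n]]%fset => m m1.
have mE : m = map_mx (@nat_of_ord 2) (map_mx inord m); last first.
  rewrite !inE /= mE; apply/mapP; exists (map_mx inord m); first by rewrite mem_enum.
  by [].
apply/matrixP => i j; rewrite !mxE inordK //.
apply: (@leq_ltn_trans (mx_deg m)); last exact: m1.
rewrite /mx_deg (bigD1 i) //= (bigD1 j) //= -addnA.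
exact: leq_addr.
Qed.

(** Beyond some finite set J0 the partial sums are within 1 of the limit, and any
finite sum differs from such a partial sum by a sum over a part of J0. *)
Lemma bounded_partial_sums (t : 'M[nat]_n -> C) (f : C) :
  (summability.partial_sum t @ summability.totally --> f)%classic ->
  exists K : C, forall J : {fset 'M[nat]_n}, `|\sum_(m <- J) t m| <= K.
Proof.
move=> /totallyP/(_ 1 ltr01)[J0 hJ0].
exists (`|f| + 1 + \sum_(m <- J0) `|t m|) => J.
have E : \sum_(m <- J) t m = \sum_(m <- (J `|` J0)%fset) t m - \sum_(m <- (J0 `\` J)%fset) t m.
  apply/eqP; rewrite eq_sym subr_eq; apply/eqP.
  rewrite (big_fsetID _ (fun m => m \in J)) /=.
  have -> : [fset x in (J `|` J0) | x \in J]%fset = J.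
    by apply/fsetP => m; rewrite !inE /=; case: (m \in J); rewrite ?andbF.
  have -> : [fset x in (J `|` J0) | x \notin J]%fset = (J0 `\` J)%fset.
    by apply/fsetP => m; rewrite !inE /=; case: (m \in J); rewrite ?andbF ?andbT.
  by [].
rewrite E; apply: le_trans (ler_normB _ _) _; apply: lerD.
  rewrite -[X in `|X| <= _](subrK f) addrC; apply: le_trans (ler_normD _ _) _.
  rewrite lerD2l distrC; apply/ltW/hJ0; exact: fsubsetUr.
apply: le_trans (ler_norm_sum _ _ _) _.
rewrite [leRHS](big_fsetID _ (fun m => m \in J)) /= addrC.
rewrite (_ : [fset x in J0 | x \notin J]%fset = (J0 `\` J)%fset); last first.
  by apply/fsetP => m; rewrite !inE andbC.
by rewrite lerDl; apply: sumr_ge0.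
Qed.

Lemma norm_entry_lt (X : M) i j : `|X i j| < 1 + \sum_i \sum_j `|X i j|.
Proof.
apply: (@le_lt_trans _ _ (\sum_i \sum_j `|X i j|)); last by rewrite ltrDr ltr01.
rewrite (bigD1 i) //= (bigD1 j) //= -addrA lerDl addr_ge0 ?sumr_ge0 // => k _.
exact: sumr_ge0.
Qed.

(** Along the line s X the series is regrouped by degree.  Its terms of a given degree
d, taken at a fixed point r X, have bounded partial sums by bounded_partial_sums;
at s r X they are multiplied by s^d, so those of degree at least 2 contribute
O(s^2) for s <= 1/2. *)
Lemma holomorphic_jet (f : M -> C) (X : M) : geometrically_complete C ->
  holomorphic_at0 f -> exists l, has_jet (fun s => f (s *: X)) (f 0) l.
Proof.
move=> Cc [a /near0P[e e0 he]].
pose x0 : C := 1 + \sum_i \sum_j `|X i j|.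
have x01 : 1 <= x0 by rewrite lerDl; apply: sumr_ge0 => i _; apply: sumr_ge0.
have x0_gt0 : 0 < x0 := lt_le_trans ltr01 x01.
have Xx i j : `|X i j| < x0 by apply: norm_entry_lt.
pose r : C := e / x0; have r0 : 0 < r by rewrite divr_gt0.
have rX i j : `|(r *: X) i j| < e.
  by rewrite mxE normrM gtr0_norm // /r mulrAC ltr_pdivrMr // ltr_pM2l.
pose t m := a m * mx_monomial (r *: X) m.
have [K hK] := bounded_partial_sums (he _ rX).
have K0 : 0 <= K by have := hK fset0; apply: le_trans.
have [J1 hJ1] := fset_low_degree.
pose c := \sum_(m <- J1 | mx_deg m == 0%N) t m; pose l := \sum_(m <- J1 | mx_deg m == 1%N) t m.
have approx s : 0 <= s -> s <= 2^-1 -> `|f (s *: (r *: X)) - (c + s * l)| <= 8 * K * s ^+ 2.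
  move=> s0 s1; have s1' : s <= 1 by apply: le_trans s1 _; rewrite invf_le1 ?ler1n.
  have sX : mx_lt (s *: (r *: X)) e.
    move=> i j; rewrite mxE normrM ger0_norm //; apply: le_lt_trans (rX i j).
    by rewrite ler_piMl.
  have /totallyP lim := he _ sX.
  apply: (@le_dyadic_le _ _ _ 1 Cc) => //; first exact: normr_real.
    by rewrite ger0_real // !mulr_ge0 // exprn_ge0.
  move=> k; have [J2 hJ2] := lim _ (dyadic_gt0 C k).
  pose J := (J1 `|` J2)%fset; have := hJ2 J (fsubsetUr _ _).
  have -> : \sum_(m <- J) a m * mx_monomial (s *: (r *: X)) m = \sum_(m <- J) s ^+ mx_deg m * t m.
    by apply: eq_bigr => m _; rewrite mx_monomialZ mulrCA.
  have low d : (d <= 1)%N -> \sum_(m <- J | mx_deg m == d) s ^+ mx_deg m * t m =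
      s ^+ d * \sum_(m <- J1 | mx_deg m == d) t m.
    move=> d1; rewrite mulr_sumr [RHS](eq_bigr (fun m => s ^+ mx_deg m * t m)); last first.
      by move=> m /eqP ->.
    rewrite -[LHS]big_filter -[RHS]big_filter; apply: perm_big; apply: uniq_perm.
    - by rewrite filter_uniq ?fset_uniq.
    - by rewrite filter_uniq ?fset_uniq.
    move=> m; rewrite !mem_filter inE; case: eqP => //= md; rewrite hJ1 // md.
    exact: d1.
  (* Degrees 0 and 1 give the first-order expansion. *)
  have split : \sum_(m <- J) s ^+ mx_deg m * t m = c + s * l +
      \sum_(m <- J | (1 < mx_deg m)%N) s ^+ mx_deg m * t m.
    rewrite (bigID (fun m => 1 < mx_deg m)%N) /= addrC; congr (_ + _).
    rewrite (bigID (fun m => mx_deg m == 0%N)) /= -[c]mul1r -(expr0 s) -[s in RHS]expr1.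
    rewrite -low // -low //; congr (_ + _); apply: eq_bigl => m; case: (mx_deg m) => // -[] //.
  pose D := \max_(m <- J) mx_deg m.
  have leD m : m \in J -> (mx_deg m <= D)%N by move=> mJ; rewrite /D (big_rem m) //= leq_maxl.
  have tailE : \sum_(m <- J | (1 < mx_deg m)%N) s ^+ mx_deg m * t m =
      \sum_(d < D.+1 | (1 < d)%N) s ^+ d * \sum_(m <- J | mx_deg m == d) t m.
    rewrite [RHS](eq_bigr (fun d : 'I_D.+1 => \sum_(m <- J | mx_deg m == d) s ^+ mx_deg m * t
      m)); last first.
      by move=> d _; rewrite mulr_sumr; apply: eq_bigr => m /eqP ->.
    rewrite (exchange_big_dep (fun m => 1 < mx_deg m)%N) /=; last by move=> d m h /eqP ->.
    rewrite big_seq_cond [RHS]big_seq_cond; apply: eq_bigr => m /andP[mJ m1].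
    rewrite (bigD1 (inord (mx_deg m))) /=; last by rewrite inordK ?m1 ?eqxx // ltnS leD.
    rewrite big1 ?addr0 // => d /andP[/andP[_ /eqP md]] /eqP []; apply: val_inj.
    by rewrite /= inordK // ltnS leD.
  have tail_le : `|\sum_(m <- J | (1 < mx_deg m)%N) s ^+ mx_deg m * t m| <= 8 * K * s ^+ 2.
    rewrite tailE; apply: le_trans (ler_norm_sum _ _ _) _.
    apply: (@le_trans _ _ (\sum_(d < D.+1) (4 * K * s ^+ 2) * dyadic C d)); last first.
      rewrite -mulr_sumr (_ : 8 * K * s ^+ 2 = (4 * K * s ^+ 2) * 2); last by ring.
      by rewrite ler_wpM2l ?sum_dyadic // !mulr_ge0 ?exprn_ge0.
    rewrite [leRHS](bigID (fun d : 'I_D.+1 => 1 < d)%N) /= -[leLHS]addr0; apply: lerD; last first.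
      by apply: sumr_ge0 => d _; rewrite mulr_ge0 ?dyadic_ge0 // !mulr_ge0 ?exprn_ge0.
    apply: ler_sum => d d1; rewrite normrM normrX ger0_norm //.
    have -> : (d : nat) = (d - 2 + 2)%N by rewrite subnK.
    rewrite (_ : 4 * K * s ^+ 2 * dyadic C (d - 2 + 2) = dyadic C (d - 2) * s ^+ 2 * K);
      last first.
      by rewrite /dyadic exprD; field.
    rewrite exprD; apply: ler_pM; rewrite ?mulr_ge0 ?exprn_ge0 //.
      by rewrite ler_wpM2r ?exprn_ge0 // /dyadic; apply: lerXn2r; rewrite ?nnegrE ?invr_ge0.
    by rewrite big_fset_condE; apply: hK.
  rewrite split => h; rewrite mul1r.
  set T := \sum_(m <- J | (1 < mx_deg m)%N) _ in tail_le h.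
  rewrite (_ : f _ - _ = T + (f (s *: (r *: X)) - (c + s * l + T))); last by ring.
  by apply: le_trans (ler_normD _ _) _; apply: lerD => //; apply: ltW.
have f0 : f 0 = c.
  have := approx 0 (lexx _); rewrite invr_ge0 ler0n => /(_ isT).
  by rewrite scale0r mul0r addr0 expr2 !mulr0 normr_le0 subr_eq0 => /eqP.
(* The variable s r of the estimate is renamed s, which divides l by r. *)
pose r1 := r / 2.
have r10 : 0 < r1 by rewrite divr_gt0.
have rr : r1 >=< 1 by rewrite real_comparable ?gtr0_real.
exists (l / r), (fun s => (f (s *: X) - (c + s * (l / r))) / s ^+ 2), (8 * K / r ^+ 2),
  (Num.min r1 1).
split; first by rewrite comparable_lt_min ?r10 //= ltr01.
  by rewrite comparable_ge_min // lexx orbT.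
move=> s s0; rewrite comparable_le_min // => /andP[sr _]; split.
  by rewrite f0 [s ^+ 2 * _]mulrC divfK ?sqrf_eq0 ?gt_eqF // addrC subrK.
have sr0 : 0 <= s / r by rewrite divr_ge0 // ltW.
have sr1 : s / r <= 2^-1 by rewrite ler_pdivrMr // mulrC.
have := approx _ sr0 sr1; rewrite scalerA divfK ?gt_eqF //.
rewrite (_ : s / r * l = s * (l / r)); last by rewrite mulrAC mulrA.
rewrite normrM [ `|_^-1| ]gtr0_norm ?invr_gt0 ?exprn_gt0 // ler_pdivrMr ?exprn_gt0 //.
rewrite (_ : 8 * K * (s / r) ^+ 2 = 8 * K / r ^+ 2 * s ^+ 2) //.
by field; rewrite gt_eqF.
Qed.

End HolomorphicJet.

(** * Minimality of the number of stars *)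

Section Minimality.
Variables (C : numClosedFieldType) (n : nat).
Local Notation M := 'M[C]_n.

(** The first-order term at A of the reduction along s X' is the sum of S^T X' S and
of a tangent vector at Acan, and it fits Q since the deformation does.  Every X
is of the form S^T X' S. *)
Lemma tangent_cover (A Acan S : M) (Q : 'M[bool]_n) F : geometrically_complete C ->
  S \in unitmx -> S^T *m A *m S = Acan -> reduces_to A Acan S Q F ->
  forall X, exists L, fits_pattern Q (X + (L^T *m Acan + Acan *m L)).
Proof.
move=> Cc Su SA [[hF F0 _] hQ _] X0.
pose X := (invmx S)^T *m X0 *m invmx S.
have SX : S^T *m X *m S = X0.
  by rewrite /X !mulmxA -trmx_mul mulVmx // trmx1 mul1mx mulmxKV.
have /choice[l hl] : forall ij : 'I_n * 'I_n, exists l, has_jet (fun s => F (s *: X) ij.1 ij.2)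
  (S ij.1 ij.2) l.
  by move=> -[i j]; have [l hl] := holomorphic_jet X Cc (hF i j); exists l; rewrite F0 in hl.
pose L : M := \matrix_(i, j) l (i, j).
have jF : mx_jet (fun s => F (s *: X)) S L.
  by move=> i j; rewrite mxE; apply: (hl (i, j)).
have jE : mx_jet (fun s => A + s *: X) A X.
  move=> i j; rewrite (_ : (fun s => _) = fun s => A i j + s * X i j); last first.
    by apply/funext => s; rewrite !mxE.
  rewrite -[X in has_jet _ X _](addr0 (A i j)) -[X in has_jet _ _ X](add0r (X i j)).
  apply: jetD; first exact: jet_cst.
  rewrite -[X in has_jet _ X _](mul0r (X i j)).
  rewrite (_ : X i j = 0 * 0 + 1 * X i j); last by rewrite mul0r add0r mul1r.
  have := jetM (jet_id C) (jet_cst (X i j)).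
  by rewrite mulr0 add0r !mul1r mul0r.
exists (invmx S *m L).
have TE : X0 + ((invmx S *m L)^T *m Acan + Acan *m (invmx S *m L)) =
    S^T *m A *m L + (S^T *m X + L^T *m A) *m S.
  have -> : (invmx S *m L)^T *m Acan = L^T *m A *m S.
    rewrite -SA trmx_mul !mulmxA -[L^T *m (invmx S)^T *m S^T]mulmxA.
    by rewrite -[(invmx S)^T *m S^T]trmx_mul mulmxV // trmx1 mulmx1.
  have -> : Acan *m (invmx S *m L) = S^T *m A *m L by rewrite -SA -!mulmxA mulKVmx.
  by rewrite -SX mulmxDl addrA addrC.
rewrite TE => i j nQ.
have := mx_jetM (mx_jetM (mx_jetT jF) jE) jF i j; rewrite SA => jd.
apply: (@jet_unique0 _ (fun s => deformation A Acan F (s *: X) i j)) => //.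
  rewrite (_ : (fun s => _) = fun s =>
    ((F (s *: X))^T *m (A + s *: X) *m F (s *: X)) i j + - Acan i j); last first.
    by apply/funext => s; rewrite /deformation mxE [(- Acan) i j]mxE.
  rewrite -(subrr (Acan i j)) -[X in has_jet _ _ X]addr0; apply: jetD => //.
  exact: jet_cst.
case/near0P: hQ => e e0 he.
pose x0 : C := 1 + \sum_i \sum_j `|X i j|.
have x01 : 1 <= x0 by rewrite lerDl; apply: sumr_ge0 => k _; apply: sumr_ge0.
have x0_gt0 : 0 < x0 := lt_le_trans ltr01 x01.
exists (e / x0) => [|s s0 sr]; first exact: divr_gt0.
apply: he nQ => k k'; rewrite mxE normrM gtr0_norm //.
apply: (@le_lt_trans _ _ (e / x0 * `|X k k'|)); first by rewrite ler_wpM2r.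
by rewrite mulrAC ltr_pdivrMr // ltr_pM2l // norm_entry_lt.
Qed.

Lemma dual_sys_lin (A : M) (I : finType) (c : I -> C) (Z : I -> M) :
  (forall k, dual_sys A (Z k)) -> dual_sys A (\sum_k c k *: Z k).
Proof.
move=> h; rewrite /dual_sys linear_sum /= !mulmx_sumr -big_split /= big1 // => k _.
by rewrite linearZ /= -!scalemxAr -scalerDr h scaler0.
Qed.

(** Solutions Z a of the dual equation that form a dual basis on the stars of P give
a matrix of values on the stars of Q whose rows are independent, because a
solution vanishing on Q is orthogonal to everything. *)
Theorem star_count_minimal (A Acan S : M) (P Q : 'M[bool]_n) F : geometrically_complete C ->
  S \in unitmx -> S^T *m A *m S = Acan -> unisolvent (dual_sys Acan) P ->
  reduces_to A Acan S Q F -> (star_count P <= star_count Q)%N.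
Proof.
move=> Cc Su SA [_ exP] /(tangent_cover Cc Su SA) cover.
have uniqQ Z : dual_sys Acan Z -> agree_on Q Z 0 -> Z = 0.
  move=> hZ QZ; apply: trace_form_eq0 => X; have [L hL] := cover X.
  have : \tr ((X + (L^T *m Acan + Acan *m L))^T *m Z) = 0.
    rewrite trace_form_sum big1 // => i _; rewrite big1 // => j _.
    case: (boolP (Q i j)) => [/QZ ->|/hL ->]; first by rewrite [X in _ * X]mxE mulr0.
    by rewrite mul0r.
  by rewrite linearD /= mulmxDl mxtraceD tangent_adjoint hZ mulmx0 linear0 addr0.
rewrite /star_count; set PP := [pred _ | _]; set QQ := [pred _ | _].
have /choice[Z hZ] : forall a : 'I_#|PP|, exists Z, dual_sys Acan Z /\
    agree_on P Z (\matrix_(i, j) ((i, j) == enum_val a)%:R).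
  by move=> a; have [Z ? ?] := exP (\matrix_(i, j) ((i, j) == enum_val a)%:R); exists Z.
pose N : 'M[C]_(#|PP|, #|QQ|) := \matrix_(a, b) Z a (enum_val b).1 (enum_val b).2.
suff /eqP <- : row_free N by apply: rank_leq_col.
apply: inj_row_free => v vN.
have Z0 : \sum_a v 0 a *: Z a = 0.
  apply: uniqQ; first by apply: dual_sys_lin => a; have [] := hZ a.
  move=> i j Qij; have QQij : (i, j) \in QQ by [].
  rewrite summxE mxE; have /matrixP/(_ 0 (enum_rank_in QQij (i, j))) := vN.
  rewrite !mxE => h; rewrite -[RHS]h; apply: eq_bigr => a _.
  by rewrite !mxE enum_rankK_in.
apply/rowP => a; rewrite mxE.
have Pa : P (enum_val a).1 (enum_val a).2 by have := enum_valP a.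
have /matrixP/(_ (enum_val a).1 (enum_val a).2) := Z0.
rewrite summxE mxE => h; rewrite -[RHS]h (bigD1 a) //= big1 => [|b /negPf ba]; last first.
  rewrite mxE; have [_ ->] := hZ b => //; rewrite mxE -surjective_pairing.
  by rewrite (inj_eq enum_val_inj) eq_sym ba mulr0.
rewrite addr0 mxE; have [_ ->] := hZ a => //.
by rewrite mxE -surjective_pairing eqxx mulr1.
Qed.

End Minimality.

Local Open Scope complex_scope.

Theorem theorem2p2 (R : realType) (t : nat) (B : 'I_t -> block R[i])
    (A S : 'M[R[i]]_(\sum_i bsize (B i)))
    (P : 'M[bool]_(\sum_i bsize (B i)))
    (hB : canonical_blocks B)
    (hS : S \in unitmx)
    (hA : S^T *m A *m S = canonical_mx B)
    (hP : canonical_pattern P) :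
  (exists F, reduces_to A (canonical_mx B) S P F) /\
  (forall (Q : 'M[bool]_(\sum_i bsize (B i))) F,
     reduces_to A (canonical_mx B) S Q F -> (star_count P <= star_count Q)%N).
Proof.
have Cc := complex_complete R; have uni := canonical_unisolvent hB hP.
split; first exact: exists_holomorphic_reduction uni.1.
by move=> Q F; exact: star_count_minimal.
Qed.
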